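(* Let $E$ be a holomorphic vector bundle over $\mathbb{C}$ with a compatible Hermitian metric, and suppose there are constants $\kappa_0>0$ and $\epsilon_0>0$ such that for all $0<\epsilon<\epsilon_0$ and all compactly supported smooth sections $s\in C^\infty_c(E)$, $$\kappa_0\int_{\mathbb{C}}|s|^2e^{-\epsilon|z|}\,dx\,dy\le\int_{\mathbb{C}}|\overline{\partial}s|^2e^{-\epsilon|z|}\,dx\,dy .$$ Assume that $E$ is the complexification of some real vector bundle $\xi$ over $\mathbb{C}$. Then for any $0<\epsilon<\min\left(\frac{\epsilon_0}{2},\frac{\sqrt{\kappa_0}}{2}\right)$ there exists a non-trivial (i.e. not identically zero) holomorphic section $s\in L^2(E,e^{-4\epsilon|z|})$, that is, $\overline{\partial}s=0$ and $$\int_{\mathbb{C}}|s|^2e^{-4\epsilon|z|}\,dx\,dy<\infty .$$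
   Context: $\mathbb{C}$ carries the standard flat metric $dx^2+dy^2=|dz|^2$. Vector bundles have positive rank. $E$ has a connection $\nabla$ compatible with its Hermitian metric and its holomorphic structure, and $\overline{\partial}s=(\nabla_{\partial/\partial\overline{z}}s)\otimes d\overline{z}$, where $\partial/\partial\overline z=\frac12(\partial_x+i\partial_y)$; norms are normalized so that $|s\otimes d\overline{z}|=|s|$. A section $s$ is holomorphic if $\overline{\partial}s=0$. ''$E$ is the complexification of a real vector bundle $\xi$'' means $E=\xi\otimes_{\mathbb{R}}\mathbb{C}$, where the Hermitian metric of $E$ is the Hermitian extension of a Euclidean bundle metric on $\xi$ and $\nabla$ is the complex-linear extension of a metric connection on $\xi$; in particular $\overline{E}=E$ and $\overline{\nabla_{\partial/\partial\overline{z}}s}=\nabla_{\partial/\partial z}\overline{s}$, $|\overline{s}|=|s|$. For a positive continuous function $\varphi$ on $\mathbb{C}$, $L^2(E,\varphi)$ is the Hilbert space completion of $C^\infty_c(E)$ under the norm $\|s\|_{L^2(E,\varphi)}=\left(\int_{\mathbb{C}}|s|^2\varphi\,dx\,dy\right)^{1/2}$, i.e. the space of measurable sections with finite norm. *)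

(* Defs.v *)
From HB Require Import structures.
From mathcomp Require Import all_boot all_order all_algebra.
From mathcomp Require Import complex.
From mathcomp Require Import all_classical all_reals all_analysis.
Import Order.TTheory GRing.Theory Num.Theory numFieldNormedType.Exports.

Set Implicit Arguments.
Unset Strict Implicit.
Unset Printing Implicit Defensive.

Local Open Scope classical_set_scope.
Local Open Scope ring_scope.
Local Open Scope complex_scope.

(** The base of all bundles is the complex plane, presented as [R * R] through
    z = x + i y.  The library norm of [R * R] is the sup norm, so |z| is
    [modulus z] below. *)
Definition modulus (R : realType) (z : R * R) : R :=
  Num.sqrt (z.1 ^+ 2 + z.2 ^+ 2).

Definition plane_measure (R : realType) :
    {measure set (measurableTypeR R * measurableTypeR R)%type -> \bar R} :=
  (@lebesgue_measure R \x @lebesgue_measure R)%E.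

(** Every iterated directional derivative exists and is differentiable (hence
    continuous) on the set; for open [U] this is C^oo on [U]. *)
Definition rsmooth_on (R : realType) (U : set (R * R)) (f : R * R -> R) : Prop :=
  forall (vs : seq (R * R)) (z : R * R), U z ->
    differentiable (foldr (fun v (g : R * R -> R) => 'D_v g) f vs) z.

Definition csmooth_on (R : realType) (U : set (R * R)) (f : R * R -> R[i]) :
    Prop :=
  rsmooth_on U (fun z => complex.Re (f z)) /\
  rsmooth_on U (fun z => complex.Im (f z)).

Definition cderive (R : realType) (v : R * R) (f : R * R -> R[i]) (z : R * R) :
    R[i] :=
  'D_v (fun w => complex.Re (f w)) z +i* 'D_v (fun w => complex.Im (f w)) z.

(** d/dzbar = (d/dx + i d/dy) / 2 *)
Definition cderive_zbar (R : realType) (f : R * R -> R[i]) (z : R * R) : R[i] :=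
  2^-1 * (cderive (1, 0) f z + 'i%C * cderive (0, 1) f z).

Definition holomorphic_on (R : realType) (U : set (R * R))
    (f : R * R -> R[i]) : Prop :=
  csmooth_on U f /\ forall z, U z -> cderive_zbar f z = 0.

(** The data that distinguish real from complex coefficients, so that real and
    complex bundles, Euclidean and Hermitian metrics, and their connections are
    instances of the same definitions. *)
Record coeffs (R : realType) (K : numDomainType) := Coeffs {
  emb : R -> K;
  cconj : K -> K;
  smooth_on : set (R * R) -> (R * R -> K) -> Prop;
  dderive : R * R -> (R * R -> K) -> R * R -> K
}.

(** The ordered field is found by unification, which keeps the canonical
    instance free of reverse coercions. *)
Definition real_coeffs (R : realType) :=
  Coeffs (@id R) (@id R) (@rsmooth_on R) (fun v f => 'D_v f).

Definition complex_coeffs (R : realType) :=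
  Coeffs (fun a : R => a%:C : R[i]) (@conjc R) (@csmooth_on R) (@cderive R).

(** Vector bundles of rank [n] over the plane: a family of [K]-vector spaces
    with local trivializations over an open cover whose transition functions
    are regular, regularity being [rsmooth_on] or [holomorphic_on].
    [triv i z] and its inverse [untriv i z] are constrained only for
    [z] in [dom i]. *)
Record vbundle (R : realType) (K : numDomainType)
    (regular : set (R * R) -> (R * R -> K) -> Prop) (n : nat) := VBundle {
  fiber :> R * R -> lmodType K;
  chart : Type;
  dom : chart -> set (R * R);
  triv : forall (i : chart) (z : R * R), fiber z -> 'cV[K]_n;
  untriv : forall (i : chart) (z : R * R), 'cV[K]_n -> fiber z;
  dom_open : forall i, open (dom i);
  dom_cover : forall z, exists i, dom i z;
  triv_linear : forall i z, dom i z -> linear (@triv i z);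
  trivK : forall i z, dom i z -> cancel (@triv i z) (@untriv i z);
  untrivK : forall i z, dom i z -> cancel (@untriv i z) (@triv i z);
  transition_regular : forall i j (a : 'cV[K]_n) (k : 'I_n),
    regular (dom i `&` dom j)
      (fun z => @triv i z (@untriv j z a) k ord0)
}.
Arguments triv {R K regular n} v i z _.
Arguments untriv {R K regular n} v i z _.
Arguments dom {R K regular n} v _ _.

Definition section (R : realType) (K : numDomainType)
    (regular : set (R * R) -> (R * R -> K) -> Prop) (n : nat)
    (E : vbundle regular n) : Type := forall z : R * R, E z.

Definition smooth_section (R : realType) (K : numDomainType) (c : coeffs R K)
    (regular : set (R * R) -> (R * R -> K) -> Prop) (n : nat)
    (E : vbundle regular n) (s : section E) : Prop :=
  forall (i : chart E) (k : 'I_n),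
    smooth_on c (dom E i) (fun z => triv E i z (s z) k ord0).

Definition compactly_supported (R : realType) (K : numDomainType)
    (regular : set (R * R) -> (R * R -> K) -> Prop) (n : nat)
    (E : vbundle regular n) (s : section E) : Prop :=
  exists A : set (R * R), compact A /\ forall z, ~ A z -> s z = 0.

(** A Euclidean (resp. Hermitian, linear in the first argument) bundle metric.
    For complex coefficients [0 < x] says that [x] is real and positive. *)
Record is_metric (R : realType) (K : numDomainType) (c : coeffs R K)
    (regular : set (R * R) -> (R * R -> K) -> Prop) (n : nat)
    (E : vbundle regular n) (h : forall z : R * R, E z -> E z -> K) : Prop := {
  metric_linear : forall z (a : K) (u v w : E z),
    h z (a *: u + v) w = a * h z u w + h z v w;
  metric_sym : forall z (u v : E z), h z v u = cconj c (h z u v);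
  metric_pos : forall z (u : E z), u != 0 -> 0 < h z u u;
  metric_smooth : forall s t : section E,
    smooth_section c s -> smooth_section c t ->
    smooth_on c [set: R * R] (fun z => h z (s z) (t z))
}.

(** A covariant derivative: [D v s] is nabla_v s for the constant vector field
    [v]; since these frame the tangent bundle of the plane, they determine
    nabla.  Only the values of [D v] on smooth sections matter. *)
Record is_connection (R : realType) (K : numDomainType) (c : coeffs R K)
    (regular : set (R * R) -> (R * R -> K) -> Prop) (n : nat)
    (E : vbundle regular n) (D : R * R -> section E -> section E) : Prop := {
  conn_smooth : forall v (s : section E),
    smooth_section c s -> smooth_section c (D v s);
  conn_dir : forall (a : R) (v w : R * R) (s : section E) z,
    smooth_section c s ->
    D (a *: v + w) s z = emb c a *: D v s z + D w s z;
  conn_add : forall v (s t : section E) z,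
    smooth_section c s -> smooth_section c t ->
    D v (fun y => s y + t y) z = D v s z + D v t z;
  conn_leibniz : forall v (f : R * R -> K) (s : section E) z,
    smooth_on c [set: R * R] f -> smooth_section c s ->
    D v (fun y => f y *: s y) z = dderive c v f z *: s z + f z *: D v s z
}.

(** A vector bundle with a bundle metric and a metric connection. *)
Record metric_bundle (R : realType) (K : numDomainType) (c : coeffs R K)
    (regular : set (R * R) -> (R * R -> K) -> Prop) (n : nat) := MetricBundle {
  mbundle :> vbundle regular n;
  metric : forall z : R * R, mbundle z -> mbundle z -> K;
  nabla : R * R -> section mbundle -> section mbundle;
  metricP : is_metric c metric;
  nablaP : is_connection c nabla;
  nabla_metric : forall v (s t : section mbundle) z,
    smooth_section c s -> smooth_section c t ->
    dderive c v (fun y => metric (s y) (t y)) z =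
      metric (nabla v s z) (t z) + metric (s z) (nabla v t z)
}.
Arguments metric {R K c regular n} m z _ _.
Arguments nabla {R K c regular n} m v s z.

Definition euclidean_bundle (R : realType) (n : nat) :=
  metric_bundle (real_coeffs R) (@rsmooth_on R) n.

(** dbar s = (nabla_{d/dzbar} s) (x) dzbar is identified with its coefficient
    nabla_{d/dzbar} s, which has the same pointwise norm. *)
Definition dbar (R : realType) (n : nat)
    (E : metric_bundle (complex_coeffs R) (@holomorphic_on R) n)
    (s : section E) : section E :=
  fun z => (2^-1 : R[i]) *:
    (nabla E (1, 0) s z + ('i%C : R[i]) *: nabla E (0, 1) s z).

(** A holomorphic vector bundle with a Hermitian metric and a connection
    compatible with both: in the holomorphic trivializations nabla_{d/dzbar}
    is d/dzbar. *)
Record hermitian_holomorphic_bundle (R : realType) (n : nat) := HHBundle {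
  hhbundle :> metric_bundle (complex_coeffs R) (@holomorphic_on R) n;
  nabla_holomorphic : forall (s : section hhbundle) (i : chart hhbundle) z
      (k : 'I_n),
    smooth_section (complex_coeffs R) s -> dom hhbundle i z ->
    triv hhbundle i z (dbar s z) k ord0 =
      cderive_zbar (fun w => triv hhbundle i w (s w) k ord0) z
}.

(** E = xi (x)_R C.  The maps [iota z], u |-> u (x) 1, identify [E z] with
    [xi z (+) i xi z], smoothly in [z]; as the metric of [E] is sesquilinear and
    its connection complex linear, they are the Hermitian and the
    complex-linear extension of those of [xi] as soon as they agree with them
    on [xi]. *)
Record is_complexification (R : realType) (n : nat) (xi : euclidean_bundle R n)
    (E : hermitian_holomorphic_bundle R n)
    (iota : forall z : R * R, xi z -> E z) : Prop := {
  iota_linear : forall z (a : R) (u v : xi z),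
    iota z (a *: u + v) = (a%:C : R[i]) *: iota z u + iota z v;
  iota_decomp : forall z (e : E z), exists! uv : xi z * xi z,
    e = iota z uv.1 + ('i%C : R[i]) *: iota z uv.2;
  iota_smooth : forall u v : section xi,
    smooth_section (complex_coeffs R)
      ((fun z => iota z (u z) + ('i%C : R[i]) *: iota z (v z)) : section E) <->
    smooth_section (real_coeffs R) u /\ smooth_section (real_coeffs R) v;
  iota_metric : forall z (u v : xi z),
    metric E z (iota z u) (iota z v) = (metric xi z u v)%:C;
  iota_nabla : forall w (u : section xi) z,
    smooth_section (real_coeffs R) u ->
    nabla E w (fun y => iota y (u y)) z = iota z (nabla xi w u z)
}.

(** |s|^2 *)
Definition normsq (R : realType) (n : nat)
    (E : hermitian_holomorphic_bundle R n) (s : section E) (z : R * R) : R :=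
  complex.Re (metric E z (s z) (s z)).

(** || s ||_{L^2(E, phi)}^2 *)
Definition L2normsq (R : realType) (n : nat)
    (E : hermitian_holomorphic_bundle R n) (phi : R * R -> R) (s : section E) :
    \bar R :=
  (\int[plane_measure R]_z (normsq s z * phi z)%:E)%E.

Definition measurable_section (R : realType) (n : nat)
    (E : hermitian_holomorphic_bundle R n) (s : section E) : Prop :=
  forall (i : chart E) (k : 'I_n),
    measurable_fun (dom E i)
      (fun z => complex.Re (triv E i z (s z) k ord0)) /\
    measurable_fun (dom E i)
      (fun z => complex.Im (triv E i z (s z) k ord0)).

Definition in_L2 (R : realType) (n : nat)
    (E : hermitian_holomorphic_bundle R n) (phi : R * R -> R) (s : section E) :
    Prop :=
  measurable_section s /\ (L2normsq phi s < +oo)%E.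

Definition holomorphic_section (R : realType) (n : nat)
    (E : hermitian_holomorphic_bundle R n) (s : section E) : Prop :=
  smooth_section (complex_coeffs R) s /\ forall z, dbar s z = 0.

Definition exp_weight (R : realType) (a : R) (z : R * R) : R :=
  expR (- a * modulus z).

(* Main.v *)
Require Import Defs.
From HB Require Import structures.
From mathcomp Require Import all_boot all_order all_algebra.
From mathcomp Require Import complex.
From mathcomp Require Import all_classical all_reals all_analysis.
From mathcomp Require Import measurable_realfun ring lra.
Import Order.TTheory GRing.Theory Num.Theory numFieldNormedType.Exports.

(** The idea: solve dbar v = dbar e / z for a local holomorphic section e, cut off,
    and take s = e - z v. Then dbar s = 0, and s is not zero because z v vanishes at
    the origin while e does not.

    The equation for v is solved with Hilbert space methods. The spectral gap bounds
    dbar from below, whereas solving dbar v = f needs a lower bound for its adjoint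
    -nabla_z. The real structure supplies it: conjugation is an isometry that
    exchanges the two operators ([conj_section]), so nabla_z has the same gap. Its
    weight e^(-a|z|), a = 2 eps, is replaced by the growing weight w = e^(a<z>),
    <z> = (1 + |z|^2)^(1/2), by applying the gap to w t; since a^2 < kappa0, the
    derivative of w is absorbed ([gap_grow]). The result,
    ||t||_w <= K ||nabla_z t||_w for test sections t, bounds the functional
    t |-> Re <f, t> by the energy ||nabla_z t||_w^2, so it has an (approximate)
    Riesz representative t_k ([approx_riesz]); v_k = - w nabla_z t_k solves
    dbar v_k = f in the limit, with the integral of |v_k|^2 / w bounded. The
    factor z in s_k = e - z v_k costs a second factor of w, whence the decay rate
    4 eps of the statement ([weak_limit_exists]).

    No completion is formed: the limit of the s_k is a functional L on test sections
    that vanishes on the image of nabla_z. Pairing L with a frame dual to a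
    holomorphic one turns this into the weak Cauchy-Riemann equations, and Weyl's
    lemma ([weyl]) makes L integration against a holomorphic section, first locally
    ([local_representation]) and then globally ([global_representation]). Weyl's
    lemma itself rests on one computation: kernels obtained by truncating the
    Cauchy kernel at two radii differ by the divergence of a curl-free field with
    compact support ([rho_diff]), so a weakly holomorphic functional has the same
    mean for both. The bound on L in the dual norm gives square integrability
    ([representation_L2], [L2_of_cutoffs]); its value on a small bump times a dual
    frame section is positive ([source_test]), so the section is not zero. *)

Set Implicit Arguments.
Unset Strict Implicit.
Unset Printing Implicit Defensive.

Local Open Scope classical_set_scope.
Local Open Scope ring_scope.

(** * Smooth functions of two real variables *)

Definition lin2 (R : realType) (a b : R) (h : R * R) : R := a * h.1 + b * h.2.

Lemma lin2_linear (R : realType) (a b : R) : linear (lin2 a b).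
Proof. by move=> k [x1 x2] [y1 y2]; rewrite /lin2 /= /GRing.scale/=; ring. Qed.

HB.instance Definition _ (R : realType) (a b : R) :=
  GRing.isLinear.Build R (R * R)%type R _ (lin2 a b) (@lin2_linear R a b).

Section Smooth.
Variable R : realType.
Implicit Types (U V : set (R * R)) (f g h : R * R -> R) (v z : R * R).

Lemma lin2_continuous (a b : R) : continuous (lin2 a b).
Proof.
move=> z; apply: (@cvgD _ R^o); apply: cvgM; try exact: cvg_cst.
  exact: cvg_fst.
exact: cvg_snd.
Qed.

Lemma lin2_ext (L : {linear (R * R)%type -> R}) : 
  L =1 lin2 (L (1, 0)) (L (0, 1)).
Proof.
move=> [x y]; rewrite /lin2 /=.
have -> : (x, y) = x *: (1, 0) + y *: (0, 1) :> R * R.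
  rewrite [RHS]surjective_pairing; congr pair => /=.
    by rewrite scaler0 addr0 -[x *: _]/(x * 1) mulr1.
  by rewrite scaler0 add0r -[y *: _]/(y * 1) mulr1.
by rewrite linearD !linearZ/= /GRing.scale/= mulrC [y * _]mulrC.
Qed.

(** Functions without a formula, such as functionals of a translated test
    function, are differentiated by estimating the remainder. *)
Lemma diff_eps f z (a b : R) :
  (forall e : R, 0 < e -> exists2 d : R, 0 < d & forall h : R * R, `|h| < d ->
     `|f (z + h) - f z - lin2 a b h| <= e * `|h|) ->
  differentiable f z /\ 'd f z = lin2 a b :> (R * R -> R).
Proof.
move=> H.
have K e : 0 < e -> \forall h \near (0 : R * R),
    `|f (h + z) - (f z + lin2 a b h)| <= e * `|h|.
  move=> e0; have [d d0 Hd] := H e e0.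
  near=> h; rewrite [h + z]addrC opprD addrA; apply: Hd.
  near: h; apply/nbhs_ballP; exists d => // h.
  by rewrite -ball_normE /= sub0r normrN.
have D : 'd f z = lin2 a b :> (R * R -> R).
  apply: (@diff_unique _ _ _ f (lin2 a b)); first exact: lin2_continuous.
  by apply/eqaddoP => e e0; exact: K.
split=> //; apply/diff_locallyP; rewrite D; split.
  exact: lin2_continuous.
by apply/eqaddoP => e e0; exact: K.
Unshelve. all: by end_near. Qed.

Lemma diff_epsP f z : differentiable f z ->
  forall e : R, 0 < e -> exists2 d : R, 0 < d & forall h : R * R, `|h| < d ->
     `|f (z + h) - f z - 'd f z h| <= e * `|h|.
Proof.
move=> /diff_locallyP[_ /eqaddoP E] e e0.
have /= := E e e0.
move=> /nbhs0P /nbhs_ballP[d d0 Hd]; exists d => // h hd.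
have /= := Hd h; rewrite -ball_normE /= sub0r normrN add0r => /(_ hd).
by rewrite !fctE/= [h + z]addrC opprD addrA.
Qed.

Lemma diff_ext U f g z : open U -> (forall z, U z -> f z = g z) -> U z ->
  differentiable f z -> differentiable g z /\ forall v, 'D_v g z = 'D_v f z.
Proof.
move=> oU fg Uz df.
have [r r0 Hr] : exists2 r : R, 0 < r & forall h : R * R, `|h| < r -> U (z + h).
  have /nbhs_ballP[r r0 Hr] : nbhs z U by exact: open_nbhs_nbhs.
  exists r => // h hr; apply: Hr; rewrite -ball_normE /=.
  by rewrite opprD addNKr normrN.
have Lf := lin2_ext ('d f z).
have [dg Dg] : differentiable g z /\ 'd g z = lin2 ('d f z (1, 0)) ('d f z (0, 1)) :> (R * R -> R).
  apply: diff_eps => e e0.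
  have [d d0 Hd] := diff_epsP df e0.
  exists (Num.min d r); first by rewrite lt_min d0.
  move=> h; rewrite lt_min => /andP[hd hr].
  by rewrite -!fg// -?Lf; [exact: Hd|exact: Hr].
by split=> // v; rewrite (deriveE _ dg) (deriveE _ df) Dg; exact/esym/Lf.
Qed.

(** The order-by-order form of [rsmooth_on]: unlike the list of directions there,
    it peels derivatives from the inside, so closure under an operation with a
    product or chain rule is an induction on [n]. *)
Fixpoint Cn (n : nat) U f : Prop :=
  (forall z, U z -> differentiable f z) /\
  (if n is n'.+1 then forall v, Cn n' U ('D_v f) else True).

Lemma Cn_diff n U f z : Cn n U f -> U z -> differentiable f z.
Proof. by case: n => [|n] [H _]; apply: H. Qed.

Lemma CnD n U f v : Cn n.+1 U f -> Cn n U ('D_v f).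
Proof. by move=> [_ H]; apply: H. Qed.

Lemma CnW n U f : Cn n.+1 U f -> Cn n U f.
Proof.
by elim: n f => [|n IH] f [H1 H2]; split=> // v; apply: IH; exact: H2.
Qed.

Lemma rsmoothP U f : rsmooth_on U f <-> forall n, Cn n U f.
Proof.
split=> [H n|H vs z Uz].
- elim: n f H => [|n IH] f H; split=> //; [exact: (H [::])|exact: (H [::])|].
  move=> v; apply: IH => vs z Uz.
  by have := H (rcons vs v) z Uz; rewrite foldr_rcons.
- have {H} := H (size vs).
  elim/last_ind: vs f => [|vs v IH] f; first by move=> H; exact: (Cn_diff H).
  by rewrite foldr_rcons size_rcons => H; apply: IH; exact: CnD.
Qed.

Lemma Cn_ext n U f g : open U -> (forall z, U z -> f z = g z) ->
  Cn n U f -> Cn n U g.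
Proof.
move=> oU; elim: n f g => [|n IH] f g fg [H1 H2]; split=> //.
- by move=> z Uz; have [] := diff_ext oU fg Uz (H1 _ Uz).
- by move=> z Uz; have [] := diff_ext oU fg Uz (H1 _ Uz).
- move=> v; apply: IH (H2 v) => z Uz.
  by have [_ ->] := diff_ext oU fg Uz (H1 _ Uz).
Qed.

(** One step of such an induction: it suffices to name the derivatives. *)
Lemma CnS_of_D n U f : open U -> (forall z, U z -> differentiable f z) ->
  (forall v, exists2 g, Cn n U g & forall z, U z -> 'D_v f z = g z) ->
  Cn n.+1 U f.
Proof.
move=> oU H1 H2; split=> // v; have [g Cg fg] := H2 v.
by apply: Cn_ext Cg => // z Uz; rewrite fg.
Qed.

Lemma Cn_cst n U (k : R) : Cn n U (fun=> k).
Proof.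
elim: n k => [|n IH] k; split=> //; try (by move=> z _; exact: differentiable_cst).
by move=> v; rewrite (_ : 'D_v _ = fun=> 0)//; apply/funext => z; exact: derive_cst.
Qed.

Lemma Cn_add n U f g : open U -> Cn n U f -> Cn n U g ->
  Cn n U (fun z => f z + g z).
Proof.
move=> oU; elim: n f g => [|n IH] f g [f1 f2] [g1 g2].
  by split=> // z Uz; apply: differentiableD; auto.
apply: CnS_of_D => // [z Uz|v]; first by apply: differentiableD; auto.
exists (fun z => 'D_v f z + 'D_v g z); first exact: (IH _ _ (f2 v) (g2 v)).
by move=> z Uz; apply: deriveD; apply: diff_derivable; auto.
Qed.

Lemma Cn_mul n U f g : open U -> Cn n U f -> Cn n U g ->
  Cn n U (fun z => f z * g z).
Proof.
move=> oU; elim: n f g => [|n IH] f g Cf Cg.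
  case: Cf Cg => [f1 f2] [g1 g2].
  by split=> // z Uz; apply: differentiableM; auto.
have f1 z := @Cn_diff _ _ _ z Cf.
have g1 z := @Cn_diff _ _ _ z Cg.
apply: CnS_of_D => // [z Uz|v]; first by apply: differentiableM; auto.
exists (fun z => f z * 'D_v g z + g z * 'D_v f z).
  by apply: Cn_add => //; apply: IH; (exact: CnW || exact: CnD).
move=> z Uz; have := @deriveM _ _ f g z v.
by apply; apply: diff_derivable; auto.
Qed.

Lemma rs_diff U f z : rsmooth_on U f -> U z -> differentiable f z.
Proof. by move=> /(_ [::]) H Uz; apply: H. Qed.

Lemma rs_ext U f g : open U -> (forall z, U z -> f z = g z) ->
  rsmooth_on U f -> rsmooth_on U g.
Proof.
by move=> oU fg /rsmoothP H; apply/rsmoothP => n; exact: Cn_ext (H n).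
Qed.

Lemma rs_D U f v : rsmooth_on U f -> rsmooth_on U ('D_v f).
Proof.
by move=> /rsmoothP H; apply/rsmoothP => n; exact: CnD (H n.+1).
Qed.

Lemma rs_sub U V f : V `<=` U -> rsmooth_on U f -> rsmooth_on V f.
Proof. by move=> VU H vs z /VU; apply: H. Qed.

Lemma rs_cst U (k : R) : rsmooth_on U (fun=> k).
Proof. by apply/rsmoothP => n; exact: Cn_cst. Qed.

Lemma rs_add U f g : open U -> rsmooth_on U f -> rsmooth_on U g ->
  rsmooth_on U (fun z => f z + g z).
Proof.
by move=> oU /rsmoothP Hf /rsmoothP Hg; apply/rsmoothP => n; exact: Cn_add.
Qed.

Lemma rs_mul U f g : open U -> rsmooth_on U f -> rsmooth_on U g ->
  rsmooth_on U (fun z => f z * g z).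
Proof.
by move=> oU /rsmoothP Hf /rsmoothP Hg; apply/rsmoothP => n; exact: Cn_mul.
Qed.

Lemma rs_opp U f : open U -> rsmooth_on U f -> rsmooth_on U (fun z => - f z).
Proof.
move=> oU Hf; have := rs_mul oU (rs_cst (-1)) Hf.
by apply: rs_ext => // z _; rewrite mulN1r.
Qed.

Lemma rs_subr U f g : open U -> rsmooth_on U f -> rsmooth_on U g ->
  rsmooth_on U (fun z => f z - g z).
Proof. by move=> oU Hf Hg; apply: rs_add => //; exact: rs_opp. Qed.

Lemma rs_local U f :
  (forall z, U z -> exists V, [/\ open V, V z & rsmooth_on V f]) ->
  rsmooth_on U f.
Proof. by move=> H vs z /H[V [_ Vz]]; apply. Qed.

Lemma linear_rs (a b : R) U : rsmooth_on U (lin2 a b).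
Proof.
apply: (@rs_sub setT) => //; apply/rsmoothP => n.
have dl z : differentiable (lin2 a b) z.
  by apply: linear_differentiable; exact: lin2_continuous.
case: n => [|n]; first by split=> // z _; exact: dl.
apply: CnS_of_D => //; first exact: openT.
move=> v; exists (fun=> lin2 a b v); first exact: Cn_cst.
move=> z _; rewrite (deriveE _ (dl z)).
by rewrite diff_lin//; exact: lin2_continuous.
Qed.

Lemma D_lin2 (a b : R) v z : 'D_v (lin2 a b) z = lin2 a b v.
Proof.
have dl : differentiable (lin2 a b) z.
  by apply: linear_differentiable; exact: lin2_continuous.
by rewrite (deriveE _ dl) diff_lin//; exact: lin2_continuous.
Qed.

Lemma fstE : (@fst R R) = lin2 1 0.
Proof. by apply/funext => z; rewrite /lin2 mul1r mul0r addr0. Qed.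

Lemma sndE : (@snd R R) = lin2 0 1.
Proof. by apply/funext => z; rewrite /lin2 mul1r mul0r add0r. Qed.

Lemma rs_fst U : rsmooth_on U fst.
Proof. by rewrite fstE; exact: linear_rs. Qed.

Lemma rs_snd U : rsmooth_on U snd.
Proof. by rewrite sndE; exact: linear_rs. Qed.

Lemma D_fst v z : 'D_v (@fst R R) z = v.1.
Proof. by rewrite fstE D_lin2 /lin2 mul1r mul0r addr0. Qed.

Lemma D_snd v z : 'D_v (@snd R R) z = v.2.
Proof. by rewrite sndE D_lin2 /lin2 mul1r mul0r add0r. Qed.

Lemma D_lin f v z : differentiable f z ->
  'D_v f z = v.1 * 'D_(1, 0) f z + v.2 * 'D_(0, 1) f z.
Proof.
move=> df; rewrite !(deriveE _ df) lin2_ext /lin2; ring.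
Qed.

Lemma D_mul f g v z : differentiable f z -> differentiable g z ->
  'D_v (fun z => f z * g z) z = f z * 'D_v g z + g z * 'D_v f z.
Proof.
by move=> df dg; have := @deriveM _ _ f g z v; apply; exact: diff_derivable.
Qed.

Lemma D_add f g v z : differentiable f z -> differentiable g z ->
  'D_v (fun z => f z + g z) z = 'D_v f z + 'D_v g z.
Proof.
by move=> df dg; have := @deriveD _ _ _ f g z v; apply; exact: diff_derivable.
Qed.

Lemma D_opp f v z : differentiable f z ->
  'D_v (fun z => - f z) z = - 'D_v f z.
Proof.
by move=> df; have := @deriveN _ _ _ f z v; apply; exact: diff_derivable.
Qed.

Lemma D_sub f g v z : differentiable f z -> differentiable g z ->
  'D_v (fun z => f z - g z) z = 'D_v f z - 'D_v g z.
Proof.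
by move=> df dg; have := @deriveB _ _ _ f g z v; apply; exact: diff_derivable.
Qed.

Lemma D_cst v z (k : R) : 'D_v (fun=> k : R) z = 0.
Proof. exact: derive_cst. Qed.

Lemma D_comp (phi : R -> R) f z (d : R) :
  is_derive (f z) 1 phi d -> differentiable f z ->
  differentiable (fun z => phi (f z)) z /\
  forall v, 'D_v (fun z => phi (f z)) z = d * 'D_v f z.
Proof.
move=> [dphi phid] df.
have dphi' : differentiable phi (f z) by exact/derivable1_diffP.
have dc : differentiable (fun z => phi (f z)) z.
  exact: (differentiable_comp df dphi').
split=> // v.
rewrite (deriveE _ dc) (deriveE _ df).
have -> : 'd (fun z => phi (f z)) z = 'd phi (f z) \o 'd f z :> (R * R -> R).
  exact: (diff_comp df dphi').
rewrite /= deriv1E// derive1E phid.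
by rewrite /GRing.scale /= mulrC.
Qed.

Lemma Cn_inv n U f : open U -> (forall z, U z -> f z != 0) ->
  Cn n U f -> Cn n U (fun z => (f z)^-1).
Proof.
move=> oU f0; elim: n => [|n IH] Cf.
  by split=> // z Uz; apply: differentiableV; [exact: Cn_diff Cf Uz|exact: f0].
apply: CnS_of_D => // [z Uz|v].
  by apply: differentiableV; [exact: Cn_diff Cf Uz|exact: f0].
have CI := IH (CnW Cf).
exists (fun z => -1 * ((f z)^-1 * (f z)^-1 * 'D_v f z)).
  apply: Cn_mul => //; first exact: Cn_cst.
  by apply: Cn_mul => //; [exact: Cn_mul|exact: CnD].
move=> z Uz.
have -> : 'D_v (fun z => (f z)^-1) z = - (f z) ^- 2 *: 'D_v f z.
  by apply: (@deriveV _ _ f z v (f0 _ Uz)); exact: diff_derivable (Cn_diff Cf Uz).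
by rewrite mulN1r -[_ *: _]/(_ * _) mulNr -exprVn expr2.
Qed.

Lemma rs_inv U f : open U -> (forall z, U z -> f z != 0) ->
  rsmooth_on U f -> rsmooth_on U (fun z => (f z)^-1).
Proof.
by move=> oU f0 /rsmoothP H; apply/rsmoothP => n; exact: Cn_inv.
Qed.

Lemma rs_exp U f : open U -> rsmooth_on U f ->
  rsmooth_on U (fun z => expR (f z)).
Proof.
move=> oU /rsmoothP H; apply/rsmoothP => n.
have E z : U z -> differentiable (fun z => expR (f z)) z /\
    forall v, 'D_v (fun z => expR (f z)) z = expR (f z) * 'D_v f z.
  by move=> Uz; apply: D_comp; exact: Cn_diff (H 0%N) Uz.
elim: n => [|n IH]; first by split=> // z /E[].
apply: CnS_of_D => // [z /E[]//|v].
exists (fun z => expR (f z) * 'D_v f z).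
  by apply: Cn_mul => //; exact: CnD.
by move=> z /E[].
Qed.

Lemma rs_sqrt U f : open U -> (forall z, U z -> 0 < f z) ->
  rsmooth_on U f -> rsmooth_on U (fun z => Num.sqrt (f z)).
Proof.
move=> oU f0 /rsmoothP H; apply/rsmoothP => n.
have E z : U z -> differentiable (fun z => Num.sqrt (f z)) z /\
    forall v, 'D_v (fun z => Num.sqrt (f z)) z = (2 * Num.sqrt (f z))^-1 * 'D_v f z.
  by move=> Uz; apply: D_comp; [apply: is_derive1_sqrt; exact: f0|exact: Cn_diff (H 0%N) Uz].
elim: n => [|n IH]; first by split=> // z /E[].
apply: CnS_of_D => // [z /E[]//|v].
exists (fun z => (2 * Num.sqrt (f z))^-1 * 'D_v f z).
  apply: Cn_mul => //; last exact: CnD.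
  apply: Cn_inv => //; last by apply: Cn_mul => //; exact: Cn_cst.
  by move=> z Uz; rewrite mulf_neq0// gt_eqF// sqrtr_gt0 f0.
by move=> z /E[].
Qed.

Lemma rs_continuous f : rsmooth_on setT f -> continuous f.
Proof. by move=> H z; apply: differentiable_continuous; exact: rs_diff H _. Qed.

Lemma diff_affine f (a : R) (b z : R * R) : differentiable f (a *: z + b) ->
  differentiable (fun z => f (a *: z + b)) z /\
  forall v, 'D_v (fun z => f (a *: z + b)) z = a * 'D_v f (a *: z + b).
Proof.
move=> df.
have [dg Dg] : differentiable (fun z => f (a *: z + b)) z /\
  'd (fun z => f (a *: z + b)) z =
     lin2 (a * 'D_(1, 0) f (a *: z + b)) (a * 'D_(0, 1) f (a *: z + b)) :> (R * R -> R).
  apply: diff_eps => e e0.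
  have [d d0 Hd] := @diff_epsP f _ df (e / (1 + `|a|)) ltac:(by rewrite divr_gt0// ltr_pwDl).
  have a1 : 0 < 1 + `|a| by rewrite ltr_pwDl.
  exists (d / (1 + `|a|)); first by rewrite divr_gt0.
  move=> h hd.
  have -> : f (a *: (z + h) + b) - f (a *: z + b) - lin2 (a * 'D_(1, 0) f (a *: z + b)) (a * 'D_(0, 1) f (a *: z + b)) h =
     f (a *: z + b + a *: h) - f (a *: z + b) - 'd f (a *: z + b) (a *: h).
    rewrite scalerDr [a *: z + a *: h + b]addrAC; congr (_ - _).
    rewrite [RHS]linearZ /= [X in _ = _ *: X]lin2_ext /lin2 !(deriveE _ df).
    by rewrite -[RHS]/(a * _); ring.
  apply: le_trans (Hd _ _) _; rewrite normrZ.
    move: hd; rewrite ltr_pdivlMr// => /(le_lt_trans _); apply.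
    by rewrite mulrC ler_wpM2l// lerDr.
  rewrite mulrA ler_wpM2r//.
  by rewrite mulrAC ler_pdivrMr// ler_pM2l// lerDr.
split=> // v; rewrite (deriveE _ dg) Dg [in RHS]D_lin// /lin2; ring.
Qed.

Lemma rs_affine f (a : R) (b : R * R) : rsmooth_on setT f ->
  rsmooth_on setT (fun z => f (a *: z + b)).
Proof.
move=> /rsmoothP H; apply/rsmoothP => n.
elim: n f H => [|n IH] f H.
  by split=> // z _; have [] := diff_affine (Cn_diff (H 0%N) (I : setT (a *: z + b))).
apply: CnS_of_D; first exact: openT.
  by move=> z _; have [] := diff_affine (Cn_diff (H 0%N) (I : setT (a *: z + b))).
move=> v; exists (fun z => a * 'D_v f (a *: z + b)).
  apply: Cn_mul; [exact: openT|exact: Cn_cst|].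
  by apply: (IH ('D_v f)) => m; exact: CnD (H m.+1).
by move=> z _; have [_ ->] := diff_affine (Cn_diff (H 0%N) (I : setT (a *: z + b))).
Qed.

End Smooth.

(** * Cutoffs and radial kernels *)

Section Bump.
Variable R : realType.
Implicit Types (p : {poly R}) (x : R) (z v : R * R).

(** The family p(1/x) exp(-1/x) is stable under differentiation, which makes the
    smoothness of the flat function exp(-1/x) an induction. *)
Definition flat p x : R := if 0 < x then p.[x^-1] * expR (- x^-1) else 0.

(** (p(1/x) exp(-1/x))' = q(1/x) exp(-1/x) with q = X^2 (p - p'). *)
Definition dflat p : {poly R} := 'X^2 * (p - p^`()).

Lemma pow_le_exp n : exists C : R, forall y, 0 <= y -> y ^+ n <= C * expR y.
Proof.
case: n => [|n].
  by exists 1 => y y0; rewrite expr0 mul1r -[1]expR0 ler_expR.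
exists (n.+1)`!%:R => y y0; rewrite -ler_pdivrMl ?ltr0n ?fact_gt0//.
by rewrite mulrC; apply: le_trans (expR_ge1Dxn n y0); rewrite lerDr.
Qed.

Lemma poly_le_exp p : exists C : R, forall y, 0 <= y -> `|p.[y]| <= C * expR y.
Proof.
have H n : exists C : R, forall y, 0 <= y -> `|p`_n| * y ^+ n <= C * expR y.
  have [C HC] := pow_le_exp n; exists (`|p`_n| * C) => y y0.
  by rewrite -mulrA ler_wpM2l// HC.
have [C HC] := choice H.
exists (\sum_(i < size p) C i) => y y0.
rewrite horner_coef mulr_suml; apply: le_trans (ler_norm_sum _ _ _) _.
apply: ler_sum => i _; rewrite normrM normrX [`|y|]ger0_norm//; exact: HC.
Qed.

(** A quadratic bound at 0 gives the derivative there, the only point where the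
    differentiation rules do not apply. *)
Lemma flat_le p : exists2 C : R, 0 <= C & forall x, `|flat p x| <= C * x ^+ 2.
Proof.
have [C HC] := poly_le_exp ('X^2 * p).
have C0 : 0 <= C by have := HC 0 (lexx _); rewrite expR0 mulr1; exact: le_trans.
exists C => // x; rewrite /flat; case: ifPn => x0; last first.
  by rewrite normr0 mulr_ge0// sqr_ge0.
have y0 : 0 <= x^-1 by rewrite invr_ge0 ltW.
have := HC _ y0; rewrite hornerM hornerXn normrM ger0_norm ?sqr_ge0//.
rewrite normrM [`|expR _|]ger0_norm ?expR_ge0// expRN.
rewrite -ler_pdivrMr ?expR_gt0// exprVn => H.
by rewrite -ler_pdivrMr ?exprn_gt0// mulrC mulrA.
Qed.

Lemma is_derive_flat p x : is_derive x 1 (flat p) (flat (dflat p) x).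
Proof.
have [x0|x0|->] := ltgtP x 0.
- rewrite {2}/flat ltNge ltW//=.
  apply: (near_eq_is_derive _ (is_derive_cst (0 : R) x 1)).
  near=> y; rewrite /flat ltNge ltW//=.
  by near: y; exact: lt_nbhsl.
- rewrite {2}/flat x0.
  have x1 : x != 0 by rewrite gt_eqF.
  have E : \forall y \near x, p.[y^-1] * expR (- y^-1) = flat p y.
    near=> y; rewrite /flat ifT//.
    by near: y; exact: lt_nbhsr.
  apply: (near_eq_is_derive E).
  have dV : is_derive x 1 (fun y : R => y^-1) (- x ^- 2).
    have -> : - x ^- 2 = - x ^- 2 *: (1 : R) by rewrite /GRing.scale/= mulr1.
    by apply: is_deriveV.
  have dp : is_derive x 1 (fun y : R => p.[y^-1]) (- x ^- 2 * p^`().[x^-1]).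
    rewrite mulrC.
    exact: (@is_derive1_comp _ (horner p) (fun y => y^-1)).
  have dN : is_derive x 1 (fun y : R => - y^-1) (x ^- 2).
    by rewrite -[x ^- 2]opprK; exact: is_deriveN.
  have de : is_derive x 1 (fun y : R => expR (- y^-1)) (expR (- x^-1) * x ^- 2).
    exact: (@is_derive1_comp _ expR (fun y => - y^-1)).
  have -> : (dflat p).[x^-1] * expR (- x^-1) =
      p.[x^-1] *: (expR (- x^-1) / x ^+ 2) +
      expR (- x^-1) *: (- x ^- 2 * p^`().[x^-1]).
    rewrite /dflat !hornerE -[p.[_] *: _]/(_ * _) -[expR _ *: _]/(_ * _) /=.
    by rewrite exprVn; ring.
  exact: is_deriveM dp de.
- have [C C0 HC] := flat_le p.
  have f0 q : flat q 0 = 0 by rewrite /flat ltxx.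
  rewrite f0.
  have K : (fun h => h^-1 *: (flat p (h *: 1 + 0) - flat p 0)) @ 0^' --> (0 : R).
    apply/cvgrPdist_le => e e0.
    near=> h.
    have h0 : h != 0 by near: h; exact: nbhs_dnbhs_neq.
    rewrite f0 subr0 sub0r normrN addr0 -[h *: 1]/(h * 1) mulr1.
    rewrite -[_ *: _]/(_ * _) normrM normfV ler_pdivrMl ?normr_gt0//.
    apply: le_trans (HC h) _.
    rewrite -real_normK ?num_real// expr2 mulrA mulrC ler_wpM2l//.
    have : `|h| <= e / (C + 1).
      near: h; apply: dnbhs0_le.
      by rewrite divr_gt0// ltr_pwDr.
    rewrite ler_pdivlMr ?ltr_pwDr// => H.
    by apply: le_trans H; rewrite mulrC ler_wpM2l// lerDl.
  by apply: DeriveDef; [apply/cvg_ex; exists 0|apply/cvg_lim].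
Unshelve. all: by end_near. Qed.

Lemma rs_flat (U : set (R * R)) p f : open U -> rsmooth_on U f ->
  rsmooth_on U (fun z => flat p (f z)).
Proof.
move=> oU /rsmoothP H; apply/rsmoothP => n.
elim: n p => [|n IH] p.
  by split=> // z Uz; have [] := D_comp (is_derive_flat p (f z)) (Cn_diff (H 0%N) Uz).
apply: CnS_of_D => // [z Uz|v].
  by have [] := D_comp (is_derive_flat p (f z)) (Cn_diff (H 0%N) Uz).
exists (fun z => flat (dflat p) (f z) * 'D_v f z).
  by apply: Cn_mul => //; exact: CnD (H n.+1).
by move=> z Uz; have [_] := D_comp (is_derive_flat p (f z)) (Cn_diff (H 0%N) Uz).
Qed.

Lemma flat_pos x : 0 < x -> 0 < flat 1 x.
Proof. by move=> x0; rewrite /flat x0 hornerC mul1r expR_gt0. Qed.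

Lemma flat0 p x : x <= 0 -> flat p x = 0.
Proof. by rewrite /flat leNgt => /negbTE ->. Qed.

Lemma flat_ge0 x : 0 <= flat 1 x.
Proof. by case: (ltP 0 x) => [/flat_pos/ltW //|/flat0 ->]. Qed.

Lemma dflat1 : dflat 1 = 'X^2.
Proof. by rewrite /dflat derivC subr0 mulr1. Qed.

Lemma dflat_ge0 x : 0 <= flat (dflat 1) x.
Proof.
case: (ltP 0 x) => [x0|/flat0 ->//].
by rewrite dflat1 /flat x0 hornerXn mulr_ge0// ?expR_ge0// sqr_ge0.
Qed.

Lemma dflat_pos x : 0 < x -> 0 < flat (dflat 1) x.
Proof.
move=> x0.
by rewrite dflat1 /flat x0 hornerXn mulr_gt0// ?expR_gt0// exprn_gt0// invr_gt0.
Qed.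

(** The smooth step falls from 1 at x <= 1/4 to 0 at x >= 1. *)
Definition step_den x : R := flat 1 (1 - x) + flat 1 (x - 4^-1).
Definition step x : R := flat 1 (1 - x) / step_den x.
Definition dstep x : R :=
  (flat (dflat 1) (1 - x) * flat 1 (x - 4^-1) +
   flat 1 (1 - x) * flat (dflat 1) (x - 4^-1)) / step_den x ^+ 2.

Lemma step_den_gt0 x : 0 < step_den x.
Proof.
rewrite /step_den; case: (ltP x 1) => x1.
  by rewrite ltr_pwDl// ?flat_ge0// flat_pos// subr_gt0.
rewrite ltr_wpDl// ?flat_ge0// flat_pos// subr_gt0; apply: lt_le_trans x1.
by rewrite invf_lt1// ltr1n.
Qed.

Lemma step1 x : x <= 4^-1 -> step x = 1.
Proof.
move=> x1; have := step_den_gt0 x.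
rewrite /step /step_den (@flat0 _ (x - _)) ?subr_le0// addr0 => H.
by rewrite divff// gt_eqF.
Qed.

Lemma step0 x : 1 <= x -> step x = 0.
Proof. by move=> x1; rewrite /step flat0 ?subr_le0// mul0r. Qed.

Lemma step_ge0 x : 0 <= step x.
Proof. by rewrite divr_ge0// ?flat_ge0// ltW// step_den_gt0. Qed.

Lemma step_le1 x : step x <= 1.
Proof.
by rewrite ler_pdivrMr ?step_den_gt0// mul1r lerDl flat_ge0.
Qed.

Lemma dstep_ge0 x : 0 <= dstep x.
Proof.
rewrite divr_ge0// ?sqr_ge0//.
by rewrite addr_ge0// mulr_ge0// ?flat_ge0// ?dflat_ge0.
Qed.

Lemma dstep_pos x : 4^-1 < x -> x < 1 -> 0 < dstep x.
Proof.
move=> x1 x2; rewrite divr_gt0// ?exprn_gt0// ?step_den_gt0//.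
by rewrite addr_gt0// mulr_gt0// ?flat_pos// ?dflat_pos// subr_gt0.
Qed.

Lemma dstep0 x : x <= 4^-1 \/ 1 <= x -> dstep x = 0.
Proof.
rewrite /dstep => -[x1|x1].
  by rewrite !(@flat0 _ (x - _)) ?subr_le0// !mulr0 addr0 mul0r.
by rewrite !(@flat0 _ (1 - x)) ?subr_le0// !mul0r addr0 mul0r.
Qed.

Lemma is_derive_step x : is_derive x 1 step (- dstep x).
Proof.
have d1 : is_derive x 1 (fun y : R => 1 - y) (- 1).
  by rewrite -[- 1]add0r; exact: is_deriveB.
have d2 : is_derive x 1 (fun y : R => y - 4^-1) 1.
  by rewrite -[X in is_derive _ _ _ X]subr0; exact: is_deriveB.
have d3 : is_derive x 1 (fun y : R => flat 1 (1 - y))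
    (flat (dflat 1) (1 - x) * - 1).
  apply: (@is_derive1_comp _ (flat 1) (fun y => 1 - y)).
  exact: is_derive_flat.
have d4 : is_derive x 1 (fun y : R => flat 1 (y - 4^-1))
    (flat (dflat 1) (x - 4^-1) * 1).
  apply: (@is_derive1_comp _ (flat 1) (fun y => y - 4^-1)).
  exact: is_derive_flat.
have d5 := is_deriveD d3 d4.
have n0 : step_den x != 0 by rewrite gt_eqF// step_den_gt0.
have d6 : is_derive x 1 (fun y => (step_den y)^-1)
   (- (step_den x) ^- 2 *: (flat (dflat 1) (1 - x) * - 1 + flat (dflat 1) (x - 4^-1) * 1)).
  exact: is_deriveV.
have -> : - dstep x = flat 1 (1 - x) *: (- (step_den x) ^- 2 *: (flat (dflat 1) (1 - x) * - 1 + flat (dflat 1) (x - 4^-1) * 1)) + (step_den x)^-1 *: (flat (dflat 1) (1 - x) * - 1).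
  rewrite -![_ *: _]/(_ * _) /dstep.
  move: n0; rewrite /step_den.
  set A := flat 1 _; set B := flat 1 _ => n0.
  by field.
exact: is_deriveM d3 d6.
Qed.

Lemma rs_step (U : set (R * R)) f : open U -> rsmooth_on U f ->
  rsmooth_on U (fun z => step (f z)).
Proof.
move=> oU Hf.
have H1 : rsmooth_on U (fun z => flat 1 (1 - f z)).
  by apply: rs_flat => //; apply: rs_subr => //; exact: rs_cst.
have H2 : rsmooth_on U (fun z => flat 1 (f z - 4^-1)).
  by apply: rs_flat => //; apply: rs_subr => //; exact: rs_cst.
apply: rs_mul => //; apply: rs_inv => //; last exact: rs_add.
by move=> z _; rewrite gt_eqF// step_den_gt0.
Qed.

Lemma rs_dstep (U : set (R * R)) f : open U -> rsmooth_on U f ->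
  rsmooth_on U (fun z => dstep (f z)).
Proof.
move=> oU Hf.
have H1 p : rsmooth_on U (fun z => flat p (1 - f z)).
  by apply: rs_flat => //; apply: rs_subr => //; exact: rs_cst.
have H2 p : rsmooth_on U (fun z => flat p (f z - 4^-1)).
  by apply: rs_flat => //; apply: rs_subr => //; exact: rs_cst.
have H3 : rsmooth_on U (fun z => step_den (f z)) by exact: rs_add.
apply: rs_mul => //.
  by apply: rs_add => //; exact: rs_mul.
apply: rs_inv => //; last by apply: rs_mul.
by move=> z _; rewrite mulf_neq0// gt_eqF// step_den_gt0.
Qed.

Definition sqn z : R := z.1 ^+ 2 + z.2 ^+ 2.

Lemma sqn_ge0 z : 0 <= sqn z.
Proof. by rewrite addr_ge0// sqr_ge0. Qed.

Lemma sqn_eq0 z : (sqn z == 0) = (z == 0).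
Proof.
by case: z => x y; rewrite paddr_eq0 ?sqr_ge0//= !sqrf_eq0.
Qed.

Lemma rs_sqn (U : set (R * R)) : open U -> rsmooth_on U sqn.
Proof.
move=> oU; apply: rs_add => //; apply: rs_mul => //;
  (exact: rs_fst || exact: rs_snd).
Qed.

Lemma D_sqn v z : 'D_v sqn z = 2 * (z.1 * v.1 + z.2 * v.2).
Proof.
have d1 : differentiable (@fst R R) z by apply: rs_diff (rs_fst (U := setT)) _.
have d2 : differentiable (@snd R R) z by apply: rs_diff (rs_snd (U := setT)) _.
have -> : sqn = (fun z => (fun z => z.1 * z.1) z + (fun z => z.2 * z.2) z).
  by apply/funext => y; rewrite /sqn !expr2.
rewrite D_add; [|exact: differentiableM..].
rewrite (D_mul _ d1 d1) (D_mul _ d2 d2) D_fst D_snd; ring.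
Qed.

Lemma norm2_le_sqn z : `|z| ^+ 2 <= sqn z.
Proof.
rewrite prod_normE /= /sqn -(real_normK (num_real z.1)) -(real_normK (num_real z.2)).
have [h|h] := leP `|z.1| `|z.2|; first by rewrite lerDr sqr_ge0.
by rewrite lerDl sqr_ge0.
Qed.

Lemma sqn_le_norm2 z : sqn z <= 2 * `|z| ^+ 2.
Proof.
rewrite prod_normE /= /sqn -(real_normK (num_real z.1)) -(real_normK (num_real z.2)).
rewrite mulr_natl mulr2n lerD// lerXn2r ?nnegrE// ?le_max ?normr_ge0 ?lexx ?orbT//.
Qed.

Section Kernel.
Variable d : R.
Hypothesis d0 : 0 < d.

Definition chi z : R := step (sqn z / d ^+ 2).
(** Minus chi'(|z|) / |z| for the radial profile of [chi]: with this kernel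
    d/dzbar (chi / z) = - rho / 2 away from 0, so that [rho d] is an
    approximate identity, up to a constant, obtained by truncating the Cauchy
    kernel 1/z at radius [d]. *)
Definition rho z : R := 2 / d ^+ 2 * dstep (sqn z / d ^+ 2).

Let d2 : 0 < d ^+ 2. Proof. by rewrite exprn_gt0. Qed.

Lemma rs_chi : rsmooth_on setT chi.
Proof.
apply: rs_step; first exact: openT.
by apply: rs_mul; [exact: openT|apply: rs_sqn; exact: openT|exact: rs_cst].
Qed.

Lemma rs_rho : rsmooth_on setT rho.
Proof.
apply: rs_mul; [exact: openT|exact: rs_cst|].
apply: rs_dstep; first exact: openT.
by apply: rs_mul; [exact: openT|apply: rs_sqn; exact: openT|exact: rs_cst].
Qed.

Lemma D_chi v z : 'D_v chi z = - (z.1 * v.1 + z.2 * v.2) * rho z.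
Proof.
have ds : differentiable sqn z by apply: rs_diff (rs_sqn (@openT _)) _.
have dq : differentiable (fun z => sqn z / d ^+ 2) z.
  by apply: differentiableM => //; exact: differentiable_cst.
have [_ ->] := D_comp (is_derive_step _) dq.
have dk : differentiable (fun _ : R * R => (d ^+ 2)^-1 : R) z.
  exact: differentiable_cst.
by rewrite (D_mul _ ds dk) D_cst D_sqn /rho; ring.
Qed.

Lemma chi_ge0 z : 0 <= chi z. Proof. exact: step_ge0. Qed.
Lemma chi_le1 z : chi z <= 1. Proof. exact: step_le1. Qed.
Lemma rho_ge0 z : 0 <= rho z.
Proof. by rewrite mulr_ge0// ?dstep_ge0// divr_ge0// ltW. Qed.

Lemma chi1 z : sqn z <= d ^+ 2 / 4 -> chi z = 1.
Proof.
by move=> H; apply: step1; rewrite ler_pdivrMr// mulrC.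
Qed.

Lemma chi0 z : d ^+ 2 <= sqn z -> chi z = 0.
Proof. by move=> H; apply: step0; rewrite ler_pdivlMr// mul1r. Qed.

Lemma rho0 z : sqn z <= d ^+ 2 / 4 \/ d ^+ 2 <= sqn z -> rho z = 0.
Proof.
move=> H; rewrite /rho dstep0 ?mulr0//; case: H => H; [left|right].
  by rewrite ler_pdivrMr// mulrC.
by rewrite ler_pdivlMr// mul1r.
Qed.

Lemma chi_norm1 z : `|z| <= d / 4 -> chi z = 1.
Proof.
move=> H; apply: chi1; apply: le_trans (sqn_le_norm2 z) _.
have : `|z| ^+ 2 <= (d / 4) ^+ 2 by rewrite lerXn2r// ?nnegrE// divr_ge0// ltW.
rewrite expr_div_n => H2; nra.
Qed.

Lemma chi_norm0 z : d <= `|z| -> chi z = 0.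
Proof.
move=> H; apply: chi0; apply: le_trans (norm2_le_sqn z).
by rewrite lerXn2r// ?nnegrE// ltW.
Qed.

Lemma rho_norm0 z : d <= `|z| -> rho z = 0.
Proof.
move=> H; apply: rho0; right; apply: le_trans (norm2_le_sqn z).
by rewrite lerXn2r// ?nnegrE// ltW.
Qed.

Lemma rho_pos : exists z, 0 < rho z.
Proof.
exists (d / 4 * 3, 0); apply: mulr_gt0; first by rewrite divr_gt0.
have -> : sqn (d / 4 * 3, 0) / d ^+ 2 = 9 / 16.
  rewrite /sqn /=; field; exact: lt0r_neq0.
by apply: dstep_pos; lra.
Qed.

End Kernel.

(** Truncations of the Cauchy kernel at two radii differ by a smooth function
    with compact support, namely zbar * g with g = (chi d' - chi d) / |z|^2.
    Hence the difference of the kernels is the divergence of (x g, y g), and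
    this field is curl-free because g is radial. *)
Lemma rho_diff (d d' : R) : 0 < d -> 0 < d' -> exists g : R * R -> R,
  [/\ rsmooth_on setT g,
      (forall z, Num.max d d' <= `|z| -> g z = 0),
      (forall z, 'D_(1, 0) (fun z => z.1 * g z) z +
                 'D_(0, 1) (fun z => z.2 * g z) z = rho d z - rho d' z) &
      (forall z, 'D_(0, 1) (fun z => z.1 * g z) z =
                 'D_(1, 0) (fun z => z.2 * g z) z)].
Proof.
move=> d0 d'0.
pose g z : R := (chi d' z - chi d z) / sqn z.
pose m := Num.min d d'.
have m0 : 0 < m by rewrite lt_min d0.
pose U0 : set (R * R) := ball 0 (m / 4).
have z_U0 z : U0 z -> `|z| < m / 4 by rewrite /U0 -ball_normE /= sub0r normrN.
have oU0 : open U0 by exact: ball_open.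
have near0 z : U0 z -> chi d z = 1 /\ chi d' z = 1.
  move=> /z_U0/ltW H; split; apply: chi_norm1 => //; apply: le_trans H _;
  by rewrite ler_pM2r// ge_min lexx// orbT.
have g0 z : U0 z -> g z = 0.
  by move=> /near0[h1 h2]; rewrite /g h1 h2 subrr mul0r.
pose U1 : set (R * R) := ~` [set 0].
have oU1 : open U1 by apply: closed_openC; apply: accessible_closed_set1;
  apply: hausdorff_accessible; exact: norm_hausdorff.
have cover z : U0 z \/ U1 z.
  have [->|z0] := eqVneq z 0; last by right; exact/eqP.
  by left; apply: ballxx; rewrite divr_gt0.
have sqn0 z : U1 z -> sqn z != 0 by move=> /eqP; rewrite sqn_eq0.
have sc e : 0 < e -> rsmooth_on U1 (chi e).
  by move=> e0; apply: rs_sub (rs_chi e).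
have g1 : rsmooth_on U1 g.
  apply: rs_mul => //; first by apply: rs_subr => //; exact: sc.
  by apply: rs_inv => //; exact: rs_sqn.
have gs : rsmooth_on setT g.
  apply: rs_local => z _; case: (cover z) => [U0z|U1z].
    exists U0; split => //; apply: rs_ext (rs_cst 0) => // y /g0 ->//.
  by exists U1.
have dg z : differentiable g z by apply: rs_diff gs _.
have Dg z v : U1 z -> 'D_v g z = (z.1 * v.1 + z.2 * v.2) * (rho d z - rho d' z) / sqn z
      - 2 * (z.1 * v.1 + z.2 * v.2) * (chi d' z - chi d z) / sqn z ^+ 2.
  move=> U1z.
  have dc e : 0 < e -> differentiable (chi e) z by move=> e0; exact: rs_diff (rs_chi e) _.
  have ds : differentiable sqn z by apply: rs_diff (rs_sqn (@openT _)) _.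
  have dI : is_derive (sqn z) 1 (fun y : R => y^-1) (- (sqn z) ^- 2).
    have -> : - (sqn z) ^- 2 = - (sqn z) ^- 2 *: (1 : R) by rewrite /GRing.scale/= mulr1.
    by apply: is_deriveV; exact: sqn0.
  have [di Di] := D_comp dI ds.
  rewrite /g D_mul//; last by apply: differentiableB; exact: dc.
  rewrite (D_sub _ (dc _ d'0) (dc _ d0)).
  rewrite Di D_sqn !D_chi//.
  by field; exact: sqn0.
have d1 z : differentiable (@fst R R) z by apply: rs_diff (rs_fst (U := setT)) _.
have d2 z : differentiable (@snd R R) z by apply: rs_diff (rs_snd (U := setT)) _.
have Dg0 z v : U0 z -> 'D_v g z = 0.
  move=> U0z; have [_ ->] := @diff_ext _ U0 (fun=> 0) g z oU0 (fun y h => esym (g0 y h)) U0z (differentiable_cst _ _).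
  exact: D_cst.
exists g; split=> //.
- move=> z; rewrite ge_max => /andP[h1 h2].
  by rewrite /g !chi_norm0// subrr mul0r.
- move=> z; rewrite (D_mul _ (d1 z) (dg z)) (D_mul _ (d2 z) (dg z)) D_fst D_snd /= !mulr1.
  case: (cover z) => [U0z|U1z].
    rewrite !Dg0// g0// !mulr0 !addr0.
    have /ltW H := z_U0 _ U0z.
    have rr e : m <= e -> 0 < e -> rho e z = 0.
      move=> me e0; apply: rho0 => //; left.
      apply: le_trans (sqn_le_norm2 z) _.
      have : `|z| ^+ 2 <= (e / 4) ^+ 2.
        have H' : `|z| <= e / 4 by apply: le_trans H _; rewrite ler_pM2r.
        by rewrite lerXn2r// nnegrE// (le_trans _ H').
      rewrite expr_div_n => H2; nra.
    by rewrite !rr// ?ge_min ?lexx ?orbT// subrr.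
  rewrite !Dg//= /g; move: (sqn0 _ U1z); rewrite /sqn => n0.
  by field.
- move=> z; rewrite (D_mul _ (d1 z) (dg z)) (D_mul _ (d2 z) (dg z)) D_fst D_snd /= !mulr0 !addr0.
  case: (cover z) => [U0z|U1z]; first by rewrite !Dg0// !mulr0.
  by rewrite !Dg//=; ring.
Qed.

End Bump.

(** * Integrals of compactly supported functions over the plane *)

Section Integral.
Variable R : realType.
Implicit Types (F G : R * R -> R) (v z : R * R).

Notation mR := (measurableTypeR R).
Notation mP := (mR * mR)%type.
Notation mu := (plane_measure R).

(** An open set is a countable union of products of balls with rational centres
    and radii 1/(n+1); this ties the product sigma-algebra to the topology. *)
Lemma open_measurable_plane (U : set (R * R)) : open U ->
  @measurable _ mP U.
Proof.
move=> oU.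
pose box (p q : rat) (n : nat) : set mP :=
  (ball (ratr p : R) (n.+1%:R^-1 : R) : set mR) `*` (ball (ratr q : R) (n.+1%:R^-1 : R) : set mR).
have mbox p q n : @measurable _ mP (box p q n).
  by apply: measurableX; apply: open_measurable; exact: ball_open.
have -> : U = \bigcup_(p : rat) \bigcup_(q : rat) \bigcup_(n in [set n | box p q n `<=` U]) box p q n.
  apply/seteqP; split=> [z Uz|z [p _ [q _ [n /= nU]]]]; last exact: nU.
  have /nbhs_ballP[e /= e0 He] : nbhs z U by exact: open_nbhs_nbhs.
  have [n n0] : exists n : nat, 2 * n.+1%:R^-1 < e.
    exists (Num.truncn (2 / e)).
    rewrite ltr_pdivrMr// mulrC -ltr_pdivrMr// -natr1.
    by rewrite natr1 truncnS_gt// divr_ge0// ltW.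
  have n1 : 0 < n.+1%:R^-1 :> R by rewrite invr_gt0.
  have appr (x : R) : exists p : rat, `|ratr p - x| < n.+1%:R^-1 :> R.
    have [p] := @rat_in_itvoo R (x - n.+1%:R^-1) (x + n.+1%:R^-1)
      ltac:(by rewrite ltrBlDr -addrA ltrDl addr_gt0).
    rewrite in_itv/= => /andP[h1 h2]; exists p.
    by rewrite ltr_distl h1.
  have [p Hp] := appr z.1; have [q Hq] := appr z.2.
  exists p => //; exists q => //; exists n => /=; last first.
    by split; rewrite /= -ball_normE.
  move=> [y1 y2] [/=]; rewrite -!ball_normE /= => h1 h2.
  apply: He; rewrite -ball_normE /= prod_normE /= gt_max.
  apply/andP; split; apply: le_lt_trans n0.
  - apply: le_trans (ler_distD (ratr p) _ _) _.
    by rewrite mulr_natl mulr2n lerD// ltW// distrC.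
  - apply: le_trans (ler_distD (ratr q) _ _) _.
    by rewrite mulr_natl mulr2n lerD// ltW// distrC.
by apply: bigcupT_measurable_rat => p; apply: bigcupT_measurable_rat => q;
  exact: bigcup_measurable.
Qed.

Lemma continuous_measurable_plane (U : set (R * R)) F : open U ->
  (forall z, U z -> {for z, continuous F}) ->
  measurable_fun (U : set mP) (F : mP -> mR).
Proof.
move=> oU cF; apply: (measurability _ (RGenOpens.measurableE R)).
move=> _ [_ [a [b ->] <-]].
have -> : U `&` F @^-1` `]a, b[%classic = (fun z => U z /\ `]a, b[%classic (F z)) by [].
apply: open_measurable_plane.
rewrite openE => z [Uz Fz]; rewrite /interior.
apply: filterI; first exact: open_nbhs_nbhs.
by apply: cF => //; apply: open_nbhs_nbhs; split => //; exact: interval_open.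
Qed.

Lemma continuous_measurable_fun_plane F : continuous F ->
  measurable_fun (setT : set mP) (F : mP -> mR).
Proof.
move=> cF; apply: continuous_measurable_plane; first exact: openT.
by move=> z _; exact: cF.
Qed.

(** Everything paired with a test function is of this kind, which makes
    integrability automatic. *)
Definition Cc F := continuous F /\ exists N : R, forall z, N <= `|z| -> F z = 0.

Definition sq (N : R) : set (R * R) := [set z | `|z| <= N].

Lemma sqE N : sq N = (`[- N, N]%classic `*` `[- N, N]%classic).
Proof.
apply/seteqP; split=> -[x y]; rewrite /sq /= prod_normE /= ge_max !in_itv/= -!ler_norml.
  by move=> /andP.
by move=> [-> ->].
Qed.

Lemma sq_compact N : compact (sq N).
Proof.
by rewrite sqE; apply: compact_setX; exact: segment_compact.
Qed.

Lemma sq_measurable N : @measurable _ mP (sq N).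
Proof. by rewrite sqE; apply: measurableX; exact: measurable_itv. Qed.

Lemma sq_finite N : (mu (sq N) < +oo)%E.
Proof.
rewrite sqE /plane_measure /= product_measure1E; try exact: measurable_itv.
by rewrite lte_mul_pinfty ?ge0_fin_numE ?measure_ge0//= ?lebesgue_measure_itv//=; case: ifP => // _; rewrite ltry.
Qed.

Lemma continuous_bounded_sq F N : continuous F ->
  exists2 M : R, 0 <= M & forall z, `|z| <= N -> `|F z| <= M.
Proof.
move=> cF; have [N0|N0] := ltP N 0.
  by exists 0 => // z zN; have := normr_ge0 z; rewrite leNgt (le_lt_trans zN N0).
have [||z0 z0N H] := @compact_EVT_max _ R (fun z => `|F z|) (sq N) _ (@sq_compact N).
- by exists 0; rewrite /sq /= normr0.
- apply: continuous_subspaceT => z; apply: cvg_norm; exact: cF.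
by exists `|F z0| => // z zN; apply: H; rewrite inE.
Qed.

Lemma Cc_bounded F : Cc F -> exists2 M : R, 0 <= M & forall z, `|F z| <= M.
Proof.
move=> [cF [N HN]]; have [M M0 HM] := continuous_bounded_sq N cF.
exists M => // z; case: (leP `|z| N) => zN; first exact: HM.
by rewrite HN ?normr0// ltW.
Qed.

Lemma Cc_integrable F : Cc F -> mu.-integrable setT (EFin \o F).
Proof.
move=> CF; have [cF [N HN]] := CF; have [M M0 HM] := Cc_bounded CF.
have FE : (EFin \o F) = (EFin \o F) \_ (sq N).
  apply/funext => z; rewrite patchE; case: ifPn => // /negP.
  rewrite inE /sq /= => /negP; rewrite -ltNge => /ltW /HN ->//.
rewrite FE; apply/(integrable_mkcond _ (sq_measurable N)).
apply: measurable_bounded_integrable.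
- exact: sq_measurable.
- exact: sq_finite.
- apply: (@measurable_funS _ _ _ _ setT) => //.
  exact: continuous_measurable_fun_plane.
- by exists M; split => [|x Mx z _]; first exact: num_real;
   apply: le_trans (HM z) _; exact: ltW.
Qed.

Definition I2 F : R := \int[mu]_z F z.

Lemma Cc_add F G : Cc F -> Cc G -> Cc (fun z => F z + G z).
Proof.
move=> [cF [N HN]] [cG [N' HN']]; split.
  by move=> z; apply: (@cvgD _ R^o); [exact: cF|exact: cG].
exists (Num.max N N') => z; rewrite ge_max => /andP[h1 h2].
by rewrite HN// HN'// addr0.
Qed.

Lemma Cc_mulr F G : Cc F -> continuous G -> Cc (fun z => F z * G z).
Proof.
move=> [cF [N HN]] cG; split.
  by move=> z; apply: cvgM; [exact: cF|exact: cG].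
by exists N => z h; rewrite HN// mul0r.
Qed.

Lemma Cc_mull F G : continuous F -> Cc G -> Cc (fun z => F z * G z).
Proof.
move=> cF cG; have := Cc_mulr cG cF.
by congr Cc; apply/funext => z; rewrite mulrC.
Qed.

Lemma Cc_scale (k : R) F : Cc F -> Cc (fun z => k * F z).
Proof. by move=> H; apply: Cc_mull => // z; exact: cvg_cst. Qed.

Lemma Cc_opp F : Cc F -> Cc (fun z => - F z).
Proof.
by move=> /(Cc_scale (-1)); congr Cc; apply/funext => z; rewrite mulN1r.
Qed.

Lemma Cc_sub F G : Cc F -> Cc G -> Cc (fun z => F z - G z).
Proof. by move=> HF HG; apply: Cc_add => //; exact: Cc_opp. Qed.

Lemma Cc_norm F : Cc F -> Cc (fun z => `|F z|).
Proof.
move=> [cF [N HN]]; split; last by exists N => z h; rewrite HN// normr0.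
by move=> z; apply: cvg_norm; exact: cF.
Qed.

Lemma Cc0 : Cc (fun=> 0).
Proof. by split; [move=> z; exact: cvg_cst|exists 0]. Qed.

Lemma I2_add F G : Cc F -> Cc G -> I2 (fun z => F z + G z) = I2 F + I2 G.
Proof.
by move=> HF HG; rewrite /I2 RintegralD//; exact: Cc_integrable.
Qed.

Lemma I2_sub F G : Cc F -> Cc G -> I2 (fun z => F z - G z) = I2 F - I2 G.
Proof.
by move=> HF HG; rewrite /I2 RintegralB//; exact: Cc_integrable.
Qed.

Lemma I2_scale (k : R) F : Cc F -> I2 (fun z => k * F z) = k * I2 F.
Proof.
by move=> HF; rewrite /I2 RintegralZl//; exact: Cc_integrable.
Qed.

Lemma I2_le F G : Cc F -> Cc G -> (forall z, F z <= G z) -> I2 F <= I2 G.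
Proof.
by move=> HF HG H; apply: le_Rintegral => //; exact: Cc_integrable.
Qed.

Lemma I2_ge0 F : (forall z, 0 <= F z) -> 0 <= I2 F.
Proof. by move=> H; exact: Rintegral_ge0. Qed.

Lemma I2_norm F : Cc F -> `|I2 F| <= I2 (fun z => `|F z|).
Proof. by move=> HF; apply: le_normr_Rintegral => //; exact: Cc_integrable. Qed.

Lemma I2_E F : Cc F -> (I2 F)%:E = (\int[mu]_z (F z)%:E)%E.
Proof.
by move=> HF; rewrite /I2 /Rintegral fineK//; apply: integrable_fin_num => //; exact: Cc_integrable.
Qed.

Lemma I2_0 : I2 (fun=> 0) = 0.
Proof. by rewrite /I2 Rintegral_cst// mul0r. Qed.

(** A positive value would persist on a small square, whose measure is
    positive. *)
Lemma I2_eq0 F : Cc F -> (forall z, 0 <= F z) -> I2 F = 0 -> forall z, F z = 0.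
Proof.
move=> CF F0 IF z; apply/eqP; rewrite eq_le F0 andbT leNgt; apply/negP => Fz.
have [cF _] := CF.
have : \forall y \near z, F z / 2 < F y.
  have := cvgr_gt _ (cF z); apply.
  by rewrite ltr_pdivrMr// mulr_natr mulr2n ltrDl.
move=> /nbhs_ballP[e /= e0 He].
pose A : set mP := (ball z.1 e : set mR) `*` (ball z.2 e : set mR).
have mA : measurable A by apply: measurableX; apply: open_measurable; exact: ball_open.
have muA : mu A = (e *+ 2 * (e *+ 2))%:E.
  rewrite /A /plane_measure /= product_measure1E; try by apply: open_measurable; exact: ball_open.
  by rewrite EFinM; congr (_ * _)%E;
    apply: lebesgue_measure_ball; exact: ltW.
have le1 : ((F z / 2 * (e *+ 2 * (e *+ 2)))%:E <= (I2 F)%:E)%E.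
  rewrite I2_E// EFinM -muA -integral_cst//.
  have mF : measurable_fun (setT : set mP) (fun y => (F y)%:E).
    by apply/measurable_EFinP; exact: continuous_measurable_fun_plane.
  apply: (@le_trans _ _ (\int[mu]_(y in A) (F y)%:E)%E).
    apply: ge0_le_integral => //.
    - by move=> y _; rewrite lee_fin divr_ge0// ltW.
    - exact: measurable_funS mF.
    - move=> -[y1 y2] [/= h1 h2]; rewrite lee_fin ltW//; apply: He.
      by split.
  by apply: ge0_subset_integral => // y _; rewrite lee_fin.
have : 0 < F z / 2 * (e *+ 2 * (e *+ 2)).
  by rewrite !mulr_gt0// ?divr_gt0// mulr2n addr_gt0.
by rewrite ltNge; move: le1; rewrite IF lee_fin => ->.
Qed.

Lemma line_derive F z v (t : R) : differentiable F (z + t *: v) ->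
  is_derive t 1 (fun t => F (z + t *: v)) ('D_v F (z + t *: v)).
Proof.
move=> dF.
have E : (fun h : R => h^-1 *: (F (z + (h *: (1 : R) + t) *: v) - F (z + t *: v))) =
   (fun h : R => h^-1 *: (F (h *: v + (z + t *: v)) - F (z + t *: v))).
  apply/funext => h; congr (_ *: (F _ - _)).
  by rewrite -[h *: 1]/(h * 1) mulr1 scalerDl addrCA.
apply: DeriveDef.
  by rewrite /derivable /= E; exact: diff_derivable.
by rewrite /derive /= E.
Qed.

(** The fundamental theorem of calculus on [-N, N]. *)
Lemma integral_line0 (f f' : R -> R) (N : R) : continuous f' ->
  (forall x : R, is_derive x 1 f (f' x)) ->
  (forall x, N <= `|x| -> f x = 0 /\ f' x = 0) ->
  (\int[@lebesgue_measure R]_x (f' x)%:E = 0)%E.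
Proof.
move=> cf' df HN.
pose M := Num.max N 1.
have M0 : 0 < M by rewrite lt_max ltr01 orbT.
have HM x : M <= `|x| -> f x = 0 /\ f' x = 0.
  by rewrite ge_max => /andP[/HN].
have -> : (\int[@lebesgue_measure R]_x (f' x)%:E = \int[@lebesgue_measure R]_(x in `[(- M)%R, M]) (f' x)%:E)%E.
  rewrite [RHS]integral_mkcond; apply: eq_integral => x _.
  rewrite patchE; case: ifPn => // /negP; rewrite inE /= in_itv /= -ler_norml => /negP.
  by rewrite -ltNge => /ltW/HM[_ ->].
have cf : continuous f.
  move=> x; apply: differentiable_continuous; apply/derivable1_diffP.
  by have [] := df x.
rewrite (@continuous_FTC2 _ f' f).
- by rewrite (HM M _).1 ?gtr0_norm// (HM (- M) _).1 ?normrN ?gtr0_norm// subee.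
- by rewrite gtrN.
- exact: continuous_subspaceT.
- split.
  + by move=> x _; have [] := df x.
  + by apply: cvg_at_right_filter; exact: cf.
  + by apply: cvg_at_left_filter; exact: cf.
- by move=> x _; rewrite derive1E; have [_ ->] := df x.
Qed.

Lemma pairl_continuous (y : R) : continuous (fun x : R => (x, y)).
Proof.
move=> x; apply/cvgrPdist_lt => e e0.
near=> t; rewrite prod_normE /= subrr normr0 gt_max e0 andbT.
near: t; exact: cvgr_dist_lt.
Unshelve. all: by end_near. Qed.

Lemma pairr_continuous (x : R) : continuous (fun y : R => (x, y)).
Proof.
move=> y; apply/cvgrPdist_lt => e e0.
near=> t; rewrite prod_normE /= subrr normr0 gt_max e0 /=.
near: t; exact: cvgr_dist_lt.
Unshelve. all: by end_near. Qed.

(** Fubini reduces the claim to the lines parallel to the axis. *)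
Lemma I2_D1 F : Cc F -> (forall z, differentiable F z) ->
  Cc ('D_(1, 0) F) -> I2 ('D_(1, 0) F) = 0.
Proof.
move=> [cF [N HN]] dF CD; have [cD [N' HN']] := CD.
apply/EFin_inj; rewrite I2_E// /plane_measure.
rewrite -(@integral21_prod_meas1 _ _ mR mR); last exact: Cc_integrable.
rewrite integral0_eq// => y _.
apply: (@integral_line0 (fun x => F (x, y)) _ (Num.max N N')).
- move=> x; apply: (@continuous_comp _ _ _ (fun x => (x, y)) ('D_(1, 0) F)).
    exact: pairl_continuous.
  exact: cD.
- move=> x.
  have E : (fun x => F (x, y)) = (fun t => F ((0, y) + t *: (1, 0))).
    apply/funext => t; congr F; rewrite [RHS]surjective_pairing /=.
    by rewrite scaler0 addr0 add0r -[t *: 1]/(t * 1) mulr1.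
  have E2 : (x, y) = (0, y) + x *: (1, 0) :> R * R.
    rewrite [RHS]surjective_pairing /=.
    by rewrite scaler0 addr0 add0r -[x *: 1]/(x * 1) mulr1.
  by rewrite E E2; exact: line_derive.
- move=> x; rewrite ge_max => /andP[h1 h2]; split.
  + by apply: HN; rewrite prod_normE /= le_max h1.
  + by apply: HN'; rewrite prod_normE /= le_max h2.
Qed.

Lemma I2_D2 F : Cc F -> (forall z, differentiable F z) ->
  Cc ('D_(0, 1) F) -> I2 ('D_(0, 1) F) = 0.
Proof.
move=> [cF [N HN]] dF CD; have [cD [N' HN']] := CD.
apply/EFin_inj; rewrite I2_E// /plane_measure.
rewrite -(@integral12_prod_meas1 _ _ mR mR); last exact: Cc_integrable.
rewrite integral0_eq// => x _.
apply: (@integral_line0 (fun y => F (x, y)) _ (Num.max N N')).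
- move=> y; apply: (@continuous_comp _ _ _ (fun y => (x, y)) ('D_(0, 1) F)).
    exact: pairr_continuous.
  exact: cD.
- move=> y.
  have E : (fun y => F (x, y)) = (fun t => F ((x, 0) + t *: (0, 1))).
    apply/funext => t; congr F; rewrite [RHS]surjective_pairing /=.
    by rewrite scaler0 addr0 add0r -[t *: 1]/(t * 1) mulr1.
  have E2 : (x, y) = (x, 0) + y *: (0, 1) :> R * R.
    rewrite [RHS]surjective_pairing /=.
    by rewrite scaler0 addr0 add0r -[y *: 1]/(y * 1) mulr1.
  by rewrite E E2; exact: line_derive.
- move=> y; rewrite ge_max => /andP[h1 h2]; split.
  + by apply: HN; rewrite prod_normE /= le_max h1 orbT.
  + by apply: HN'; rewrite prod_normE /= le_max h2 orbT.
Qed.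

Lemma translate_continuous G y : continuous G -> continuous (fun z : R * R => G (z - y)).
Proof.
move=> cG z; apply: (@continuous_comp _ _ _ (fun z : R * R => z - y) G); last exact: cG.
by apply: cvgB; [exact: cvg_id|exact: cvg_cst].
Qed.

Lemma reflect_continuous G z : continuous G -> continuous (fun y : R * R => G (z - y)).
Proof.
move=> cG y; apply: (@continuous_comp _ _ _ (fun y : R * R => z - y) G); last exact: cG.
by apply: cvgB; [exact: cvg_cst|exact: cvg_id].
Qed.

Definition plane : set mP -> \bar R := mu.

HB.instance Definition _ := Measure.copy plane mu.

Lemma plane_sigma_finite : sigma_finite setT plane.
Proof.
exists (fun n => sq n%:R).
  apply/seteqP; split=> // z _; exists (Num.truncn `|z|).+1 => //=.
  by rewrite /sq /= ltW// truncnS_gt.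
by move=> n; split; [exact: sq_measurable|exact: sq_finite].
Qed.

HB.instance Definition _ :=
  @Measure_isSigmaFinite.Build _ mP R plane plane_sigma_finite.

Let leb2 : {sigma_finite_measure set mP -> \bar R} := plane.

Lemma I2_fubini F G H : Cc F -> Cc G -> Cc H ->
  I2 (fun z => F z * I2 (fun y => G (z - y) * H y)) =
  I2 (fun y => I2 (fun z => F z * G (z - y)) * H y).
Proof.
move=> CF CG CH; have [cF _] := CF; have [cG _] := CG; have [cH _] := CH.
have C1 z : Cc (fun y => G (z - y) * H y).
  by apply: Cc_mull => //; exact: reflect_continuous.
have C2 y : Cc (fun z => F z * G (z - y)).
  by apply: Cc_mulr => //; exact: translate_continuous.
pose f (p : mP * mP) : \bar R := (F p.1 * G (p.1 - p.2) * H p.2)%:E.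
have mF := continuous_measurable_fun_plane cF.
have mG := continuous_measurable_fun_plane cG.
have mH := continuous_measurable_fun_plane cH.
have mf : measurable_fun setT f.
  apply/measurable_EFinP; apply: measurable_funM; last first.
    exact: measurableT_comp mH measurable_snd.
  apply: measurable_funM; first exact: measurableT_comp mF measurable_fst.
  apply: (measurableT_comp mG (g := fun p : mP * mP => (p.1 - p.2 : mP))).
  apply: (@measurable_fun_pair _ _ _ (mP * mP)%type mR mR
    (fun p => p.1.1 - p.2.1) (fun p => p.1.2 - p.2.2)).
    apply: measurable_funB.
      exact: (measurableT_comp measurable_fst measurable_fst).
    exact: (measurableT_comp measurable_fst measurable_snd).
  apply: measurable_funB.
    exact: (measurableT_comp measurable_snd measurable_fst).
  exact: (measurableT_comp measurable_snd measurable_snd).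
have [M M0 HM] := Cc_bounded CG.
have intf : (leb2 \x leb2)%E.-integrable setT f.
  apply/(integrable12ltyP leb2 leb2 mf).
  apply: (@le_lt_trans _ _ (\int[mu]_z (M * I2 (fun y => `|H y|) * `|F z|)%:E)%E); last first.
    rewrite -I2_E ?ltry//; apply: Cc_scale; exact: Cc_norm.
  apply: ge0_le_integral => //.
  - by move=> z _; apply: integral_ge0.
  - apply: (@measurable_fun_fubini_tonelli_F _ _ mP mP R leb2 (fun p => `|f p|)%E) => //.
    exact: measurableT_comp.
  - apply/measurable_EFinP; apply: continuous_measurable_fun_plane.
    by have [] : Cc (fun z => M * I2 (fun y => `|H y|) * `|F z|) by apply: Cc_scale; exact: Cc_norm.
  - move=> z _.
    have CC : Cc (fun y => M * `|F z| * `|H y|) by apply: Cc_scale; exact: Cc_norm.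
    rewrite mulrAC -I2_scale; last exact: Cc_norm.
    rewrite I2_E//; apply: ge0_le_integral => //.
    + apply: measurableT_comp => //; apply/measurable_EFinP.
      have -> : (fun y : mP => F z * G (z - y) * H y) = (fun y => F z * (G (z - y) * H y)).
        by apply/funext => y; rewrite mulrA.
      by apply: continuous_measurable_fun_plane; have [] := Cc_scale (F z) (C1 z).
    + by apply/measurable_EFinP; apply: continuous_measurable_fun_plane; have [] := CC.
    + move=> y _; rewrite lee_fin !normrM ler_wpM2r// mulrC ler_wpM2r//.
have := Fubini intf.
rewrite /I2 /Rintegral => E; congr fine.
transitivity (\int[leb2]_x \int[leb2]_y f (x, y))%E.
  apply: eq_integral => z _; rewrite -I2_scale// I2_E; last exact: Cc_scale.
  by apply: eq_integral => y _; rewrite /f/= mulrA.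
rewrite E; apply: eq_integral => y _.
rewrite mulrC -I2_scale// I2_E; last exact: Cc_scale.
by apply: eq_integral => z _; rewrite /f/= mulrC.
Qed.

End Integral.

(** * Functionals on test functions *)

Section Weyl.
Variable R : realType.
Implicit Types (f g eta : R * R -> R) (v z h c : R * R) (r d : R).

(** The support stays away from the boundary of the ball, which leaves room for
    small translations. *)
Definition tst c r eta := rsmooth_on setT eta /\
  exists2 r', r' < r & forall z, r' <= `|z - c| -> eta z = 0.

Lemma tst_Cc c r eta : tst c r eta -> Cc eta.
Proof.
move=> [Se [r' _ H]]; split; first exact: rs_continuous.
exists (r' + `|c|) => z Hz; apply: H.
by rewrite -(lerD2r `|c|); apply: le_trans Hz _; rewrite -{1}(subrK c z) ler_normD.
Qed.

Lemma tst_add c r f g : tst c r f -> tst c r g -> tst c r (fun z => f z + g z).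
Proof.
move=> [Sf [r1 r1r H1]] [Sg [r2 r2r H2]]; split; first exact: rs_add openT Sf Sg.
exists (Num.max r1 r2); first by rewrite gt_max r1r.
by move=> z; rewrite ge_max => /andP[h1 h2]; rewrite H1// H2// addr0.
Qed.

Lemma tst_scale c r (a : R) f : tst c r f -> tst c r (fun z => a * f z).
Proof.
move=> [Sf [r1 r1r H1]]; split; first exact: rs_mul openT (rs_cst _) Sf.
by exists r1 => // z h1; rewrite H1// mulr0.
Qed.

Lemma tst_opp c r f : tst c r f -> tst c r (fun z => - f z).
Proof.
by move=> /(tst_scale (-1)); congr tst; apply/funext => z; rewrite mulN1r.
Qed.

Lemma tst_sub c r f g : tst c r f -> tst c r g -> tst c r (fun z => f z - g z).
Proof. by move=> Hf Hg; apply: tst_add => //; exact: tst_opp. Qed.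

Lemma tst_D c r f v : tst c r f -> tst c r ('D_v f).
Proof.
move=> [Sf [r1 r1r H1]]; split; first exact: rs_D.
exists ((r1 + r) / 2); first lra.
move=> z Hz.
pose U : set (R * R) := [set z | r1 < `|z - c|].
have oU : open U.
  rewrite openE => y Uy; rewrite /interior /U.
  have cn : {for y, continuous (fun z => `|z - c|)}.
    by apply: cvg_norm; apply: cvgB; [exact: cvg_id|exact: cvg_cst].
  by have := cvgr_gt _ cn; apply.
have Uz : U z by rewrite /U /=; lra.
have [_ ->] := @diff_ext _ U (fun=> 0) f z oU (fun y Uy => esym (H1 y (ltW Uy))) Uz (differentiable_cst _ _).
exact: D_cst.
Qed.

Lemma tst_le c r r2 f : r <= r2 -> tst c r f -> tst c r2 f.
Proof.
by move=> rr [Sf [r1 r1r H1]]; split=> //; exists r1 => //; exact: lt_le_trans rr.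
Qed.

Lemma tst_mul c r f eta : rsmooth_on (ball c r) f -> tst c r eta ->
  tst c r (fun z => f z * eta z).
Proof.
move=> Sf [Se [r1 r1r H1]]; split; last first.
  by exists r1 => // z h1; rewrite H1// mulr0.
pose U : set (R * R) := [set z | r1 < `|z - c|].
have oU : open U.
  rewrite openE => y Uy; rewrite /interior /U.
  have cn : {for y, continuous (fun z => `|z - c|)}.
    by apply: cvg_norm; apply: cvgB; [exact: cvg_id|exact: cvg_cst].
  by have := cvgr_gt _ cn; apply.
apply: rs_local => z _; case: (ltP r1 `|z - c|) => hz.
  exists U; split=> //; apply: rs_ext (rs_cst 0) => // y Uy.
  by rewrite H1 ?mulr0// ltW.
exists (ball c r); split.
- exact: ball_open.
- by rewrite -ball_normE /= distrC; exact: le_lt_trans r1r.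
- apply: rs_mul => //; first exact: ball_open.
  by apply: rs_sub Se.
Qed.

Lemma tst_shift f d c r z : tst 0 d f -> `|z - c| + d <= r ->
  tst c r (fun y => f (y - z)).
Proof.
move=> [Sf [d' d'd Hf]] zd; split.
  have := rs_affine 1 (- z) Sf.
  by apply: rs_ext; [exact: openT|move=> y _; rewrite scale1r].
exists (`|z - c| + d'); first by apply: lt_le_trans zd; rewrite ltrD2l.
move=> y; rewrite -lerBrDl => h; apply: Hf; rewrite subr0.
apply: le_trans h _; rewrite lerBlDr.
by have := ler_distD z y c.
Qed.

Lemma MVT_line f z h :
  (forall t : R, 0 <= t <= 1 -> differentiable f (z + t *: h)) ->
  exists2 t : R, 0 <= t <= 1 & f (z + h) - f z = 'D_h f (z + t *: h).
Proof.
move=> df.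
have [||t t01 E] := @MVT_segment R (fun t => f (z + t *: h)) (fun t => 'D_h f (z + t *: h)) 0 1 ler01.
- by move=> t /andP[/ltW t0 /ltW t1]; apply: line_derive; apply: df; rewrite t0.
- apply: derivable_within_continuous => t; rewrite in_itv/= => t01.
  by have [] := @line_derive R f z h t (df _ t01).
exists t; first by move: t01; rewrite in_itv.
by move: E; rewrite scale1r scale0r addr0 subr0 mulr1.
Qed.

Lemma Cc_D f v : rsmooth_on setT f -> Cc f -> Cc ('D_v f).
Proof.
move=> Sf [_ [N HN]].
have T : tst 0 (N + 1) f.
  by split=> //; exists N; [rewrite ltrDl|move=> z; rewrite subr0; exact: HN].
by have /tst_Cc := tst_D v T.
Qed.

(** A bound uniform in the base point, from the two partial derivatives. *)
Lemma D_bound f : rsmooth_on setT f -> Cc f ->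
  exists2 K : R, 0 <= K & forall z h, `|'D_h f z| <= K * `|h|.
Proof.
move=> Sf Cf.
have [K1 K10 H1] := Cc_bounded (Cc_D (1, 0) Sf Cf).
have [K2 K20 H2] := Cc_bounded (Cc_D (0, 1) Sf Cf).
exists (K1 + K2); first exact: addr_ge0.
move=> z h; rewrite D_lin; last exact: rs_diff Sf _.
have h1 : `|h.1| <= `|h| by rewrite prod_normE /= le_max lexx.
have h2 : `|h.2| <= `|h| by rewrite prod_normE /= le_max lexx orbT.
apply: le_trans (ler_normD _ _) _; rewrite mulrDl !normrM.
by apply: lerD; rewrite mulrC ler_pM.
Qed.

Lemma rs_lipschitz f : rsmooth_on setT f -> Cc f ->
  exists2 K : R, 0 <= K & forall z h, `|f (z + h) - f z| <= K * `|h|.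
Proof.
move=> Sf Cf; have [K K0 HK] := D_bound Sf Cf; exists K => // z h.
have [t _ ->] := @MVT_line f z h (fun t _ => rs_diff Sf (I : setT (z + t *: h))).
exact: HK.
Qed.

Lemma taylor2 f : rsmooth_on setT f -> Cc f ->
  exists2 K : R, 0 <= K &
    forall z h, `|f (z + h) - f z - 'D_h f z| <= K * `|h| ^+ 2.
Proof.
move=> Sf Cf.
have [K1 K10 H1] := rs_lipschitz (rs_D (1, 0) Sf) (Cc_D (1, 0) Sf Cf).
have [K2 K20 H2] := rs_lipschitz (rs_D (0, 1) Sf) (Cc_D (0, 1) Sf Cf).
have df y : differentiable f y by exact: rs_diff Sf (I : setT y).
exists (K1 + K2); first exact: addr_ge0.
move=> z h; have [t /andP[t0 t1] ->] := @MVT_line f z h (fun t _ => df (z + t *: h)).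
have h1 : `|h.1| <= `|h| by rewrite prod_normE /= le_max lexx.
have h2 : `|h.2| <= `|h| by rewrite prod_normE /= le_max lexx orbT.
have th : `|t *: h| <= `|h| by rewrite normrZ ger0_norm// ler_piMl.
rewrite ![in 'D_h f _]D_lin//.
set A := 'D_(1, 0) f; set B := 'D_(0, 1) f.
have -> : h.1 * A (z + t *: h) + h.2 * B (z + t *: h) - (h.1 * A z + h.2 * B z) =
  h.1 * (A (z + t *: h) - A z) + h.2 * (B (z + t *: h) - B z) by ring.
apply: le_trans (ler_normD _ _) _; rewrite mulrDl expr2 !normrM !mulrA.
apply: lerD; rewrite mulrC ler_pM//.
- by apply: le_trans (H1 _ _) _; rewrite ler_wpM2l.
- by apply: le_trans (H2 _ _) _; rewrite ler_wpM2l.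
Qed.

(** Distributions of order zero on the ball; a functional that is bounded for a
    weighted L2 norm is one of them. *)
Record bdfun c r (P : (R * R -> R) -> R) : Prop := {
  bd_lin : forall (a : R) f g, tst c r f -> tst c r g ->
    P (fun z => a * f z + g z) = a * P f + P g;
  bd_bound : exists2 C : R, 0 <= C & forall f (M : R), tst c r f ->
    (forall z, `|f z| <= M) -> `|P f| <= C * M }.

Section Functional.
Variables (c : R * R) (r : R) (P : (R * R -> R) -> R).
Hypothesis bP : bdfun c r P.

Lemma tst0 f : tst c r f -> tst c r (fun=> 0).
Proof.
by move=> /(tst_scale 0); congr tst; apply/funext => z; rewrite mul0r.
Qed.

Lemma bd_ext f g : (forall z, f z = g z) -> P f = P g.
Proof. by move=> fg; congr P; apply/funext. Qed.

Lemma bd0 f : tst c r f -> P (fun=> 0) = 0.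
Proof.
move=> /tst0 T0.
have := bd_lin bP (-1) T0 T0.
have -> : P (fun=> -1 * 0 + 0) = P (fun=> 0).
  by apply: bd_ext => z; rewrite mulr0 addr0.
by move=> E; lra.
Qed.

Lemma bd_scale (a : R) f : tst c r f -> P (fun z => a * f z) = a * P f.
Proof.
move=> Tf; have := bd_lin bP a Tf (tst0 Tf).
by rewrite (bd0 Tf) addr0 => <-; apply: bd_ext => z; rewrite addr0.
Qed.

Lemma bd_add f g : tst c r f -> tst c r g ->
  P (fun z => f z + g z) = P f + P g.
Proof.
move=> Tf Tg; have := bd_lin bP 1 Tf Tg; rewrite mul1r => <-.
by apply: bd_ext => z; rewrite mul1r.
Qed.

Lemma bd_opp f : tst c r f -> P (fun z => - f z) = - P f.
Proof.
move=> Tf; rewrite -mulN1r -bd_scale//.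
by apply: bd_ext => z; rewrite mulN1r.
Qed.

Lemma bd_sub f g : tst c r f -> tst c r g ->
  P (fun z => f z - g z) = P f - P g.
Proof. by move=> Tf Tg; rewrite bd_add ?bd_opp//; exact: tst_opp. Qed.

(** Taylor's formula is uniform over the plane and [P] is bounded for the sup
    norm, so [P] may be applied to the remainder: differentiating in the
    translation falls on the test function. *)
Lemma shift_diff f d z : tst 0 d f -> `|z - c| + d < r ->
  differentiable (fun z => P (fun y => f (y - z))) z /\
  forall v, 'D_v (fun z => P (fun y => f (y - z))) z =
    - P (fun y => 'D_v f (y - z)).
Proof.
move=> Tf0 zd; have [Sf _] := Tf0; have Cf := tst_Cc Tf0.
have [K K0 HK] := taylor2 Sf Cf.
have [C C0 HC] := bd_bound bP.
have df y : differentiable f y by exact: rs_diff Sf (I : setT y).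
pose e0 := (r - (`|z - c| + d)) / 2.
have e00 : 0 < e0 by rewrite /e0; lra.
have Tf h : `|h| < e0 -> tst c r (fun y => f (y - (z + h))).
  move=> he; apply: tst_shift Tf0 _.
  have : `|z + h - c| <= `|z - c| + `|h| by rewrite addrAC ler_normD.
  rewrite /e0 in he *; lra.
have TD v : tst c r (fun y => 'D_v f (y - z)).
  by apply: tst_shift (tst_D v Tf0) _; exact: ltW.
have T0 : tst c r (fun y => f (y - z)).
  by apply: tst_shift Tf0 _; exact: ltW.
have [dP DP] : differentiable (fun z => P (fun y => f (y - z))) z /\
  'd (fun z => P (fun y => f (y - z))) z =
    lin2 (- P (fun y => 'D_(1, 0) f (y - z))) (- P (fun y => 'D_(0, 1) f (y - z))) :> (R * R -> R).
  apply: diff_eps => e ee.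
  exists (Num.min e0 (e / (C * K + 1))).
    by rewrite lt_min e00 divr_gt0// ltr_wpDl// mulr_ge0.
  move=> h; rewrite lt_min => /andP[he0 he].
  have -> : P (fun y => f (y - (z + h))) - P (fun y => f (y - z)) -
      lin2 (- P (fun y => 'D_(1, 0) f (y - z))) (- P (fun y => 'D_(0, 1) f (y - z))) h =
    P (fun y => (f (y - (z + h)) - f (y - z)) +
       (h.1 * 'D_(1, 0) f (y - z) + h.2 * 'D_(0, 1) f (y - z))).
    rewrite bd_add; first last.
    - by apply: tst_add; apply: tst_scale.
    - by apply: tst_sub => //; exact: Tf.
    rewrite bd_sub//; last exact: Tf.
    rewrite bd_add; [|exact: tst_scale..].
    by rewrite !bd_scale// /lin2; ring.
  apply: le_trans (HC _ (K * `|h| ^+ 2) _ _) _.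
  - apply: tst_add; first by apply: tst_sub => //; exact: Tf.
    by apply: tst_add; apply: tst_scale.
  - move=> y; have := HK (y - z) (- h); rewrite normrN.
    have -> : y - z - h = y - (z + h) by rewrite opprD addrA.
    have -> : 'D_(- h) f (y - z) = - (h.1 * 'D_(1, 0) f (y - z) + h.2 * 'D_(0, 1) f (y - z)).
      by rewrite D_lin//=; ring.
    by rewrite opprK.
  - rewrite mulrA expr2 mulrA ler_wpM2r//.
    move: he; rewrite ltr_pdivlMr ?ltr_wpDl ?mulr_ge0// => he.
    by apply: le_trans (ltW he); rewrite mulrC ler_wpM2l// lerDl.
split=> // v; rewrite (deriveE _ dP) DP /lin2.
have -> : P (fun y => 'D_v f (y - z)) = P (fun y => v.1 * 'D_(1, 0) f (y - z) + v.2 * 'D_(0, 1) f (y - z)).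
  by apply: bd_ext => y; rewrite D_lin.
rewrite bd_add; [|exact: tst_scale..].
by rewrite !bd_scale//; ring.
Qed.

Lemma shift_smooth f d : tst 0 d f ->
  rsmooth_on (ball c (r - d)) (fun z => P (fun y => f (y - z))).
Proof.
move=> Tf; apply/rsmoothP => n.
have zb z : ball c (r - d) z -> `|z - c| + d < r.
  by rewrite -ball_normE /= distrC; lra.
elim: n f Tf => [|n IH] f Tf.
  by split=> // z /zb h; have [] := shift_diff Tf h.
apply: CnS_of_D; first exact: ball_open.
  by move=> z /zb h; have [] := shift_diff Tf h.
move=> v; exists (fun z => -1 * P (fun y => 'D_v f (y - z))).
  apply: Cn_mul; [exact: ball_open|exact: Cn_cst|].
  exact: (IH _ (tst_D v Tf)).
by move=> z /zb h; have [_ ->] := shift_diff Tf h; rewrite mulN1r.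
Qed.

End Functional.

Lemma chi_tst d : 0 < d -> tst 0 (2 * d) (chi d).
Proof.
move=> d0; split; first exact: rs_chi.
by exists d; [lra|move=> z; rewrite subr0; exact: chi_norm0].
Qed.

Lemma rho_tst d d' : 0 < d -> d < d' -> tst 0 d' (rho d).
Proof.
move=> d0 dd; split; first exact: rs_rho.
by exists d => // z; rewrite subr0; exact: rho_norm0.
Qed.

Lemma bdfun_I2 c r u : Cc u -> bdfun c r (fun eta => I2 (fun z => u z * eta z)).
Proof.
move=> Cu; split.
  move=> a f g Tf Tg; have [cf _] := tst_Cc Tf; have [cg _] := tst_Cc Tg.
  have Cf : Cc (fun z => u z * f z) by exact: Cc_mulr.
  have Cg : Cc (fun z => u z * g z) by exact: Cc_mulr.
  rewrite -I2_scale// -I2_add//; last exact: Cc_scale.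
  by congr I2; apply/funext => z; ring.
exists (I2 (fun z => `|u z|)); first by apply: I2_ge0 => z; exact: normr_ge0.
move=> f M Tf HM; have [cf _] := tst_Cc Tf.
apply: le_trans (I2_norm _) _; first exact: Cc_mulr.
rewrite mulrC -I2_scale; last exact: Cc_norm.
apply: I2_le => [||z].
- by apply: Cc_norm; exact: Cc_mulr.
- by apply: Cc_scale; exact: Cc_norm.
- by rewrite normrM mulrC ler_wpM2r.
Qed.

Lemma I2_shift f z : rsmooth_on setT f -> Cc f ->
  I2 (fun y => f (y - z)) = I2 f.
Proof.
move=> Sf Cf; have [cf [N HN]] := Cf.
pose d := Num.max N 0 + 1.
have d0 : 0 < d by rewrite ltr_wpDl// le_max lexx orbT.
have Tf : tst 0 d f.
  split=> //; exists (Num.max N 0); first by rewrite ltrDl.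
  by move=> y; rewrite subr0 ge_max => /andP[/HN].
pose r := `|z| + d + 1.
pose P eta := I2 (fun y => chi (4 * r) y * eta y).
have r0 : 0 < r by rewrite /r ltr_pwDr// addr_ge0// ltW.
have bP : bdfun 0 r P.
  by apply: bdfun_I2; apply: tst_Cc (chi_tst _); rewrite mulr_gt0.
have PE g (y : R * R) : tst 0 d g -> `|y| <= `|z| -> P (fun x => g (x - y)) = I2 (fun x => g (x - y)).
  move=> Tg yz; congr I2; apply/funext => x.
  have [xr|xr] := leP `|x| r.
    by rewrite chi_norm1 ?mul1r ?mulr_gt0//; lra.
  have [_ [d' d'd H]] := Tg; rewrite (H (x - y)) ?mulr0//.
  rewrite subr0; have := lerB_dist x y; rewrite /r in xr; lra.
have ID (y : R * R) v : I2 (fun x => 'D_v f (x - y)) = 0.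
  pose g x := f (x - y).
  have Tg : tst y d g by apply: tst_shift Tf _; rewrite subrr normr0 add0r.
  have [Sg _] := Tg; have Cg := tst_Cc Tg.
  have dg x : differentiable g x by exact: rs_diff Sg (I : setT x).
  have -> : (fun x => 'D_v f (x - y)) = (fun x => v.1 * 'D_(1, 0) g x + v.2 * 'D_(0, 1) g x).
    apply/funext => x; rewrite -D_lin//.
    have dfx : differentiable f (1 *: x - y) by exact: rs_diff Sf (I : setT _).
    have [_ /(_ v)] := diff_affine dfx; rewrite mul1r scale1r => <-.
    by congr ('D_v _ x); apply/funext => t; rewrite scale1r.
  have C1 := Cc_D (1, 0) Sg Cg; have C2 := Cc_D (0, 1) Sg Cg.
  rewrite (I2_add (Cc_scale _ C1) (Cc_scale _ C2)) (I2_scale _ C1) (I2_scale _ C2).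
  by rewrite (I2_D1 Cg dg C1) (I2_D2 Cg dg C2) !mulr0 addr0.
pose W (y : R * R) := P (fun x => f (x - y)).
have nseg (t : R) : 0 <= t <= 1 -> `|0 + t *: z| <= `|z|.
  by move=> /andP[t0 t1]; rewrite add0r normrZ ger0_norm// ler_piMl.
have inr (y : R * R) : `|y| <= `|z| -> `|y - 0| + d < r by rewrite subr0 /r; lra.
have [t t01] := @MVT_line W 0 z (fun t t01 => (shift_diff bP Tf (@inr _ (nseg t t01))).1).
have [_ ->] := shift_diff bP Tf (@inr _ (nseg t t01)).
rewrite (PE _ _ (tst_D z Tf) (nseg t t01)) ID oppr0 add0r => /eqP.
rewrite subr_eq0 /W PE// PE// ?normr0// => /eqP ->.
by congr I2; apply/funext => x; rewrite subr0.
Qed.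

End Weyl.

(** * Weyl's lemma for the Cauchy-Riemann system *)

Section WeylLemma.
Variable R : realType.
Implicit Types (f g eta : R * R -> R) (v z h c : R * R) (r d : R).

Lemma D_shift f z v y : rsmooth_on setT f ->
  'D_v (fun x : R * R => f (x - z)) y = 'D_v f (y - z).
Proof.
move=> Sf; have dfx : differentiable f (1 *: y - z) by exact: rs_diff Sf (I : setT _).
have [_ /(_ v)] := diff_affine dfx; rewrite mul1r scale1r => <-.
by congr ('D_v _ y); apply/funext => t; rewrite scale1r.
Qed.

Lemma rho_even d z : rho d (- z) = rho d z.
Proof. by rewrite /rho /sqn /= !sqrrN. Qed.

Opaque I2 chi rho.

Lemma rho_sym d z y : rho d (z - y) = rho d (y - z).
Proof. by rewrite -rho_even opprB. Qed.

Lemma rho_Cc d : 0 < d -> Cc (rho d).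
Proof. by move=> d0; apply: (tst_Cc (rho_tst d0 (ltr_pwDr ltr01 (lexx d)))). Qed.

Lemma tst_fst c r f (a : R) : tst c r f -> tst c r (fun z => (z.1 - a) * f z).
Proof.
move=> Tf; apply: tst_mul => //; apply: (@rs_sub _ setT) => //.
by apply: rs_subr; [exact: openT|exact: rs_fst|exact: rs_cst].
Qed.

Lemma tst_snd c r f (a : R) : tst c r f -> tst c r (fun z => (z.2 - a) * f z).
Proof.
move=> Tf; apply: tst_mul => //; apply: (@rs_sub _ setT) => //.
by apply: rs_subr; [exact: openT|exact: rs_snd|exact: rs_cst].
Qed.

(** The same around another centre, as test functions in a given ball. *)
Lemma rho_diff_shift c r d d' z : 0 < d -> 0 < d' ->
  `|z - c| + d < r -> `|z - c| + d' < r ->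
  exists F G, [/\ tst c r F, tst c r G,
   (forall y, 'D_(1, 0) F y + 'D_(0, 1) G y = rho d (y - z) - rho d' (y - z)) &
   (forall y, 'D_(0, 1) F y = 'D_(1, 0) G y)].
Proof.
move=> d0 d'0 h1 h2; have [g [Sg Hg E1 E2]] := rho_diff d0 d'0.
pose D := (Num.max d d' + (r - `|z - c|)) / 2.
have mD : Num.max d d' < D.
  have : Num.max d d' < r - `|z - c| by rewrite gt_max; apply/andP; split; lra.
  rewrite /D; lra.
have Tg : tst 0 D g.
  by split=> //; exists (Num.max d d') => // y; rewrite subr0; exact: Hg.
have mdr : `|z - c| + D <= r.
  have : Num.max d d' < r - `|z - c| by rewrite gt_max; apply/andP; split; lra.
  rewrite /D; lra.
have T1 : tst 0 D (fun y => y.1 * g y).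
  by have := tst_fst 0 Tg; congr tst; apply/funext => y; rewrite subr0.
have T2 : tst 0 D (fun y => y.2 * g y).
  by have := tst_snd 0 Tg; congr tst; apply/funext => y; rewrite subr0.
exists (fun y => (y - z).1 * g (y - z)), (fun y => (y - z).2 * g (y - z)).
have [S1 _] := T1; have [S2 _] := T2.
split; [exact: tst_shift T1 _|exact: tst_shift T2 _|move=> y|move=> y].
  by rewrite (D_shift z (1, 0) y S1) (D_shift z (0, 1) y S2) E1.
by rewrite (D_shift z (0, 1) y S1) (D_shift z (1, 0) y S2) E2.
Qed.

(** The difference is a divergence. *)
Lemma I2_rho d d' : 0 < d -> 0 < d' -> I2 (rho d) = I2 (rho d').
Proof.
move=> d0 d'0; pose r := d + d' + 1.
have h1 : `|0 - 0 : R * R| + d < r by rewrite subr0 normr0 /r; lra.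
have h2 : `|0 - 0 : R * R| + d' < r by rewrite subr0 normr0 /r; lra.
have [F [G [TF TG E1 _]]] := rho_diff_shift d0 d'0 h1 h2.
have dF y : differentiable F y by exact: rs_diff TF.1 (I : setT y).
have dG y : differentiable G y by exact: rs_diff TG.1 (I : setT y).
have C1 := tst_Cc (tst_D (1, 0) TF); have C2 := tst_Cc (tst_D (0, 1) TG).
have : I2 (fun y => 'D_(1, 0) F y + 'D_(0, 1) G y) = 0.
  by rewrite I2_add// (I2_D1 (tst_Cc TF) dF C1) (I2_D2 (tst_Cc TG) dG C2) addr0.
have -> : (fun y => 'D_(1, 0) F y + 'D_(0, 1) G y) = (fun y => rho d y - rho d' y).
  by apply/funext => y; rewrite E1 subr0.
by rewrite I2_sub; [move/eqP; rewrite subr_eq0 => /eqP|exact: rho_Cc..].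
Qed.

Lemma I2_rho_gt0 d : 0 < d -> 0 < I2 (rho d).
Proof.
move=> d0; have := I2_ge0 (rho_ge0 d0); rewrite le_eqVlt => /orP[/eqP E|//].
have [z] := rho_pos d0.
by rewrite (I2_eq0 (rho_Cc d0) (rho_ge0 d0) (esym E)) ltxx.
Qed.

Definition moll d eta z := I2 (fun y => rho d (z - y) * eta y).

Lemma moll_fun d eta : moll d eta = fun z => I2 (fun y => rho d (z - y) * eta y).
Proof. by []. Qed.

Lemma mollE d eta z : moll d eta z = I2 (fun y => eta y * rho d (y - z)).
Proof. by congr I2; apply/funext => y; rewrite rho_sym mulrC. Qed.

Lemma moll_smooth d u : 0 < d -> Cc u ->
  rsmooth_on setT (fun z => I2 (fun y => u y * rho d (y - z))).
Proof.
move=> d0 Cu; apply: rs_local => z _.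
have Tr : tst 0 (d + 1) (rho d) by apply: rho_tst => //; rewrite ltrDl.
exists (ball z (d + 2 - (d + 1))); split; first exact: ball_open.
  by apply: ballxx; lra.
exact: (shift_smooth (bdfun_I2 z (d + 2) Cu) Tr).
Qed.

Lemma moll_tst c r r' d eta : 0 < d -> r + d <= r' -> tst c r eta ->
  tst c r' (moll d eta).
Proof.
move=> d0 rr Te; have [Se [s sr Hs]] := Te; split.
  have := moll_smooth d0 (tst_Cc Te).
  by apply: rs_ext; [exact: openT|move=> z _; rewrite mollE].
exists (s + d); first by lra.
move=> z hz; rewrite /moll -[RHS](@I2_0 R); congr I2; apply/funext => y.
have [ys|ys] := leP s `|y - c|; first by rewrite Hs// mulr0.
rewrite rho_norm0// ?mul0r//.
have : `|z - c| <= `|z - y| + `|y - c| by exact: ler_distD.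
lra.
Qed.

(** [eta] is Lipschitz and the kernel is supported at distance [d]. *)
Lemma moll_approx c r eta : tst c r eta -> exists2 K : R, 0 <= K &
  forall d z, 0 < d -> `|moll d eta z - I2 (rho d) * eta z| <= K * (I2 (rho d) * d).
Proof.
move=> Te; have [Se _] := Te; have [K K0 HK] := rs_lipschitz Se (tst_Cc Te).
exists K => // d z d0.
have Sr := rs_rho d; have Cr := rho_Cc d0.
have [cr _] := Cr; have [ce _] := tst_Cc Te.
have Cz : Cc (fun y => rho d (z - y)).
  have Tr : tst 0 (d + 1) (rho d) by apply: rho_tst => //; rewrite ltrDl.
  have := tst_shift (c := z) (r := d + 1) (z := z) Tr.
  rewrite subrr normr0 add0r => /(_ (lexx _))/tst_Cc.
  by congr Cc; apply/funext => y; rewrite rho_sym.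
have Iz : I2 (fun y => rho d (z - y)) = I2 (rho d).
  rewrite -(I2_shift z Sr Cr); congr I2; apply/funext => y; exact: rho_sym.
have C1 := Cc_mulr Cz ce; have C2 := Cc_scale (eta z) Cz.
have C12 := Cc_sub C1 C2.
have -> : moll d eta z - I2 (rho d) * eta z =
    I2 (fun y => rho d (z - y) * eta y - eta z * rho d (z - y)).
  by rewrite (I2_sub C1 C2) (I2_scale _ Cz) Iz mulrC.
apply: le_trans (I2_norm C12) _.
rewrite -Iz [_ * d]mulrC mulrA -(I2_scale _ Cz); apply: I2_le.
- exact: Cc_norm.
- exact: Cc_scale.
move=> y; rewrite [eta z * _]mulrC -mulrBr normrM.
rewrite (ger0_norm (rho_ge0 d0 _)) mulrC.
have [dy|dy] := leP d `|z - y|; first by rewrite (rho_norm0 d0 dy) !mulr0.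
apply: ler_wpM2r; first exact: rho_ge0.
have := HK z (y - z); rewrite [z + _]addrC subrK => /le_trans; apply.
by apply: (ler_wpM2l K0); rewrite distrC; exact: ltW.
Qed.

Opaque moll.
Section Half.
Variables (c : R * R) (r : R) (u : nat -> R * R -> R).
Variables (P Q : (R * R -> R) -> R).
Hypotheses (r0 : 0 < r) (Cu : forall k, Cc (u k)).
Hypothesis bP : bdfun c r P.
Hypothesis approx : forall e : R, 0 < e -> exists k, forall f (M : R),
  tst c r f -> (forall z, `|f z| <= M) ->
  `|I2 (fun z => u k z * f z) - P f| <= e * M.
Hypothesis CR1 : forall f, tst c r f -> P ('D_(1, 0) f) = Q ('D_(0, 1) f).
Hypothesis CR2 : forall f, tst c r f -> Q ('D_(1, 0) f) = - P ('D_(0, 1) f).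

(** The value at [z] of the function that represents [P]: test [P] on a
    normalized kernel centred at [z]. *)
Definition weyl_rep z := (I2 (rho (r / 4)))^-1 * P (fun y => rho (r / 4) (y - z)).

Let r4 : 0 < r / 4. Proof. by rewrite divr_gt0. Qed.

(** The heart of the matter. Kernels of two sizes differ by the divergence of a
    curl-free field (F, G), and the Cauchy-Riemann equations of (P, Q) turn
    P (D_1 F + D_2 G) into Q (D_2 F - D_1 G) = 0: the mean of [P] over the
    kernel does not depend on its size. *)
Lemma P_rho d z : 0 < d -> d <= r / 4 -> `|z - c| < r / 2 ->
  P (fun y => rho d (y - z)) = I2 (rho d) * weyl_rep z.
Proof.
move=> d0 dr zr; rewrite /weyl_rep (I2_rho d0 r4) mulVKf ?gt_eqF ?I2_rho_gt0//.
have [||F [G [TF TG E1 E2]]] := @rho_diff_shift c r d (r / 4) z d0 r4; try lra.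
have T e : 0 < e -> e <= r / 4 -> tst c r (fun y => rho e (y - z)).
  move=> e0 er; have Tr : tst 0 (r / 2) (rho e) by apply: rho_tst => //; lra.
  apply: tst_shift Tr _; lra.
apply/eqP; rewrite -subr_eq0 -(bd_sub bP); [|exact: T..].
have -> : P (fun y => rho d (y - z) - rho (r / 4) (y - z)) =
    P (fun y => 'D_(1, 0) F y + 'D_(0, 1) G y).
  by apply: bd_ext => y; rewrite E1.
rewrite (bd_add bP (tst_D _ TF) (tst_D _ TG)) CR1//.
have -> : 'D_(0, 1) F = 'D_(1, 0) G by apply/funext.
by rewrite CR2// addNr.
Qed.

Lemma weyl_rep_smooth : rsmooth_on (ball c (r / 2)) weyl_rep.
Proof.
have r0' := r0.
apply: rs_mul; [exact: ball_open|exact: rs_cst|].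
have Tr : tst 0 (r / 2) (rho (r / 4)) by apply: rho_tst => //; lra.
by have := shift_smooth bP Tr; have -> : r - r / 2 = r / 2 by lra.
Qed.

Lemma weyl_rep_D v z : ball c (r / 2) z ->
  'D_v weyl_rep z = - ((I2 (rho (r / 4)))^-1 * P ('D_v (fun y : R * R => rho (r / 4) (y - z)))).
Proof.
have r0' := r0.
rewrite -ball_normE /= distrC => hz.
have Tr : tst 0 (r / 3) (rho (r / 4)) by apply: rho_tst => //; lra.
have [|dd E] := shift_diff (z := z) bP Tr; first by lra.
have dk : differentiable (fun _ : R * R => (I2 (rho (r / 4)))^-1) z.
  exact: differentiable_cst.
rewrite /weyl_rep (D_mul _ dk dd) D_cst mulr0 addr0 E mulrN; congr (- (_ * P _)).
by apply/funext => y; rewrite D_shift//; case: Tr.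
Qed.

(** [P] is applied under the integral sign of a mollification. For integration
    against the continuous functions [u k] this is Fubini's theorem, and the
    error made by replacing [P] with [u k] is controlled by the sup norm. *)
Lemma P_moll d eta : 0 < d -> d <= r / 4 -> tst c (r / 2) eta ->
  P (moll d eta) = I2 (rho d) * I2 (fun z => weyl_rep z * eta z).
Proof.
have r0' := r0.
move=> d0 dr Te.
have TG : tst c r (moll d eta) by apply: moll_tst Te => //; lra.
have Ce := tst_Cc Te; have Cr := rho_Cc d0.
have TU := tst_mul weyl_rep_smooth Te.
have CU := tst_Cc TU.
have [MG MG0 HMG] := Cc_bounded (tst_Cc TG).
have [Mr Mr0 HMr] := Cc_bounded Cr.
pose B := MG + Mr * I2 (fun y => `|eta y|).
have B0 : 0 <= B by rewrite addr_ge0// mulr_ge0// I2_ge0.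
have key e : 0 < e ->
    `|P (moll d eta) - I2 (rho d) * I2 (fun z => weyl_rep z * eta z)| <= e * B.
  move=> e0; have [k Hk] := approx e0.
  have h1 := Hk _ _ TG HMG.
  have h2 : `|I2 (fun z => u k z * moll d eta z) - I2 (rho d) * I2 (fun z => weyl_rep z * eta z)| <= e * (Mr * I2 (fun y => `|eta y|)).
    rewrite moll_fun (I2_fubini (Cu k) Cr Ce) -I2_scale//.
    have Ck : Cc (fun y => I2 (fun z => u k z * rho d (z - y)) * eta y).
      by apply: Cc_mull => //; apply: rs_continuous; exact: moll_smooth.
    rewrite -I2_sub//; last exact: Cc_scale.
    rewrite mulrA -I2_scale; last exact: Cc_norm.
    apply: le_trans (I2_norm _) _; first by apply: Cc_sub => //; exact: Cc_scale.
    apply: I2_le.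
    - by apply: Cc_norm; apply: Cc_sub => //; exact: Cc_scale.
    - by apply: Cc_scale; exact: Cc_norm.
    move=> y; rewrite mulrA -mulrBl normrM.
    have [_ [s sr Hs]] := Te.
    have [ys|ys] := leP s `|y - c|; first by rewrite Hs// normr0 !mulr0.
    rewrite ler_wpM2r// -P_rho//; last by apply: lt_trans ys _.
    apply: Hk => //.
    have Tr : tst 0 (r / 2) (rho d) by apply: rho_tst => //; lra.
    apply: tst_shift Tr _; lra.
  rewrite /B mulrDr; apply: le_trans (ler_distD (I2 (fun z => u k z * moll d eta z)) _ _) _.
  by rewrite lerD// distrC.
apply/eqP; rewrite -subr_eq0 -normr_le0.
have B1 : 0 < B + 1 by rewrite ltr_wpDl.
apply/ler_addgt0Pl => e e0; rewrite addr0.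
have := key (e / (B + 1)); rewrite divr_gt0// => /(_ isT)/le_trans; apply.
by rewrite mulrAC ler_pdivrMr// ler_pM2l// lerDl.
Qed.

(** Let the size [d] of the mollifier tend to 0 in [P_moll]. *)
Lemma weyl_repP eta : tst c (r / 2) eta ->
  P eta = I2 (fun z => weyl_rep z * eta z).
Proof.
have r0' := r0.
move=> Te; have [K K0 HK] := moll_approx Te; have [C C0 HC] := bd_bound bP.
have Te' : tst c r eta by apply: tst_le Te; lra.
pose c0 := I2 (rho (r / 4)).
have c00 : 0 < c0 by exact: I2_rho_gt0.
have key d : 0 < d -> d <= r / 4 ->
    `|I2 (fun z => weyl_rep z * eta z) - P eta| <= C * K * d.
  move=> d0 dr.
  have TG : tst c r (moll d eta) by apply: moll_tst Te => //; lra.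
  have cd : I2 (rho d) = c0 by exact: I2_rho.
  have : `|P (fun z => moll d eta z - c0 * eta z)| <= C * (K * (c0 * d)).
    apply: HC; first exact: (tst_sub TG (tst_scale _ Te')).
    by move=> z; rewrite -cd; exact: HK.
  rewrite (bd_sub bP TG (tst_scale _ Te')) (bd_scale bP _ Te') P_moll// cd.
  rewrite -mulrBr normrM (gtr0_norm c00).
  have -> : C * (K * (c0 * d)) = c0 * (C * K * d) by ring.
  by rewrite ler_pM2l.
apply/esym/eqP; rewrite -subr_eq0 -normr_le0.
apply/ler_addgt0Pl => e e0; rewrite addr0.
have CK : 0 < C * K + 1 by rewrite ltr_wpDl// mulr_ge0.
pose d := Num.min (r / 4) (e / (C * K + 1)).
have := key d; rewrite /d lt_min r4 divr_gt0// ge_min lexx => /(_ isT isT)/le_trans.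
apply; apply: (@le_trans _ _ (C * K * (e / (C * K + 1)))).
  by rewrite ler_wpM2l ?mulr_ge0// ge_min lexx orbT.
by rewrite mulrA ler_pdivrMr// mulrC ler_pM2l// lerDl.
Qed.

End Half.

(** Two functionals that satisfy the Cauchy-Riemann equations weakly are given by
    smooth functions that satisfy them. Each is a limit of integrations against
    functions, which is what permits interchanging it with an integral in
    [P_moll]. The second function is obtained from the first construction with
    the pair (Q, - P). *)
Theorem weyl c r (u v : nat -> R * R -> R) (P Q : (R * R -> R) -> R) :
  0 < r -> (forall k, Cc (u k)) -> (forall k, Cc (v k)) ->
  bdfun c r P -> bdfun c r Q ->
  (forall e : R, 0 < e -> exists k, forall f (M : R),
    tst c r f -> (forall z, `|f z| <= M) ->
    `|I2 (fun z => u k z * f z) - P f| <= e * M) ->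
  (forall e : R, 0 < e -> exists k, forall f (M : R),
    tst c r f -> (forall z, `|f z| <= M) ->
    `|I2 (fun z => v k z * f z) - Q f| <= e * M) ->
  (forall f, tst c r f -> P ('D_(1, 0) f) = Q ('D_(0, 1) f)) ->
  (forall f, tst c r f -> Q ('D_(1, 0) f) = - P ('D_(0, 1) f)) ->
  exists U V,
  [/\ rsmooth_on (ball c (r / 2)) U /\ rsmooth_on (ball c (r / 2)) V,
      (forall z, ball c (r / 2) z ->
         'D_(1, 0) U z = 'D_(0, 1) V z /\ 'D_(1, 0) V z = - 'D_(0, 1) U z),
      (forall f, tst c (r / 2) f -> P f = I2 (fun z => U z * f z)) &
      (forall f, tst c (r / 2) f -> Q f = I2 (fun z => V z * f z))].
Proof.
move=> r0 Cu Cv bP bQ aP aQ CR1 CR2.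
have bNP : bdfun c r (fun f => - P f).
  split; first by move=> a f g Tf Tg; rewrite (bd_lin bP)//; ring.
  have [C C0 HC] := bd_bound bP; exists C => // f M Tf HM.
  by rewrite normrN; exact: HC.
exists (weyl_rep r P), (weyl_rep r Q); split.
- by split; exact: weyl_rep_smooth.
- move=> z hz; rewrite !(weyl_rep_D r0 bP)// !(weyl_rep_D r0 bQ)//.
  have T : tst c r (fun y => rho (r / 4) (y - z)).
    have Tr : tst 0 (r / 2) (rho (r / 4)) by apply: rho_tst; lra.
    move: hz; rewrite -ball_normE /= distrC => hz.
    apply: tst_shift Tr _; lra.
  split; congr (- _); first by congr (_ * _); exact: CR1 _ T.
  by rewrite -mulrN; congr (_ * _); exact: CR2 _ T.
- by move=> f Tf; exact: (weyl_repP r0 Cu bP aP CR1 CR2).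
- move=> f Tf; apply: (weyl_repP (Q := fun f => - P f) r0 Cv bQ aQ _ _ Tf) => g Tg.
    exact: CR2 Tg.
  congr (- _); exact: CR1 Tg.
Qed.

End WeylLemma.

(** * Smooth complex-valued functions *)

Local Open Scope complex_scope.

Section ComplexSmooth.
Variable R : realType.
Notation C := R[i].
Notation Re := (@complex.Re R).
Notation Im := (@complex.Im R).
Implicit Types (f g : R * R -> C) (U V : set (R * R)) (v z : R * R) (x y : C).

Lemma ReD x y : Re (x + y) = Re x + Re y. Proof. by case: x y => [a b] [c d]. Qed.
Lemma ImD x y : Im (x + y) = Im x + Im y. Proof. by case: x y => [a b] [c d]. Qed.
Lemma ReN x : Re (- x) = - Re x. Proof. by case: x. Qed.
Lemma ImN x : Im (- x) = - Im x. Proof. by case: x. Qed.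
Lemma ReM x y : Re (x * y) = Re x * Re y - Im x * Im y.
Proof. by case: x y => [a b] [c d]. Qed.
Lemma ImM x y : Im (x * y) = Re x * Im y + Im x * Re y.
Proof. by case: x y => [a b] [c d]. Qed.
Lemma ReJ x : Re (conjc x) = Re x. Proof. by case: x. Qed.
Lemma ImJ x : Im (conjc x) = - Im x. Proof. by case: x. Qed.
Lemma ReR (a : R) : Re a%:C = a. Proof. by []. Qed.
Lemma ImR (a : R) : Im a%:C = 0. Proof. by []. Qed.
Lemma Re0 : Re 0 = 0. Proof. by []. Qed.
Lemma Rei : Re 'i = 0. Proof. by []. Qed.
Lemma Imi : Im 'i = 1. Proof. by []. Qed.
Lemma ReV x : Re x^-1 = Re x / (Re x ^+ 2 + Im x ^+ 2).
Proof. by case: x. Qed.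
Lemma ImV x : Im x^-1 = - (Im x / (Re x ^+ 2 + Im x ^+ 2)).
Proof. by case: x. Qed.
Lemma complex_eq x y : Re x = Re y -> Im x = Im y -> x = y.
Proof. by case: x y => [a b] [c d] /= -> ->. Qed.
Lemma half_real : (2^-1 : C) = (2^-1 : R)%:C.
Proof.
apply: (mulfI (x := 2)); first by rewrite pnatr_eq0.
rewrite divff ?pnatr_eq0// mulr_natl mulr2n.
by apply: complex_eq; rewrite ?ReD ?ImD /= ?addr0//; field.
Qed.

Lemma cs_ext U f g : open U -> (forall z, U z -> f z = g z) ->
  csmooth_on U f -> csmooth_on U g.
Proof.
move=> oU fg [H1 H2]; split; [apply: rs_ext H1|apply: rs_ext H2] => // z Uz;
by rewrite fg.
Qed.

Lemma cs_sub U V f : V `<=` U -> csmooth_on U f -> csmooth_on V f.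
Proof. by move=> VU [H1 H2]; split; exact: rs_sub VU _. Qed.

Lemma cs_cst U x : csmooth_on U (fun=> x).
Proof. by split; exact: rs_cst. Qed.

Lemma cs_add U f g : open U -> csmooth_on U f -> csmooth_on U g ->
  csmooth_on U (fun z => f z + g z).
Proof.
move=> oU [f1 f2] [g1 g2]; split.
  by apply: rs_ext (rs_add oU f1 g1) => // z _; rewrite ReD.
by apply: rs_ext (rs_add oU f2 g2) => // z _; rewrite ImD.
Qed.

Lemma cs_mul U f g : open U -> csmooth_on U f -> csmooth_on U g ->
  csmooth_on U (fun z => f z * g z).
Proof.
move=> oU [f1 f2] [g1 g2]; split.
  apply: rs_ext (rs_subr oU (rs_mul oU f1 g1) (rs_mul oU f2 g2)) => // z _.
  by rewrite ReM.
apply: rs_ext (rs_add oU (rs_mul oU f1 g2) (rs_mul oU f2 g1)) => // z _.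
by rewrite ImM.
Qed.

Lemma cs_real U (f : R * R -> R) : rsmooth_on U f ->
  csmooth_on U (fun z => (f z)%:C).
Proof. by move=> Sf; split; [|exact: rs_cst]. Qed.

Lemma cs_conj U f : open U -> csmooth_on U f -> csmooth_on U (fun z => conjc (f z)).
Proof.
move=> oU [f1 f2]; split; first by apply: rs_ext f1 => // z _; rewrite ReJ.
by apply: rs_ext (rs_opp oU f2) => // z _; rewrite ImJ.
Qed.

Lemma cs_inv U f : open U -> (forall z, U z -> f z != 0) ->
  csmooth_on U f -> csmooth_on U (fun z => (f z)^-1).
Proof.
move=> oU f0 [f1 f2].
have n0 z : U z -> Re (f z) * Re (f z) + Im (f z) * Im (f z) != 0.
  move=> /f0; apply: contraNneq => /eqP.
  rewrite -!expr2 paddr_eq0 ?sqr_ge0// !sqrf_eq0 => /andP[/eqP a /eqP b].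
  by apply/eqP; apply: complex_eq.
have SI := rs_inv oU n0 (rs_add oU (rs_mul oU f1 f1) (rs_mul oU f2 f2)).
split; first by apply: rs_ext (rs_mul oU f1 SI) => // z _; rewrite ReV !expr2.
apply: rs_ext (rs_opp oU (rs_mul oU f2 SI)) => // z _.
by rewrite ImV !expr2.
Qed.

Lemma cs_sum U (I : Type) (r : seq I) (P : pred I) (F : I -> R * R -> C) :
  open U -> (forall i, P i -> csmooth_on U (F i)) ->
  csmooth_on U (fun z => \sum_(i <- r | P i) F i z).
Proof.
move=> oU H; elim: r => [|i r IH].
  by apply: cs_ext (cs_cst U 0) => // z _; rewrite big_nil.
have [Pi|nPi] := boolP (P i).
  by apply: cs_ext (cs_add oU (H i Pi) IH) => // z _; rewrite big_cons Pi.
by apply: cs_ext IH => // z _; rewrite big_cons (negbTE nPi).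
Qed.

Lemma cs_prod U (I : Type) (r : seq I) (P : pred I) (F : I -> R * R -> C) :
  open U -> (forall i, P i -> csmooth_on U (F i)) ->
  csmooth_on U (fun z => \prod_(i <- r | P i) F i z).
Proof.
move=> oU H; elim: r => [|i r IH].
  by apply: cs_ext (cs_cst U 1) => // z _; rewrite big_nil.
have [Pi|nPi] := boolP (P i).
  by apply: cs_ext (cs_mul oU (H i Pi) IH) => // z _; rewrite big_cons Pi.
by apply: cs_ext IH => // z _; rewrite big_cons (negbTE nPi).
Qed.

Lemma cs_det U m (A : R * R -> 'M[C]_m) : open U ->
  (forall i j, csmooth_on U (fun z => A z i j)) ->
  csmooth_on U (fun z => \det (A z)).
Proof.
move=> oU H; apply: cs_sum => // s _; apply: cs_mul => //; first exact: cs_cst.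
by apply: cs_prod => // i _; exact: H.
Qed.

Lemma cs_adj U m (A : R * R -> 'M[C]_m) i j : open U ->
  (forall i j, csmooth_on U (fun z => A z i j)) ->
  csmooth_on U (fun z => (\adj (A z)) i j).
Proof.
move=> oU H.
apply: (@cs_ext _ (fun z => (-1) ^+ (j + i) * \det (row' j (col' i (A z))))) => //.
  by move=> z _; rewrite mxE.
apply: cs_mul => //; first exact: cs_cst.
apply: cs_det => // k l.
by apply: cs_ext (H (lift j k) (lift i l)) => // z _; rewrite !mxE.
Qed.

Lemma cs_local U f :
  (forall z, U z -> exists V, [/\ open V, V z & csmooth_on V f]) ->
  csmooth_on U f.
Proof.
move=> H; split; apply: rs_local => z /H[V [oV Vz [H1 H2]]]; by exists V.
Qed.

Definition zc z : C := z.1 +i* z.2.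

Lemma cs_zc U : csmooth_on U zc.
Proof. by split; [exact: rs_fst|exact: rs_snd]. Qed.

Definition cdiff f z := differentiable (fun w => Re (f w)) z /\
  differentiable (fun w => Im (f w)) z.

Lemma cs_cdiff U f z : csmooth_on U f -> U z -> cdiff f z.
Proof. by move=> [H1 H2] Uz; split; [exact: rs_diff H1 Uz|exact: rs_diff H2 Uz]. Qed.

Lemma cderive_cst v x z : cderive v (fun=> x) z = 0.
Proof. by rewrite /cderive !D_cst. Qed.

Lemma cderive_real v (f : R * R -> R) z :
  cderive v (fun w => (f w)%:C) z = ('D_v f z)%:C.
Proof. by rewrite /cderive D_cst. Qed.

Lemma cderive_ext v U f g z : open U -> (forall z, U z -> f z = g z) -> U z ->
  cdiff f z -> cderive v g z = cderive v f z.
Proof.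
move=> oU fg Uz [d1 d2]; rewrite /cderive.
have [_ ->] := diff_ext oU (fun w Uw => congr1 Re (fg w Uw)) Uz d1.
by have [_ ->] := diff_ext oU (fun w Uw => congr1 Im (fg w Uw)) Uz d2.
Qed.

Lemma cderive_zc v z : cderive v zc z = zc v.
Proof. by rewrite /cderive /zc /=; congr (_ +i* _); [exact: D_fst|exact: D_snd]. Qed.

Lemma cderive_conj v f z : cdiff f z ->
  cderive v (fun w => conjc (f w)) z = conjc (cderive v f z).
Proof.
move=> [d1 d2]; rewrite /cderive /=; congr (_ +i* _).
  by congr ('D_v _ z); apply/funext => w; rewrite ReJ.
by rewrite -D_opp//; congr ('D_v _ z); apply/funext => w; rewrite ImJ.
Qed.

End ComplexSmooth.

(** * Sections, metric and connection *)

Section Bundle.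
Variables (R : realType) (n : nat) (E : hermitian_holomorphic_bundle R n).
Notation C := R[i].
Notation Re := (@complex.Re R).
Notation Im := (@complex.Im R).
Notation sec := (section E).
Notation sm s := (smooth_section (complex_coeffs R) (s : sec)).
Notation h := (metric E).
Implicit Types (s t g : sec) (z v : R * R) (U V : set (R * R)).

Lemma trivD i z (a b : E z) : dom E i z ->
  triv E i z (a + b) = triv E i z a + triv E i z b.
Proof.
by move=> /triv_linear H; have := H 1 a b; rewrite !scale1r.
Qed.

Lemma triv0 i z : dom E i z -> triv E i z 0 = 0.
Proof.
move=> di; have := trivD 0 0 di; rewrite addr0 => /eqP.
by rewrite -subr_eq0 opprD addNKr oppr_eq0 => /eqP.
Qed.

Lemma trivZ i z (k : C) (a : E z) : dom E i z ->
  triv E i z (k *: a) = k *: triv E i z a.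
Proof.
by move=> di; have := triv_linear di k a 0; rewrite !addr0 triv0// addr0.
Qed.

Lemma triv_inj i z (a b : E z) : dom E i z -> triv E i z a = triv E i z b -> a = b.
Proof. by move=> di ab; rewrite -(trivK di a) ab trivK. Qed.

Lemma triv_sum i z m (F : 'I_m -> E z) : dom E i z ->
  triv E i z (\sum_j F j) = \sum_j triv E i z (F j).
Proof.
move=> di; elim/big_ind2 : _ => //; first exact: triv0.
by move=> x1 x2 y1 y2 <- <-; rewrite trivD.
Qed.

Definition sec_on U s := forall (i : chart E) (k : 'I_n),
  csmooth_on (dom E i `&` U) (fun z => triv E i z (s z) k ord0).

Lemma sec_onT s : sec_on setT s <-> sm s.
Proof. by split=> H i k; have := H i k; rewrite setIT. Qed.

Lemma sec_on_sub U V s : V `<=` U -> sec_on U s -> sec_on V s.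
Proof.
by move=> VU H i k; apply: cs_sub (H i k) => z [di /VU].
Qed.

Lemma sm_sec_on U s : sm s -> sec_on U s.
Proof. by move=> /sec_onT; apply: sec_on_sub. Qed.

Lemma sec_on_local U s :
  (forall z, U z -> exists V t, [/\ open V, V z, sec_on V t &
     forall y, V y -> t y = s y]) -> sec_on U s.
Proof.
move=> H i k; apply: cs_local => z [di Uz].
have [V [t [oV Vz Ht ts]]] := H z Uz.
have oW : open (dom E i `&` V) by apply: openI => //; exact: dom_open.
exists (dom E i `&` V); split=> //.
by apply: cs_ext (Ht i k) => // y [dy Vy]; rewrite ts.
Qed.

Lemma sec_on_add U s t : open U -> sec_on U s -> sec_on U t ->
  sec_on U (fun z => s z + t z).
Proof.
move=> oU Hs Ht i k.
have oW : open (dom E i `&` U) by apply: openI => //; exact: dom_open.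
apply: cs_ext (cs_add oW (Hs i k) (Ht i k)) => // z [di _].
by rewrite trivD// mxE.
Qed.

Lemma sec_on_scale U (f : R * R -> C) s : open U -> csmooth_on U f ->
  sec_on U s -> sec_on U (fun z => f z *: s z).
Proof.
move=> oU Hf Hs i k.
have oW : open (dom E i `&` U) by apply: openI => //; exact: dom_open.
have Hf' : csmooth_on (dom E i `&` U) f by apply: cs_sub Hf => z [].
apply: cs_ext (cs_mul oW Hf' (Hs i k)) => // z [di _].
by rewrite trivZ// mxE.
Qed.

Lemma sec_on0 U : sec_on U (fun=> 0).
Proof.
move=> i k; have oD : open (dom E i) by exact: dom_open.
apply: (@cs_sub _ (dom E i)); first by move=> z [].
by apply: cs_ext (cs_cst _ 0) => // z di; rewrite triv0// mxE.
Qed.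

Lemma sec_on_sum U m (F : 'I_m -> sec) : open U -> (forall j, sec_on U (F j)) ->
  sec_on U (fun z => \sum_j F j z).
Proof.
move=> oU HF; rewrite -[index_enum _]/(index_enum 'I_m).
elim: (index_enum _) => [|j r IH].
  apply: sec_on_local => z Uz; exists U, (fun=> 0); split=> //; first exact: sec_on0.
  by move=> y _; rewrite big_nil.
apply: sec_on_local => z Uz; exists U, (fun z => F j z + \sum_(j <- r) F j z); split=> //.
  exact: sec_on_add.
by move=> y _; rewrite big_cons.
Qed.

Lemma sm_add s t : sm s -> sm t -> sm (fun z => s z + t z).
Proof. by move=> /sec_onT Hs /sec_onT Ht; apply/sec_onT; exact: sec_on_add openT Hs Ht. Qed.

Lemma sm_scale (f : R * R -> C) s : csmooth_on setT f -> sm s ->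
  sm (fun z => f z *: s z).
Proof. by move=> Hf /sec_onT Hs; apply/sec_onT; exact: sec_on_scale openT Hf Hs. Qed.

Lemma sm_scalec (k : C) s : sm s -> sm (fun z => k *: s z).
Proof. by apply: sm_scale; exact: cs_cst. Qed.

Lemma sm0 : sm (fun=> 0).
Proof. by apply/sec_onT; exact: sec_on0. Qed.

(** A section that is smooth only over a ball may be multiplied by a cutoff and
    extended by zero. *)
Lemma sm_cut c r (f : R * R -> C) s : sec_on (ball c r) s ->
  csmooth_on setT f -> (exists2 r', r' < r & forall z, r' <= `|z - c| -> f z = 0) ->
  sm (fun z => f z *: s z).
Proof.
move=> Hs Hf [r' r'r H]; apply/sec_onT.
pose U : set (R * R) := [set z | r' < `|z - c|].
have oU : open U.
  rewrite openE => y Uy; rewrite /interior /U.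
  have cn : {for y, continuous (fun z => `|z - c|)}.
    by apply: cvg_norm; apply: cvgB; [exact: cvg_id|exact: cvg_cst].
  by have := cvgr_gt _ cn; apply.
apply: sec_on_local => z _; case: (ltP r' `|z - c|) => hz.
  exists U, (fun=> 0); split=> //; first exact: sec_on0.
  by move=> y Uy; rewrite H ?scale0r// ltW.
exists (ball c r), (fun z => f z *: s z); split=> //; first exact: ball_open.
  by rewrite -ball_normE /= distrC; exact: le_lt_trans r'r.
apply: sec_on_scale => //; first exact: ball_open.
by apply: cs_sub Hf.
Qed.

Lemma h_linear z (a : C) (x y w : E z) : h z (a *: x + y) w = a * h z x w + h z y w.
Proof. exact: (metric_linear (metricP E)). Qed.

Lemma h_sym z (x y : E z) : h z y x = conjc (h z x y).
Proof. exact: (Defs.metric_sym (metricP E)). Qed.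

Lemma hDl z (x y w : E z) : h z (x + y) w = h z x w + h z y w.
Proof. by have := h_linear 1 x y w; rewrite scale1r mul1r. Qed.

Lemma h0l z (w : E z) : h z 0 w = 0.
Proof.
have := hDl 0 0 w; rewrite addr0 => /eqP.
by rewrite -subr_eq0 opprD addNKr oppr_eq0 => /eqP.
Qed.

Lemma hZl z (a : C) (x w : E z) : h z (a *: x) w = a * h z x w.
Proof. by have := h_linear a x 0 w; rewrite addr0 h0l addr0. Qed.

Lemma hDr z (x y w : E z) : h z w (x + y) = h z w x + h z w y.
Proof. by rewrite h_sym hDl rmorphD /= -!h_sym. Qed.

Lemma h0r z (w : E z) : h z w 0 = 0.
Proof. by rewrite h_sym h0l rmorph0. Qed.

Lemma hZr z (a : C) (x w : E z) : h z w (a *: x) = conjc a * h z w x.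
Proof. by rewrite h_sym hZl rmorphM /= -h_sym. Qed.

Lemma hNl z (x w : E z) : h z (- x) w = - h z x w.
Proof. by rewrite -scaleN1r hZl mulN1r. Qed.

Lemma hNr z (x w : E z) : h z w (- x) = - h z w x.
Proof. by rewrite h_sym hNl rmorphN /= -h_sym. Qed.

Lemma h_sumr z m (F : 'I_m -> E z) w : h z w (\sum_j F j) = \sum_j h z w (F j).
Proof.
elim/big_ind2 : _ => //; first exact: h0r.
by move=> x1 x2 y1 y2 <- <-; rewrite hDr.
Qed.

Lemma h_suml z m (F : 'I_m -> E z) w : h z (\sum_j F j) w = \sum_j h z (F j) w.
Proof.
elim/big_ind2 : _ => //; first exact: h0l.
by move=> x1 x2 y1 y2 <- <-; rewrite hDl.
Qed.

(** Real linear functionals of a section are paired through the real part of the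
    metric, which is a real inner product on each fibre. *)
Definition rh z (x y : E z) : R := Re (h z x y).

Lemma rhC z (x y : E z) : rh x y = rh y x.
Proof. by rewrite /rh h_sym ReJ. Qed.

Lemma rhDl z (x y w : E z) : rh (x + y) w = rh x w + rh y w.
Proof. by rewrite /rh hDl ReD. Qed.

Lemma rhDr z (x y w : E z) : rh w (x + y) = rh w x + rh w y.
Proof. by rewrite /rh hDr ReD. Qed.

Lemma rhZl z (a : R) (x w : E z) : rh (a%:C *: x) w = a * rh x w.
Proof. by rewrite /rh hZl ReM /= mul0r subr0. Qed.

Lemma rhZr z (a : R) (x w : E z) : rh w (a%:C *: x) = a * rh w x.
Proof. by rewrite rhC rhZl rhC. Qed.

Lemma rhNr z (x w : E z) : rh w (- x) = - rh w x.
Proof. by rewrite /rh hNr ReN. Qed.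

Lemma rhNl z (x w : E z) : rh (- x) w = - rh x w.
Proof. by rewrite /rh hNl ReN. Qed.

Lemma rh_gt0 z (x : E z) : x != 0 -> 0 < rh x x.
Proof. by move=> /(metric_pos (metricP E)); rewrite ltcE => /andP[]. Qed.

Lemma rh_ge0 z (x : E z) : 0 <= rh x x.
Proof.
have [->|/rh_gt0/ltW//] := eqVneq x 0; by rewrite /rh h0l.
Qed.

Lemma rh_eq0 z (x : E z) : rh x x = 0 -> x = 0.
Proof. by move=> H; apply/eqP; apply: contraPT H => /rh_gt0; lra. Qed.

Lemma rh_abs z (a : C) (x : E z) :
  rh (a *: x) (a *: x) = (Re a ^+ 2 + Im a ^+ 2) * rh x x.
Proof.
rewrite /rh hZl hZr !ReM !ImM ReJ ImJ.
have : Im (h z x x) = 0 by have := congr1 Im (h_sym x x); rewrite ImJ => E0; lra.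
move=> ->; ring.
Qed.

Lemma h_smooth s t : sm s -> sm t -> csmooth_on setT (fun z => h z (s z) (t z)).
Proof. exact: (metric_smooth (metricP E)). Qed.

Lemma rh_smooth s t : sm s -> sm t -> rsmooth_on setT (fun z => rh (s z) (t z)).
Proof. by move=> Hs Ht; have [] := h_smooth Hs Ht. Qed.

Lemma nabla_smooth v s : sm s -> sm (nabla E v s).
Proof. exact: (conn_smooth (nablaP E)). Qed.

Lemma nablaD v s t z : sm s -> sm t ->
  nabla E v (fun y => s y + t y) z = nabla E v s z + nabla E v t z.
Proof. exact: (conn_add (nablaP E)). Qed.

Lemma nablaM v (f : R * R -> C) s z : csmooth_on setT f -> sm s ->
  nabla E v (fun y => f y *: s y) z = cderive v f z *: s z + f z *: nabla E v s z.
Proof. exact: (conn_leibniz (nablaP E)). Qed.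

Lemma nablaZ v (k : C) s z : sm s ->
  nabla E v (fun y => k *: s y) z = k *: nabla E v s z.
Proof.
by move=> Hs; rewrite nablaM// ?cderive_cst ?scale0r ?add0r//; exact: cs_cst.
Qed.

Lemma nabla_h v s t z : sm s -> sm t ->
  cderive v (fun y => h y (s y) (t y)) z =
  h z (nabla E v s z) (t z) + h z (s z) (nabla E v t z).
Proof. by move=> Hs Ht; exact: (nabla_metric v z Hs Ht). Qed.

(** Locality from the Leibniz rule: s = f s for a function f that vanishes at [z]
    and equals 1 outside the ball, and s(z) = 0, so both terms vanish. *)
Lemma nabla_local0 v s z c r : sm s -> (forall y, `|y - c| < r -> s y = 0) ->
  `|z - c| < r -> nabla E v s z = 0.
Proof.
move=> Hs H0 hz; pose d := r - `|z - c|.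
have d0 : 0 < d by rewrite subr_gt0.
pose f y : C := (1 - chi d (y - z))%:C.
have Sc : rsmooth_on setT (fun y => chi d (y - z)).
  have := rs_affine 1 (- z) (rs_chi d).
  by apply: rs_ext; [exact: openT|move=> y _; rewrite scale1r].
have Sf : csmooth_on setT f.
  by apply: cs_real; apply: rs_subr => //; [exact: openT|exact: rs_cst].
have fz : f z = 0.
  by rewrite /f subrr chi_norm1// ?subrr// normr0 divr_ge0// ltW.
have E0 : s = (fun y => f y *: s y).
  apply: functional_extensionality_dep => y.
  have [yd|yd] := ltP `|y - z| d.
    rewrite [s y]H0 ?scaler0//.
    have := ler_distD z y c; rewrite /d in yd; lra.
  by rewrite /f chi_norm0// subr0 scale1r.
rewrite E0 nablaM// H0// fz scaler0 scale0r addr0//.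
Qed.

End Bundle.

(** * The operators dbar and nabla_z, and dual frames *)

Section Frames.
Variables (R : realType) (n : nat) (E : hermitian_holomorphic_bundle R n).
Notation C := R[i].
Notation Re := (@complex.Re R).
Notation Im := (@complex.Im R).
Notation sec := (section E).
Notation sm s := (smooth_section (complex_coeffs R) (s : sec)).
Notation h := (metric E).
Implicit Types (s t g : sec) (z v : R * R) (U V : set (R * R)).

Definition testsec s := sm s /\ exists N : R, forall z, N <= `|z| -> s z = 0.

Lemma testsec_compact s : testsec s -> compactly_supported s.
Proof.
move=> [_ [N H]]; exists (sq N); split; first exact: sq_compact.
by move=> z /= /negP; rewrite -ltNge => /ltW; exact: H.
Qed.

Lemma testsec_add s t : testsec s -> testsec t -> testsec (fun z => s z + t z).
Proof.
move=> [Ss [N HN]] [St [M HM]]; split; first exact: sm_add.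
exists (Num.max N M) => z; rewrite ge_max => /andP[/HN -> /HM ->].
by rewrite addr0.
Qed.

Lemma testsec_scale (f : R * R -> C) s : csmooth_on setT f -> testsec s ->
  testsec (fun z => f z *: s z).
Proof.
move=> Sf [Ss [N HN]]; split; first exact: sm_scale.
by exists N => z /HN ->; rewrite scaler0.
Qed.

Lemma testsec_scaler (f : R * R -> R) s : rsmooth_on setT f -> testsec s ->
  testsec (fun z => (f z)%:C *: s z).
Proof. by move=> Sf; apply: testsec_scale; exact: cs_real. Qed.

Lemma testsec_scalec (k : C) s : testsec s -> testsec (fun z => k *: s z).
Proof. by apply: testsec_scale; exact: cs_cst. Qed.

Lemma testsec0 : testsec (fun=> 0).
Proof. by split; [exact: sm0|exists 0]. Qed.

Lemma testsec_nabla v s : testsec s -> testsec (nabla E v s).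
Proof.
move=> [Ss [N HN]]; split; first exact: nabla_smooth.
exists (N + 1) => z hz; apply: (@nabla_local0 _ _ E v s z z 1 Ss).
  move=> y yz; apply: HN; have := lerB_dist z (z - y).
  rewrite opprB addrCA subrr addr0 distrC; lra.
by rewrite subrr normr0.
Qed.

(** The coefficient of the (1,0) part of the connection. *)
Definition dz s : sec := fun z =>
  (2^-1 : C) *: (nabla E (1, 0) s z - ('i%C : C) *: nabla E (0, 1) s z).

Lemma dbar_smooth s : sm s -> sm (dbar s).
Proof.
move=> Ss; apply: sm_scalec; apply: sm_add; first exact: nabla_smooth.
by apply: sm_scalec; exact: nabla_smooth.
Qed.

Lemma testsec_dbar s : testsec s -> testsec (dbar s).
Proof.
move=> Ts; apply: testsec_scalec; apply: testsec_add; first exact: testsec_nabla.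
by apply: testsec_scalec; exact: testsec_nabla.
Qed.

Lemma dzE s : dz s = fun z =>
  (2^-1 : C) *: (nabla E (1, 0) s z + (- 'i%C : C) *: nabla E (0, 1) s z).
Proof. by apply: functional_extensionality_dep => z; rewrite /dz scaleNr. Qed.

Lemma testsec_dz s : testsec s -> testsec (dz s).
Proof.
move=> Ts; rewrite dzE; apply: testsec_scalec; apply: testsec_add; first exact: testsec_nabla.
by apply: testsec_scalec; exact: testsec_nabla.
Qed.

Lemma dz_smooth s : sm s -> sm (dz s).
Proof.
move=> Ss; rewrite dzE; apply: sm_scalec; apply: sm_add; first exact: nabla_smooth.
by apply: sm_scalec; exact: nabla_smooth.
Qed.

Lemma dz_add s t z : sm s -> sm t -> dz (fun z => s z + t z) z = dz s z + dz t z.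
Proof.
move=> Ss St; rewrite /dz !nablaD// -scalerDr; congr (_ *: _).
by rewrite scalerDr opprD addrACA.
Qed.

Lemma dbar_add s t z : sm s -> sm t ->
  dbar (fun z => s z + t z) z = dbar s z + dbar t z.
Proof.
move=> Ss St; rewrite /dbar !nablaD// -scalerDr; congr (_ *: _).
by rewrite scalerDr addrACA.
Qed.

Definition cderive_z (f : R * R -> C) z : C :=
  2^-1 * (cderive (1, 0) f z - 'i%C * cderive (0, 1) f z).

Lemma dz_mul (f : R * R -> C) s z : csmooth_on setT f -> sm s ->
  dz (fun y => f y *: s y) z = cderive_z f z *: s z + f z *: dz s z.
Proof.
move=> Sf Ss; rewrite /dz !nablaM// /cderive_z.
set a := cderive _ f z; set b := cderive _ f z.
set X := nabla _ _ _ _; set Y := nabla _ _ _ _.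
have -> : a *: s z + f z *: X - ('i%C : C) *: (b *: s z + f z *: Y) =
    (a - 'i%C * b) *: s z + f z *: (X - ('i%C : C) *: Y).
  by rewrite scalerBl scalerBr scalerDr opprD addrACA !scalerA ['i%C * f z]mulrC.
by rewrite scalerDr !scalerA [f z * _]mulrC.
Qed.

Lemma dbar_mul (f : R * R -> C) s z : csmooth_on setT f -> sm s ->
  dbar (fun y => f y *: s y) z = cderive_zbar f z *: s z + f z *: dbar s z.
Proof.
move=> Sf Ss; rewrite /dbar !nablaM// /cderive_zbar.
set a := cderive _ f z; set b := cderive _ f z.
set X := nabla _ _ _ _; set Y := nabla _ _ _ _.
have -> : a *: s z + f z *: X + ('i%C : C) *: (b *: s z + f z *: Y) =
    (a + 'i%C * b) *: s z + f z *: (X + ('i%C : C) *: Y).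
  by rewrite scalerDl !scalerDr addrACA !scalerA ['i%C * f z]mulrC.
by rewrite scalerDr !scalerA [f z * _]mulrC.
Qed.

Lemma dz_scalec (k : C) s z : sm s -> dz (fun y => k *: s y) z = k *: dz s z.
Proof.
move=> Ss; rewrite dz_mul//; last exact: cs_cst.
by rewrite /cderive_z !cderive_cst mulr0 subrr mulr0 scale0r add0r.
Qed.

Lemma half_conj : conjc (2^-1 : C) = 2^-1.
Proof. by rewrite half_real; apply: complex_eq => //=; rewrite oppr0. Qed.

(** Conjugate linearity of the metric in its second argument exchanges
    nabla_zbar and nabla_z. *)
Lemma cderive_zbar_h s t z : sm s -> sm t ->
  cderive_zbar (fun y => h y (s y) (t y)) z = h z (dbar s z) (t z) + h z (s z) (dz t z).
Proof.
move=> Ss St; rewrite /cderive_zbar !nabla_h//.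
rewrite /dbar /dz hZl hZr.  rewrite half_conj -mulrDr; congr (_ * _).
rewrite hDl hDr hZl hNr hZr.
have -> : conjc ('i%C : C) = - 'i%C by apply: complex_eq => //=; rewrite oppr0.
by rewrite mulrDr mulNr opprK addrACA.
Qed.

Lemma rh_Cc s t : sm s -> testsec t -> Cc (fun z => rh (s z) (t z)).
Proof.
move=> Ss [St [N HN]]; split; first by apply: rs_continuous; exact: rh_smooth.
by exists N => z /HN ->; rewrite /rh h0r.
Qed.

(** The metric is parallel, so the sum of the two integrands is the real part of
    d/dzbar of the function h(s, t), whose integral vanishes. *)
Lemma dbar_dz_adjoint s t : sm s -> testsec t ->
  I2 (fun z => rh (dbar s z) (t z)) = - I2 (fun z => rh (s z) (dz t z)).
Proof.
move=> Ss Tt; have [St [N HN]] := Tt.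
have C1 := rh_Cc (dbar_smooth Ss) Tt.
have C2 := rh_Cc Ss (testsec_dz Tt).
have [SR SI] := h_smooth Ss St.
set HR := (fun z => Re _) in SR; set HI := (fun z => Im _) in SI.
have CR : Cc HR by exact: rh_Cc.
have CI : Cc HI.
  split; first exact: rs_continuous.
  by exists N => z /HN; rewrite /HI => ->; rewrite h0r.
apply/eqP; rewrite -addr_eq0 -I2_add//; apply/eqP.
have DR := Cc_D (1, 0) SR CR; have DI := Cc_D (0, 1) SI CI.
transitivity (I2 (fun z => 2^-1 * 'D_(1, 0) HR z - 2^-1 * 'D_(0, 1) HI z)).
  congr I2; apply/funext => z; rewrite /rh -ReD -cderive_zbar_h// /cderive_zbar half_real.
  rewrite ReM ReR ImR mul0r subr0 -mulrBr; congr (_ * _).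
  by rewrite ReD ReM Rei Imi mul0r mul1r sub0r.
rewrite (I2_sub (Cc_scale _ DR) (Cc_scale _ DI)) (I2_scale _ DR) (I2_scale _ DI).
rewrite (I2_D1 CR (fun z => rs_diff SR (I : setT z)) DR).
by rewrite (I2_D2 CI (fun z => rs_diff SI (I : setT z)) DI) !mulr0 subrr.
Qed.

Lemma transition_csmooth i j (a : 'cV[C]_n) (k : 'I_n) :
  csmooth_on (dom E i `&` dom E j) (fun z => triv E i z (untriv E j z a) k ord0).
Proof. by have [] := transition_regular (v := E) i j a k. Qed.

Lemma sec_on_untriv i U (a : 'cV[C]_n) : U `<=` dom E i ->
  sec_on U ((fun z => untriv E i z a) : sec).
Proof.
move=> Ui j k; apply: cs_sub (transition_csmooth j i a k).
by move=> z [dj /Ui].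
Qed.

Lemma chi_shift_smooth d c : rsmooth_on setT (fun y : R * R => chi d (y - c)).
Proof.
have := rs_affine 1 (- c) (rs_chi d).
by apply: rs_ext; [exact: openT|move=> y _; rewrite scale1r].
Qed.

Lemma chi_shift_supp d r c : 0 < d -> d < r ->
  exists2 r', r' < r & forall z, r' <= `|z - c| -> (chi d (z - c))%:C = 0 :> C.
Proof. by move=> d0 dr; exists d => // z hz; rewrite chi_norm0. Qed.

Lemma testsec_cut c r (f : R * R -> C) s : sec_on (ball c r) s ->
  csmooth_on setT f -> (exists2 r', r' < r & forall z, r' <= `|z - c| -> f z = 0) ->
  testsec (fun z => f z *: s z).
Proof.
move=> Hs Sf Hf; split; first exact: (sm_cut Hs Sf Hf).
have [r' r'r H] := Hf; exists (r' + `|c|) => z hz; rewrite H ?scale0r//.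
by rewrite -(lerD2r `|c|); apply: le_trans hz _; rewrite -{1}(subrK c z) ler_normD.
Qed.

(** A holomorphic frame [e] near a point with its dual frame [eps] for the
    metric. The dual frame is killed by nabla_z, so a section is holomorphic in
    the weak sense exactly when its pairings with the [eps j] satisfy the
    Cauchy-Riemann equations. The cutoffs make all of them test sections. *)
Record local_frame (c : R * R) (r : R) (e eps : 'I_n -> sec) : Prop := {
  frame_r : 0 < r;
  frame_e : forall j, testsec (e j);
  frame_eps : forall j, testsec (eps j);
  frame_dual : forall z, ball c r z -> forall j k,
    h z (e j z) (eps k z) = (j == k)%:R;
  frame_dbar : forall z, ball c r z -> forall j, dbar (e j) z = 0;
  frame_dz : forall z, ball c r z -> forall j, dz (eps j) z = 0;
  frame_expand : forall z, ball c r z -> forall x : E z,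
    x = \sum_j h z x (e j z) *: eps j z }.

(** The frame comes from a chart and the dual frame from the inverse of its Gram
    matrix. As h(e_k, eps_j) is constant and dbar e_k = 0, differentiating gives
    h(e_k, nabla_z eps_j) = 0 for all k. *)
Lemma frame_exists c : exists r e eps, local_frame c r e eps.
Proof.
have [i di] : exists i, dom E i c by exact: dom_cover.
have oD : open (dom E i) by exact: dom_open.
have [r1 r10 Hr1] : exists2 r : R, 0 < r & ball c r `<=` dom E i.
  have /nbhs_ballP[r r0 Hr] : nbhs c (dom E i) by exact: open_nbhs_nbhs.
  by exists r.
pose e (j : 'I_n) : sec := fun z => (chi (r1 / 2) (z - c))%:C *: untriv E i z (delta_mx j ord0).
have r12 : 0 < r1 / 2 by rewrite divr_gt0.
have Te j : testsec (e j).
  apply: (@testsec_cut c r1); first exact: sec_on_untriv.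
    by apply: cs_real; exact: chi_shift_smooth.
  by apply: chi_shift_supp => //; lra.
(* The cutoff in [e] equals 1 on the ball of radius r2. *)
pose r2 := r1 / 8.
have r20 : 0 < r2 by rewrite divr_gt0.
have b21 : ball c r2 `<=` ball c r1.
  by apply: le_ball; rewrite /r2; lra.
have bn r z : ball c r z -> `|z - c| < r by rewrite -ball_normE /= distrC.
have tre z j : ball c r2 z -> triv E i z (e j z) = delta_mx j ord0.
  move=> hz; have dz1 := Hr1 _ (b21 _ hz); rewrite /e trivZ// untrivK//.
  rewrite chi_norm1 ?scale1r//; have := bn _ _ hz; rewrite /r2; lra.
pose H z : 'M[C]_n := \matrix_(k, l) h z (e k z) (e l z).
have SH k l : csmooth_on setT (fun z => H z k l).
  apply: (@cs_ext _ setT (fun z => h z (e k z) (e l z))) => //; first exact: openT.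
    by move=> z _; rewrite mxE.
  by apply: h_smooth; case: (Te k) => // ? _; case: (Te l).
have expand z (x : E z) : ball c r2 z -> x = \sum_j (triv E i z x) j ord0 *: e j z.
  move=> hz; have dz1 := Hr1 _ (b21 _ hz); apply: (triv_inj dz1).
  rewrite triv_sum//; apply/colP => k; rewrite summxE (bigD1 k)//= big1 => [|j jk].
    by rewrite trivZ// tre// !mxE !eqxx mulr1 addr0.
  by rewrite trivZ// tre// !mxE eq_sym (negbTE jk) mulr0.
have h0 z (x : E z) : ball c r2 z -> (forall l, h z x (e l z) = 0) -> x = 0.
  move=> hz Hx; apply: rh_eq0; rewrite /rh [X in h z x X](expand z x hz) h_sumr big1//.
  by move=> j _; rewrite hZr Hx mulr0.
have detH z : ball c r2 z -> \det (H z) != 0.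
  move=> hz; apply/negP => /det0P[a a0 aH].
  have dz1 := Hr1 _ (b21 _ hz).
  pose x : E z := \sum_j a ord0 j *: e j z.
  have x0 : x = 0.
    apply: h0 hz _ => l; rewrite /x h_suml.
    transitivity ((a *m H z) ord0 l); last by rewrite aH mxE.
    by rewrite mxE; apply: eq_bigr => j _; rewrite hZl mxE.
  have a00 : a = 0.
    apply/rowP => k; have := congr1 (fun y => triv E i z y k ord0) x0.
    rewrite triv0// triv_sum// summxE (bigD1 k)//= big1 => [|j jk].
      by rewrite trivZ// tre// !mxE !eqxx mulr1 addr0.
    by rewrite trivZ// tre// !mxE eq_sym (negbTE jk) mulr0.
  by rewrite a00 eqxx in a0.
pose d3 := r2 / 2.
have d30 : 0 < d3 by rewrite divr_gt0.
pose eps (j : 'I_n) : sec := fun z => (chi d3 (z - c))%:C *: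
  \sum_l conjc ((\adj (H z)) l j * (\det (H z))^-1) *: e l z.
have Teps j : testsec (eps j).
  apply: (@testsec_cut c r2 _ (fun z => \sum_l conjc ((\adj (H z)) l j * (\det (H z))^-1) *: e l z)).
  - apply: (@sec_on_sum _ _ E _ n (fun l z => conjc ((\adj (H z)) l j * (\det (H z))^-1) *: e l z)).
      exact: ball_open.
    move=> l; apply: sec_on_scale; [exact: ball_open| |apply: sm_sec_on; by case: (Te l)].
    have oB : open (ball c r2) by exact: ball_open.
    have SHb k m : csmooth_on (ball c r2) (fun z => H z k m) by apply: cs_sub (SH k m).
    apply: cs_conj => //; apply: cs_mul => //; first exact: cs_adj.
    by apply: cs_inv => //; exact: cs_det.
  - by apply: cs_real; exact: chi_shift_smooth.
  - by apply: chi_shift_supp => //; rewrite /d3; lra.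
pose r := d3 / 4.
have r0 : 0 < r by rewrite divr_gt0.
have br2 : ball c r `<=` ball c r2 by apply: le_ball; rewrite /r /d3; lra.
have dual z j k : ball c r z -> h z (e j z) (eps k z) = (j == k)%:R.
  move=> hz; have hz2 := br2 _ hz.
  rewrite /eps chi_norm1 ?scale1r; [|by []|by have := bn _ _ hz; rewrite /r; lra].
  rewrite h_sumr.
  transitivity ((H z *m \adj (H z)) j k * (\det (H z))^-1).
    rewrite mxE mulr_suml; apply: eq_bigr => l _.
    by rewrite hZr conjcK [H z j l]mxE mulrC mulrA.
  rewrite mul_mx_adj mxE -mulr_natr; case: (j == k) => /=.
    by rewrite mulr1 divff// detH.
  by rewrite mulr0 mul0r.
have de z j : ball c r z -> dbar (e j) z = 0.
  move=> hz; have hz2 := br2 _ hz; have dz1 := Hr1 _ (b21 _ hz2).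
  apply: (triv_inj dz1); rewrite triv0//; apply/colP => k.
  rewrite (nabla_holomorphic (h := E)) //; last by case: (Te j).
  have oB : open (ball c r2) by exact: ball_open.
  have cst_e y : ball c r2 y -> (delta_mx j ord0 : 'cV[C]_n) k ord0 = triv E i y (e j y) k ord0.
    by move=> hy; rewrite tre.
  have cd : cdiff (fun _ : R * R => (delta_mx j ord0 : 'cV[C]_n) k ord0) z.
    by split; exact: differentiable_cst.
  rewrite /cderive_zbar (cderive_ext (1, 0) oB cst_e hz2 cd).
  by rewrite (cderive_ext (0, 1) oB cst_e hz2 cd) !cderive_cst mulr0 addr0 mulr0 mxE.
exists r, e, eps; split=> //.
- move=> z hz j k; exact: dual.
- move=> z hz j; exact: de.
- move=> z hz j; apply: h0 (br2 _ hz) _ => k; rewrite h_sym.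
  have [Sk _] := Te k; have [Sj _] := Teps j.
  have := cderive_zbar_h z Sk Sj; rewrite de// h0l add0r => <-.
  have oB : open (ball c r) by exact: ball_open.
  have cst_h y : ball c r y -> (k == j)%:R = h y (e k y) (eps j y).
    by move=> hy; rewrite dual.
  have cd : cdiff (fun _ : R * R => (k == j)%:R : C) z.
    by split; exact: differentiable_cst.
  rewrite /cderive_zbar (cderive_ext (1, 0) oB cst_h hz cd).
  by rewrite (cderive_ext (0, 1) oB cst_h hz cd) !cderive_cst mulr0 addr0 mulr0 conjc0.
- move=> z hz x; apply/eqP; rewrite -subr_eq0; apply/eqP.
  apply: h0 (br2 _ hz) _ => l; rewrite hDl hNl h_suml (bigD1 l)//= big1 => [|k kl].
    by rewrite hZl [h z (eps l z) _]h_sym dual// eqxx conjc1 mulr1 addr0 subrr.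
  by rewrite hZl [h z (eps k z) _]h_sym dual// eq_sym (negbTE kl) conjc0 mulr0.
Qed.

End Frames.

(** * Regularity of weak limits *)

Section Regularity.
Variables (R : realType) (n : nat) (E : hermitian_holomorphic_bundle R n).
Notation C := R[i].
Notation Re := (@complex.Re R).
Notation Im := (@complex.Im R).
Notation sec := (section E).
Notation sm s := (smooth_section (complex_coeffs R) (s : sec)).
Notation h := (metric E).
Implicit Types (s t g : sec) (z v c : R * R) (U V : set (R * R)).

Definition nrm (W : R * R -> R) g : R := I2 (fun z => rh (g z) (g z) * W z).

Lemma nrm_Cc (W : R * R -> R) g : continuous W -> testsec g ->
  Cc (fun z => rh (g z) (g z) * W z).
Proof. by move=> cW Tg; apply: Cc_mulr => //; apply: rh_Cc => //; case: Tg. Qed.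

Lemma nrm_ge0 (W : R * R -> R) g : (forall z, 0 <= W z) -> 0 <= nrm W g.
Proof. by move=> W0; apply: I2_ge0 => z; rewrite mulr_ge0// rh_ge0. Qed.

(** A functional [L] on test sections that vanishes on the image of nabla_z, the
    formal adjoint of dbar up to sign: a weakly holomorphic section. It is a
    limit of integrations against test sections [s_ k], in the norm dual to that
    of the weight [W]. *)
Record weak_limit (W : R * R -> R) (s_ : nat -> sec) (L : sec -> R) : Prop := {
  wl_W : continuous W;
  wl_W0 : forall z, 0 < W z;
  wl_s : forall k, testsec (s_ k);
  wl_lin : forall (a : R) g1 g2, testsec g1 -> testsec g2 ->
    L (fun z => a%:C *: g1 z + g2 z) = a * L g1 + L g2;
  wl_bound : exists2 K : R, 0 <= K & forall g, testsec g -> L g ^+ 2 <= K * nrm W g;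
  wl_approx : forall e : R, 0 < e -> exists k, forall g, testsec g ->
    (I2 (fun z => rh (s_ k z) (g z)) - L g) ^+ 2 <= e * nrm W g;
  wl_dz : forall t, testsec t -> L (dz t) = 0 }.

Variables (W : R * R -> R) (s_ : nat -> sec) (L : sec -> R).
Hypothesis wl : weak_limit W s_ L.

Lemma L_ext g1 g2 : (forall z, g1 z = g2 z) -> L g1 = L g2.
Proof. by move=> H; congr L; apply: functional_extensionality_dep. Qed.

Lemma L0 : L (fun=> 0) = 0.
Proof.
have := wl_lin wl 1 (testsec0 E) (testsec0 E).
have -> : L (fun z => (1%:C : C) *: (0 : E z) + 0) = L (fun=> 0).
  by apply: L_ext => z; rewrite scaler0 addr0.
by move=> H; lra.
Qed.

Lemma L_scale (a : R) g : testsec g -> L (fun z => a%:C *: g z) = a * L g.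
Proof.
move=> Tg; have := wl_lin wl a Tg (testsec0 E); rewrite L0 addr0 => <-.
by apply: L_ext => z; rewrite addr0.
Qed.

Lemma L_add g1 g2 : testsec g1 -> testsec g2 ->
  L (fun z => g1 z + g2 z) = L g1 + L g2.
Proof.
move=> T1 T2; have := wl_lin wl 1 T1 T2; rewrite mul1r => <-.
by apply: L_ext => z; rewrite scale1r.
Qed.

Lemma testsec_sum m (F : 'I_m -> sec) : (forall j, testsec (F j)) ->
  testsec (fun z => \sum_j F j z).
Proof.
move=> HF; rewrite -[index_enum _]/(index_enum 'I_m).
elim: (index_enum _) => [|j r IH].
  by rewrite (_ : (fun z => _) = fun=> 0); [exact: testsec0|apply: functional_extensionality_dep => z; rewrite big_nil].
rewrite (_ : (fun z => _) = fun z => F j z + \sum_(j <- r) F j z).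
  exact: testsec_add.
by apply: functional_extensionality_dep => z; rewrite big_cons.
Qed.

Lemma L_sum m (F : 'I_m -> sec) : (forall j, testsec (F j)) ->
  L (fun z => \sum_j F j z) = \sum_j L (F j).
Proof.
move=> HF; rewrite -[index_enum _]/(index_enum 'I_m).
suff [] : testsec (fun z => \sum_(j <- index_enum 'I_m) F j z) /\
  L (fun z => \sum_(j <- index_enum 'I_m) F j z) = \sum_(j <- index_enum 'I_m) L (F j) by [].
elim: (index_enum _) => [|j r [IH1 IH2]].
  rewrite big_nil (_ : (fun z => _) = fun=> 0); last first.
    by apply: functional_extensionality_dep => z; rewrite big_nil.
  by split; [exact: testsec0|exact: L0].
rewrite (_ : (fun z => _) = fun z => F j z + \sum_(j <- r) F j z); last first.
  by apply: functional_extensionality_dep => z; rewrite big_cons.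
by rewrite big_cons L_add// IH2; split=> //; exact: testsec_add.
Qed.

Lemma I2_sum m (F : 'I_m -> R * R -> R) : (forall j, Cc (F j)) ->
  I2 (fun z => \sum_j F j z) = \sum_j I2 (F j).
Proof.
move=> HF; rewrite -[index_enum _]/(index_enum 'I_m).
suff [] : Cc (fun z => \sum_(j <- index_enum 'I_m) F j z) /\
  I2 (fun z => \sum_(j <- index_enum 'I_m) F j z) = \sum_(j <- index_enum 'I_m) I2 (F j) by [].
elim: (index_enum _) => [|j r [IH1 IH2]].
  rewrite big_nil (_ : (fun z => _) = fun=> 0); last first.
    by apply/funext => z; rewrite big_nil.
  by split; [exact: Cc0|exact: I2_0].
rewrite (_ : (fun z => _) = fun z => F j z + \sum_(j <- r) F j z); last first.
  by apply/funext => z; rewrite big_cons.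
by rewrite big_cons I2_add// IH2; split=> //; exact: Cc_add.
Qed.

Lemma dbar_sum m (F : 'I_m -> sec) z : (forall j, sm (F j)) ->
  dbar (fun z => \sum_j F j z) z = \sum_j dbar (F j) z.
Proof.
move=> HF; rewrite -[index_enum _]/(index_enum 'I_m).
suff [] : sm (fun z => \sum_(j <- index_enum 'I_m) F j z) /\
  dbar (fun z => \sum_(j <- index_enum 'I_m) F j z) z = \sum_(j <- index_enum 'I_m) dbar (F j) z by [].
elim: (index_enum _) => [|j r [IH1 IH2]].
  rewrite big_nil (_ : (fun z => _) = fun z => (0 : C) *: (0 : E z)); last first.
    by apply: functional_extensionality_dep => y; rewrite big_nil scaler0.
  split; first by apply: sm_scalec; exact: sm0.
  rewrite dbar_mul; [|exact: cs_cst|exact: sm0].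
  by rewrite scale0r scaler0 addr0.
rewrite (_ : (fun z => _) = fun z => F j z + \sum_(j <- r) F j z); last first.
  by apply: functional_extensionality_dep => y; rewrite big_cons.
by rewrite big_cons dbar_add// IH2; split=> //; exact: sm_add.
Qed.

(** Fixing the section and varying a scalar factor reduces [L] to functionals on
    scalar test functions. *)
Definition Lmul (eps : sec) (th : R * R -> R) : R :=
  L (fun z => (th z)%:C *: eps z).

Lemma nrm_mul_le eps (th : R * R -> R) (M : R) : testsec eps ->
  rsmooth_on setT th -> (forall z, `|th z| <= M) ->
  nrm W (fun z => (th z)%:C *: eps z) <= M ^+ 2 * nrm W eps.
Proof.
move=> Te St HM; have cW := wl_W wl; have W0 := wl_W0 wl.
rewrite /nrm -I2_scale; last exact: nrm_Cc.
apply: I2_le; first by apply: nrm_Cc => //; exact: testsec_scaler.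
  by apply: Cc_scale; exact: nrm_Cc.
move=> z; rewrite mulrA; apply: ler_wpM2r; first exact: ltW.
rewrite rhZl rhZr mulrA -expr2; apply: ler_wpM2r; first exact: rh_ge0.
have h0 := normr_ge0 (th z).
rewrite -(real_normK (num_real (th z))) lerXn2r// nnegrE//; exact: le_trans h0 (HM z).
Qed.

Lemma sqr_le_norm (a b M : R) : 0 <= b -> 0 <= M -> a ^+ 2 <= b ^+ 2 * M ^+ 2 -> `|a| <= b * M.
Proof.
move=> b0 M0 H; rewrite -(@ler_pXn2r _ 2)// ?nnegrE ?mulr_ge0//.
by rewrite real_normK ?num_real// exprMn.
Qed.

Lemma Lmul_bdfun eps c r : testsec eps -> bdfun c r (Lmul eps).
Proof.
move=> Te; split.
  move=> a f g [Sf _] [Sg _]; rewrite /Lmul -(wl_lin wl); try exact: testsec_scaler.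
  by apply: L_ext => z; rewrite scalerA -scalerDl rmorphD rmorphM.
have [K K0 HK] := wl_bound wl.
have N0 : 0 <= nrm W eps by apply: nrm_ge0 => z; apply: ltW; exact: (wl_W0 wl).
exists (Num.sqrt (K * nrm W eps)); first exact: sqrtr_ge0.
move=> f M [Sf _] HM.
have M0 : 0 <= M by exact: le_trans (normr_ge0 _) (HM 0).
apply: sqr_le_norm => //.
rewrite sqr_sqrtr ?mulr_ge0//.
apply: le_trans (HK _ (testsec_scaler Sf Te)) _.
by rewrite -mulrA ler_wpM2l// mulrC; exact: nrm_mul_le.
Qed.

Lemma Lmul_approx eps c r : testsec eps -> forall e : R, 0 < e -> exists k,
  forall f (M : R), tst c r f -> (forall z, `|f z| <= M) ->
  `|I2 (fun z => rh (s_ k z) (eps z) * f z) - Lmul eps f| <= e * M.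
Proof.
move=> Te e e0.
have N0 : 0 <= nrm W eps by apply: nrm_ge0 => z; apply: ltW; exact: (wl_W0 wl).
have N1 : 0 < nrm W eps + 1 by rewrite ltr_wpDl.
have [k Hk] := wl_approx wl (e := e ^+ 2 / (nrm W eps + 1)) ltac:(by rewrite divr_gt0// exprn_gt0).
exists k => f M [Sf _] HM.
have M0 : 0 <= M by exact: le_trans (normr_ge0 _) (HM 0).
apply: sqr_le_norm => //; first exact: ltW.
have := Hk _ (testsec_scaler Sf Te).
have -> : I2 (fun z => rh (s_ k z) ((f z)%:C *: eps z)) = I2 (fun z => rh (s_ k z) (eps z) * f z).
  by congr I2; apply/funext => z; rewrite rhZr mulrC.
move=> /le_trans; apply.
rewrite -mulrA; apply: ler_wpM2l; first exact: sqr_ge0.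
rewrite mulrC ler_pdivrMr//; apply: le_trans (nrm_mul_le Te Sf HM) _.
by rewrite ler_wpM2l ?sqr_ge0// lerDl.
Qed.

Lemma conj_i : conjc ('i%C : C) = - 'i%C.
Proof. by apply: complex_eq => //=; rewrite oppr0. Qed.

Lemma cderive_z_real (th : R * R -> R) z :
  cderive_z (fun y => (th y)%:C : C) z =
  (2^-1 * 'D_(1, 0) th z)%:C - 'i%C * (2^-1 * 'D_(0, 1) th z)%:C.
Proof.
rewrite /cderive_z !cderive_real half_real mulrBr !rmorphM /=; congr (_ - _).
by rewrite mulrCA.
Qed.

(** nabla_z (th * eps) = (d th / dz) eps, and [L] vanishes on it. *)
Lemma Lmul_CR eps c r : testsec eps ->
  (forall z, ball c r z -> dz eps z = 0) ->
  forall th, tst c r th ->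
  Lmul eps ('D_(1, 0) th) = Lmul (fun z => ('i%C : C) *: eps z) ('D_(0, 1) th).
Proof.
move=> Te He th Tth; have [Sth [r' r'r Hth]] := Tth.
have S1 := rs_D (1, 0) Sth; have S2 := rs_D (0, 1) Sth.
have Ti := testsec_scalec 'i%C Te.
have := wl_dz wl (testsec_scaler Sth Te).
have [Se _] := Te.
have -> : L (dz (fun z => (th z)%:C *: eps z)) =
   L (fun z => (2^-1)%:C *: (('D_(1, 0) th z)%:C *: eps z) +
      (- 2^-1)%:C *: (('D_(0, 1) th z)%:C *: (('i%C : C) *: eps z))).
  apply: L_ext => z; rewrite dz_mul//; last exact: cs_real.
  have -> : (th z)%:C *: dz eps z = 0.
    have [rz|zr] := leP r `|z - c|; first by rewrite Hth ?scale0r//; apply: le_trans rz; exact: ltW.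
    by rewrite He ?scaler0// -ball_normE /= distrC.
  rewrite addr0 cderive_z_real !scalerA -scalerDl; congr (_ *: _).
  by apply: complex_eq; rewrite ?ReD ?ImD ?ReN ?ImN ?ReM ?ImM /=; ring.
have T1 := testsec_scaler S1 Te; have T2 := testsec_scaler S2 Ti.
rewrite L_add; [|exact: testsec_scalec..].
by rewrite !L_scale// /Lmul => H; lra.
Qed.

(** Weyl's lemma applies to the pairs L (th eps_j), L (i th eps_j) of a dual frame
    and yields holomorphic functions U_j + i V_j; the section is
    sum_j (U_j + i V_j) e_j. *)
Lemma local_representation c : exists r S, [/\ 0 < r, testsec S,
  (forall g, testsec g -> (forall z, ~ ball c r z -> g z = 0) ->
     L g = I2 (fun z => rh (S z) (g z))) &
  forall z, ball c r z -> dbar S z = 0].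
Proof.
have [r0 [e [eps F]]] := frame_exists E c.
have r00 := frame_r F.
have Teps := frame_eps F.
have Tieps j : testsec (fun z => ('i%C : C) *: eps j z) by exact: testsec_scalec.
have He j z : ball c r0 z -> dz (eps j) z = 0 by move=> hz; exact: (frame_dz F).
have Hie j z : ball c r0 z -> dz (fun z => ('i%C : C) *: eps j z) z = 0.
  by move=> hz; rewrite dz_scalec ?He ?scaler0//; case: (Teps j).
have HW j : exists UV : (R * R -> R) * (R * R -> R),
  [/\ rsmooth_on (ball c (r0 / 2)) UV.1 /\ rsmooth_on (ball c (r0 / 2)) UV.2,
      (forall z, ball c (r0 / 2) z ->
         'D_(1, 0) UV.1 z = 'D_(0, 1) UV.2 z /\ 'D_(1, 0) UV.2 z = - 'D_(0, 1) UV.1 z),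
      (forall f, tst c (r0 / 2) f -> Lmul (eps j) f = I2 (fun z => UV.1 z * f z)) &
      (forall f, tst c (r0 / 2) f ->
         Lmul (fun z => ('i%C : C) *: eps j z) f = I2 (fun z => UV.2 z * f z))].
  have [U [V H]] := @weyl R c r0 (fun k z => rh (s_ k z) (eps j z))
    (fun k z => rh (s_ k z) (('i%C : C) *: eps j z))
    (Lmul (eps j)) (Lmul (fun z => ('i%C : C) *: eps j z)) r00
    (fun k => rh_Cc (wl_s wl k).1 (Teps j)) (fun k => rh_Cc (wl_s wl k).1 (Tieps j))
    (Lmul_bdfun c r0 (Teps j)) (Lmul_bdfun c r0 (Tieps j))
    (Lmul_approx c r0 (Teps j)) (Lmul_approx c r0 (Tieps j))
    (Lmul_CR (Teps j) (He j))
    ltac:(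
      move=> th Tth; rewrite (Lmul_CR (Tieps j) (Hie j) Tth);
      rewrite -mulN1r -(L_scale (-1) (testsec_scaler (rs_D (0, 1) Tth.1) (Teps j)));
      apply: L_ext => z; rewrite !scalerA; congr (_ *: _);
      apply: complex_eq; rewrite ?ReM ?ImM /=; ring).
  by exists (U, V).
have {HW}[UV HUV] := choice HW.
(* [chi d] lives where the functions of [UV] are smooth and equals 1 on the
   ball of radius r. *)
pose d := r0 / 4.
have d0 : 0 < d by rewrite divr_gt0.
pose r := d / 4.
have rr : 0 < r by rewrite divr_gt0.
have Tchi : tst c (r0 / 2) (fun z => chi d (z - c)).
  by split; [exact: chi_shift_smooth|exists d; [rewrite /d; lra|move=> z; exact: (chi_norm0 d0)]].
have bn q z : ball c q z -> `|z - c| < q by rewrite -ball_normE /= distrC.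
have br2 : ball c r `<=` ball c (r0 / 2) by apply: le_ball; rewrite /r /d; lra.
have br0 : ball c r `<=` ball c r0 by apply: le_ball; rewrite /r /d; lra.
have chir z : ball c r z -> chi d (z - c) = 1.
  by move=> /bn hz; rewrite chi_norm1// ltW.
pose f j z : C := ((UV j).1 z * chi d (z - c)) +i* ((UV j).2 z * chi d (z - c)).
have T1 j : tst c (r0 / 2) (fun z => (UV j).1 z * chi d (z - c)).
  by apply: tst_mul Tchi; have [[]] := HUV j.
have T2 j : tst c (r0 / 2) (fun z => (UV j).2 z * chi d (z - c)).
  by apply: tst_mul Tchi; have [[]] := HUV j.
have Sf j : csmooth_on setT (f j) by split; [case: (T1 j)|case: (T2 j)].
pose S : sec := fun z => \sum_j f j z *: e j z.
have TSj j : testsec (fun z => f j z *: e j z).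
  by apply: testsec_scale => //; exact: (frame_e F).
have TS : testsec S by exact: testsec_sum.
exists r, S; split=> //.
- move=> g Tg gr; have [Sg _] := Tg.
  pose a j z := h z (e j z) (g z).
  have Ta j : tst c (r0 / 2) (fun z => Re (a j z)) /\ tst c (r0 / 2) (fun z => Im (a j z)).
    have [Sa1 Sa2] := h_smooth (proj1 (frame_e F j)) Sg.
    have sup z : r <= `|z - c| -> a j z = 0.
      by move=> hz; rewrite /a gr ?h0r// => /bn; rewrite ltNge hz.
    by split; split=> //; exists r => [|z /sup ->//]; rewrite /r /d; lra.
  have gE z : g z = \sum_j ((Re (a j z))%:C *: eps j z + (-1 : R)%:C *: ((Im (a j z))%:C *: (('i%C : C) *: eps j z))).
    have [hz|hz] := pselect (ball c r z).
      rewrite {1}(frame_expand F (br0 _ hz) (g z)); apply: eq_bigr => j _.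
      rewrite !scalerA -scalerDl; congr (_ *: _); rewrite h_sym -/(a j z).
      by apply: complex_eq; rewrite ?ReD ?ImD ?ReM ?ImM ?ReJ ?ImJ /=; ring.
    rewrite gr// big1// => j _.
    have -> : a j z = 0 by rewrite /a gr// h0r.
    by rewrite !scale0r scaler0 addr0.
  rewrite (L_ext gE) L_sum; last first.
    move=> j; apply: testsec_add; first by apply: testsec_scaler => //; case: (Ta j) => [[]].
    by apply: testsec_scalec; apply: testsec_scaler => //; case: (Ta j) => _ [].
  have SE z : rh (S z) (g z) = \sum_j ((UV j).1 z * Re (a j z) - (UV j).2 z * Im (a j z)).
    rewrite /rh h_suml (big_morph Re (fun x y => ReD x y) (Re0 R)); apply: eq_bigr => j _.
    rewrite hZl ReM /=.
    have [hz|hz] := pselect (ball c r z); first by rewrite chir// !mulr1.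
    have -> : h z (e j z) (g z) = 0 by rewrite gr// h0r.
    by have -> : a j z = 0; [rewrite /a gr// h0r|rewrite /= !mulr0].
  have C1 j : Cc (fun z => (UV j).1 z * Re (a j z)).
    by have [[S1 _] _ _ _] := HUV j; have [Ta1 _] := Ta j; exact: tst_Cc (tst_mul S1 Ta1).
  have C2 j : Cc (fun z => (UV j).2 z * Im (a j z)).
    by have [[_ S2] _ _ _] := HUV j; have [_ Ta2] := Ta j; exact: tst_Cc (tst_mul S2 Ta2).
  rewrite (_ : (fun z => rh (S z) (g z)) = fun z => \sum_j ((UV j).1 z * Re (a j z) - (UV j).2 z * Im (a j z))); last by apply/funext.
  rewrite I2_sum; last by move=> j; exact: Cc_sub.
  apply: eq_bigr => j _.
  have [[Sa1 _] [Sa2 _]] := Ta j.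
  have Tb := testsec_scaler Sa2 (Tieps j).
  rewrite (L_add (testsec_scaler Sa1 (Teps j)) (testsec_scalec _ Tb)) (L_scale _ Tb).
  rewrite (I2_sub (C1 j) (C2 j)) mulN1r.
  have [_ _ H1 H2] := HUV j; have [Ta1 Ta2] := Ta j.
  by rewrite -(H1 _ Ta1) -(H2 _ Ta2).
- move=> z hz; rewrite dbar_sum; last by move=> j; case: (TSj j).
  rewrite big1// => j _.
  rewrite dbar_mul//; last by case: (frame_e F j).
  rewrite (frame_dbar F (br0 _ hz)) scaler0 addr0.
  have [[S1 S2] CR _ _] := HUV j.
  have oB : open (ball c r) by exact: ball_open.
  have near1 y : ball c r y -> (UV j).1 y = (UV j).1 y * chi d (y - c).
    by move=> hy; rewrite chir// mulr1.
  have near2 y : ball c r y -> (UV j).2 y = (UV j).2 y * chi d (y - c).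
    by move=> hy; rewrite chir// mulr1.
  have [_ D1] := diff_ext oB near1 hz (rs_diff S1 (br2 _ hz)).
  have [_ D2] := diff_ext oB near2 hz (rs_diff S2 (br2 _ hz)).
  have [CR1 CR2] := CR z (br2 _ hz).
  rewrite /cderive_zbar /cderive /= (D1 (1, 0)) (D2 (1, 0)) (D1 (0, 1)) (D2 (0, 1)).
  rewrite CR1 CR2.
  have -> : forall a b : R, (a +i* - b) + 'i%C * (b +i* a) = 0 :> C.
    by move=> a b; apply: complex_eq; rewrite ?ReD ?ImD ?ReM ?ImM /=; ring.
  by rewrite mulr0 scale0r.
Qed.

(** Test both representatives on their difference, cut off near [z]: the integral
    of a nonnegative function vanishes. *)
Lemma local_representation_unique S1 S2 c1 c2 (r1 r2 : R) z : testsec S1 -> testsec S2 ->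
  (forall g, testsec g -> (forall z, ~ ball c1 r1 z -> g z = 0) ->
     L g = I2 (fun z => rh (S1 z) (g z))) ->
  (forall g, testsec g -> (forall z, ~ ball c2 r2 z -> g z = 0) ->
     L g = I2 (fun z => rh (S2 z) (g z))) ->
  ball c1 r1 z -> ball c2 r2 z -> S1 z = S2 z.
Proof.
move=> T1 T2 H1 H2 h1 h2.
have [d d0 Hd] : exists2 d : R, 0 < d & forall y, `|y - z| < d -> ball c1 r1 y /\ ball c2 r2 y.
  have : nbhs z (ball c1 r1 `&` ball c2 r2).
    apply: open_nbhs_nbhs; split; last by split.
    by apply: openI; exact: ball_open.
  move=> /nbhs_ballP[d /= d0 Hd]; exists d => // y hy.
  by have := Hd y; rewrite -ball_normE /= distrC => /(_ hy)[].
pose D : sec := fun z => S1 z + (-1 : C) *: S2 z.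
have TD : testsec D by apply: testsec_add => //; exact: testsec_scalec.
pose g : sec := fun y => (chi d (y - z))%:C *: D y.
have Tg : testsec g by apply: testsec_scaler => //; exact: chi_shift_smooth.
have g0 y : ~ `|y - z| < d -> g y = 0.
  by move=> /negP; rewrite -leNgt => hy; rewrite /g chi_norm0// scale0r.
have E1 : L g = I2 (fun y => rh (S1 y) (g y)).
  by apply: H1 => // y hy; apply: g0 => /Hd[].
have E2 : L g = I2 (fun y => rh (S2 y) (g y)).
  by apply: H2 => // y hy; apply: g0 => /Hd[].
have CD : Cc (fun y => rh (D y) (g y)) by apply: rh_Cc => //; case: TD.
have ED : I2 (fun y => rh (D y) (g y)) = 0.
  rewrite (_ : (fun y => _) = fun y => rh (S1 y) (g y) - rh (S2 y) (g y)); last first.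
    by apply/funext => y; rewrite /D rhDl scaleN1r rhNl.
  rewrite I2_sub; [by rewrite -E1 -E2 subrr|apply: rh_Cc..] => //.
    by case: T1.
  by case: T2.
have gpos y : 0 <= rh (D y) (g y).
  by rewrite rhZr mulr_ge0 ?chi_ge0 ?rh_ge0.
have := I2_eq0 CD gpos ED z.
rewrite /g subrr chi_norm1 ?normr0 ?divr_ge0 ?ltW// scale1r => /rh_eq0.
by rewrite /D scaleN1r => /eqP; rewrite subr_eq0 => /eqP.
Qed.

Lemma dbar_local s t z c (r : R) : sm s -> sm t -> (forall y, `|y - c| < r -> s y = t y) ->
  `|z - c| < r -> dbar s z = dbar t z.
Proof.
move=> Ss St st hz.
have SD : sm (fun y => s y + (-1 : C) *: t y) by apply: sm_add => //; exact: sm_scalec.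
have D0 y : `|y - c| < r -> s y + (-1 : C) *: t y = 0.
  by move=> /st ->; rewrite scaleN1r subrr.
have : dbar (fun y => s y + (-1 : C) *: t y) z = 0.
  by rewrite /dbar !(nabla_local0 _ SD D0 hz) scaler0 addr0 scaler0.
rewrite dbar_add//; last exact: sm_scalec.
rewrite dbar_mul//; last exact: cs_cst.
rewrite /cderive_zbar !cderive_cst mulr0 addr0 mulr0 scale0r add0r scaleN1r.
by move=> /eqP; rewrite subr_eq0 => /eqP.
Qed.

(** Compactness in its covering form, applied to the directed system of finite
    lists of centres. *)
Lemma square_finite_cover (d : R * R -> R) (N : R) : (forall c, 0 < d c) ->
  exists l : seq (R * R), forall z, `|z| <= N ->
    exists2 c, c \in l & `|z - c| < d c.
Proof.
move=> d0.
pose F : set_system (seq (R * R)) := fun A =>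
  exists l0 : seq (R * R), forall l, {subset l0 <= l} -> A l.
have FF : Filter F.
  split.
  - by exists [::].
  - move=> A B [l1 H1] [l2 H2]; exists (l1 ++ l2) => l Hl.
    split; [apply: H1|apply: H2] => x xl; apply: Hl;
    by rewrite mem_cat xl ?orbT.
  - by move=> A B AB [l0 H0]; exists l0 => l /H0/AB.
pose P (l : seq (R * R)) (z : R * R) := exists2 c, c \in l & `|z - c| < d c.
have nc := iffLR (compact_near_coveringP _) (@sq_compact R N).
have [|l0 Hl0] := nc _ F P FF; last first.
  by exists l0 => z zN; apply: (Hl0 l0 (fun x xl => xl)).
move=> x _; exists (ball x (d x), [set l : seq (R * R) | x \in l]) => /=.
  split; first by apply: nbhsx_ballx.
  by exists [:: x] => l; apply; rewrite inE.
move=> [y l] /= [hy xl]; exists x => //.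
by move: hy; rewrite -ball_normE /= distrC.
Qed.

Lemma chi_partition d c s z : (chi d (z - c))%:C *: s z + (1 - chi d (z - c))%:C *: s z = s z :> E z.
Proof. by rewrite -scalerDl -rmorphD addrC subrK scale1r. Qed.

(** The local representatives agree where they overlap, so they glue. A test
    section is split by the cutoffs around finitely many centres that cover its
    support, one centre at a time. *)
Lemma global_representation : exists S : sec, holomorphic_section S /\
  forall g, testsec g -> L g = I2 (fun z => rh (S z) (g z)).
Proof.
have H c : exists rS : R * sec, [/\ 0 < rS.1, testsec rS.2,
  (forall g, testsec g -> (forall z, ~ ball c rS.1 z -> g z = 0) ->
     L g = I2 (fun z => rh (rS.2 z) (g z))) &
  forall z, ball c rS.1 z -> dbar rS.2 z = 0].
  by have [r [S ?]] := local_representation c; exists (r, S).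
have [rS HrS] := choice H.
pose r c := (rS c).1; pose SS c : sec := (rS c).2.
have r0 c : 0 < r c by have [] := HrS c.
have TS c : testsec (SS c) by have [] := HrS c.
have rep c g : testsec g -> (forall z, ~ ball c (r c) z -> g z = 0) ->
     L g = I2 (fun z => rh (SS c z) (g z)) by have [_ _ + _] := HrS c; apply.
have hol c z : ball c (r c) z -> dbar (SS c) z = 0 by have [_ _ _] := HrS c; apply.
pose S : sec := fun z => SS z z.
have SE c z : ball c (r c) z -> S z = SS c z.
  by move=> hz; apply: (local_representation_unique (TS z) (TS c) (rep z) (rep c)) => //; exact: ballxx.
have bn c q z : ball c q z <-> `|z - c| < q by rewrite -ball_normE /= distrC.
have SmS : sm S.
  apply/sec_onT; apply: sec_on_local => z _; exists (ball z (r z)), (SS z); split.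
  - exact: ball_open.
  - exact: ballxx.
  - by apply: sm_sec_on; case: (TS z).
  - by move=> y /SE.
exists S; split.
  split=> // z.
  rewrite (@dbar_local S (SS z) z z (r z)) ?hol ?subrr ?normr0//; last 2 first.
  - by case: (TS z).
  - by move=> y /bn/SE.
  exact: ballxx.
(* [chi (d c)] is supported in the ball of the representative at [c] and equals
   1 up to distance [d c / 4], so it is the balls of this radius that must
   cover the support. *)
pose d c := r c / 2.
have d0 c : 0 < d c by rewrite divr_gt0.
have key (l : seq (R * R)) g : testsec g ->
    (forall z, (forall c, c \in l -> d c / 4 <= `|z - c|) -> g z = 0) ->
    L g = I2 (fun z => rh (S z) (g z)).
  elim: l g => [|c l IH] g Tg Hg.
    have g0 z : g z = 0 by exact: Hg.
    rewrite (L_ext g0) L0 (_ : (fun z => _) = fun=> 0) ?I2_0//.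
    by apply/funext => z; rewrite g0 /rh h0r.
  have Sc := chi_shift_smooth (d c) c.
  pose g1 : sec := fun z => (chi (d c) (z - c))%:C *: g z.
  pose g2 : sec := fun z => (1 - chi (d c) (z - c))%:C *: g z.
  have T1 : testsec g1 by exact: testsec_scaler.
  have T2 : testsec g2.
    by apply: testsec_scaler => //; apply: rs_subr => //; [exact: openT|exact: rs_cst].
  have E1 : L g1 = I2 (fun z => rh (S z) (g1 z)).
    have g10 z : ~ ball c (r c) z -> g1 z = 0.
      move=> /bn/negP; rewrite -leNgt => hz; rewrite /g1 chi_norm0 ?scale0r//.
      by apply: le_trans hz; rewrite /d ler_pdivrMr// ler_peMr// ?ler1n// ltW.
    rewrite (rep c g1)//; congr I2; apply/funext => z.
    have [hz|hz] := pselect (ball c (r c) z); first by rewrite (SE c).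
    by rewrite g10// /rh !h0r.
  have E2 : L g2 = I2 (fun z => rh (S z) (g2 z)).
    apply: IH => // z Hz.
    have [hz|hz] := leP (d c / 4) `|z - c|.
      rewrite /g2 Hg ?scaler0// => c'; rewrite in_cons => /orP[/eqP -> //|]; exact: Hz.
    by rewrite /g2 chi_norm1// ?subrr ?scale0r// ltW.
  have gE z : g z = g1 z + g2 z by rewrite chi_partition.
  rewrite (L_ext gE) L_add// E1 E2 -I2_add; [|exact: rh_Cc..].
  by congr I2; apply/funext => z; rewrite gE rhDr.
move=> g Tg; have [_ [N HN]] := Tg.
have [l Hl] := @square_finite_cover (fun c => d c / 4) N (fun c => divr_gt0 (d0 c) (ltr0n R 4)).
apply: (key l) => // z Hz.
have [zN|/ltW/HN//] := leP `|z| N.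
have [c cl] := Hl z zN.
by rewrite ltNge Hz.
Qed.

(** Testing [L] on chi * S / W bounds the square of the integral of
    chi |S|^2 / W by a multiple of the integral itself. *)
Lemma representation_L2 S : rsmooth_on setT W -> sm S ->
  (forall g, testsec g -> L g = I2 (fun z => rh (S z) (g z))) ->
  exists K : R, forall N : R, 0 < N ->
    I2 (fun z => chi N z * (rh (S z) (S z) / W z)) <= K.
Proof.
move=> SW SS HS; have [K K0 HK] := wl_bound wl; exists K => N N0.
have W0 := wl_W0 wl.
pose f z := chi N z * (W z)^-1.
have Sf : rsmooth_on setT f.
  apply: rs_mul; [exact: openT|exact: rs_chi|apply: rs_inv => //; first exact: openT].
  by move=> z _; rewrite gt_eqF.
pose g : sec := fun z => (f z)%:C *: S z.
have Tg : testsec g.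
  split; first by apply: sm_scale => //; exact: cs_real.
  by exists N => z hz; rewrite /g /f chi_norm0// mul0r scale0r.
set a := I2 _.
have La : L g = a.
  rewrite HS//; congr I2; apply/funext => z; rewrite /g rhZr /f.
  by rewrite mulrAC -mulrA.
have Ca : Cc (fun z => chi N z * (rh (S z) (S z) / W z)).
  have := rh_Cc SS Tg; congr Cc; apply/funext => z; rewrite /g rhZr /f.
  by rewrite mulrAC -mulrA.
have a0 : 0 <= a.
  by apply: I2_ge0 => z; rewrite mulr_ge0 ?chi_ge0// divr_ge0 ?rh_ge0// ltW.
have na : nrm W g <= a.
  apply: I2_le => //; first by apply: nrm_Cc => //; exact: (wl_W wl).
  move=> z; rewrite /g rhZl rhZr /f.
  have -> : chi N z * (W z)^-1 * (chi N z * (W z)^-1 * rh (S z) (S z)) * W z =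
     chi N z * (chi N z * (rh (S z) (S z) / W z)).
    by field; rewrite gt_eqF.
  apply: ler_piMl; last exact: chi_le1.
  by rewrite mulr_ge0 ?chi_ge0// divr_ge0 ?rh_ge0// ltW.
have := HK g Tg; rewrite La => Ha.
have : a ^+ 2 <= K * a by apply: le_trans Ha _; rewrite ler_wpM2l.
have [->//|a1] := eqVneq a 0.
by rewrite expr2 ler_pM2r// lt_neqAle eq_sym a1.
Qed.

End Regularity.

(** * Conjugation *)

Section Conjugation.
Variables (R : realType) (n : nat) (E : hermitian_holomorphic_bundle R n).
Variables (xi : euclidean_bundle R n) (iota : forall z : R * R, xi z -> E z).
Hypothesis cx : is_complexification iota.
Notation C := R[i].
Notation Re := (@complex.Re R).
Notation Im := (@complex.Im R).
Notation sec := (section E).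
Notation sm s := (smooth_section (complex_coeffs R) (s : sec)).
Notation rsm s := (smooth_section (real_coeffs R) (s : section xi)).
Notation h := (metric E).

Lemma iotaD z (a b : xi z) : iota (a + b) = iota a + iota b.
Proof. by have := iota_linear cx 1 a b; rewrite !scale1r. Qed.

Lemma iota0 z : iota (0 : xi z) = 0.
Proof.
have := iotaD (0 : xi z) 0; rewrite addr0 => /eqP.
by rewrite -subr_eq0 opprD addNKr oppr_eq0 => /eqP.
Qed.

Lemma iotaN z (a : xi z) : iota (- a) = - iota a.
Proof. by apply/eqP; rewrite -addr_eq0 -iotaD addNr iota0. Qed.

Lemma rtriv0 i z : dom xi i z -> triv xi i z 0 = 0.
Proof.
move=> di; have := triv_linear di 1 (0 : xi z) 0; rewrite !scale1r addr0 => /eqP.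
by rewrite -subr_eq0 opprD addNKr oppr_eq0 => /eqP.
Qed.

Lemma rsm0 : rsm (fun=> 0).
Proof.
move=> i k; have oD : open (dom xi i) by exact: dom_open.
by apply: rs_ext (rs_cst 0) => // z di; rewrite rtriv0// mxE.
Qed.

Lemma rsmN (u : section xi) : rsm u -> rsm (fun z => - u z).
Proof.
move=> Su i k; have oD : open (dom xi i) by exact: dom_open.
apply: rs_ext (rs_opp oD (Su i k)) => // z di.
have := triv_linear di (-1) (u z) 0; rewrite addr0 scaleN1r rtriv0// addr0 => ->.
by rewrite !mxE mulN1r.
Qed.

Lemma iota_sm (u : section xi) : rsm u -> sm (fun z => iota (u z)).
Proof.
move=> Su; have := (iota_smooth cx u (fun=> 0)).2 (conj Su rsm0).
congr smooth_section; apply: functional_extensionality_dep => z.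
by rewrite iota0 scaler0 addr0.
Qed.

Lemma h_iota z (a b : xi z) : Im (h z (iota a) (iota b)) = 0.
Proof. by rewrite (iota_metric cx). Qed.

(** The cross terms cancel when x and y are real for the metric. *)
Lemma rh_conj z (x y : E z) : Im (h z x y) = 0 ->
  rh (x + ('i%C : C) *: y) (x + ('i%C : C) *: y) =
  rh (x - ('i%C : C) *: y) (x - ('i%C : C) *: y).
Proof.
move=> H; rewrite !(rhDl, rhDr, rhNl, rhNr).
have -> : rh x (('i%C : C) *: y) = 0.
  by rewrite /rh hZr conj_i ReM ReN ImN Rei Imi H; ring.
have -> : rh (('i%C : C) *: y) x = 0.
  by rewrite rhC /rh hZr conj_i ReM ReN ImN Rei Imi H; ring.
ring.
Qed.

(** This is where the real structure of the bundle enters. The conjugate of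
    u + i v is u - i v; conjugation preserves norms, commutes with the
    connection, and so turns nabla_z into dbar. *)
Lemma conj_section (t : sec) : testsec t -> exists ct : sec, [/\ testsec ct,
  forall z, rh (ct z) (ct z) = rh (t z) (t z) &
  forall z, rh (dbar ct z) (dbar ct z) = rh (dz t z) (dz t z)].
Proof.
move=> [St [N HN]].
have dec z : exists uv : xi z * xi z, t z = iota uv.1 + ('i%C : C) *: iota uv.2.
  by have [uv [H _]] := iota_decomp cx (t z); exists uv.
pose u : section xi := fun z => (sval (cid (dec z))).1.
pose v : section xi := fun z => (sval (cid (dec z))).2.
have tE z : t z = iota (u z) + ('i%C : C) *: iota (v z).
  exact: (svalP (cid (dec z))).
have tE' : t = fun z => iota (u z) + ('i%C : C) *: iota (v z).
  exact: functional_extensionality_dep.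
have [Su Sv] : rsm u /\ rsm v by apply/(iota_smooth cx); rewrite -tE'.
have SIu := iota_sm Su; have SIv := iota_sm Sv.
pose ct : sec := fun z => iota (u z) + ('i%C : C) *: iota (- v z).
have Sct : sm ct by apply/(iota_smooth cx); split=> //; exact: rsmN.
have ctE : ct = fun z => iota (u z) + (- 'i%C : C) *: iota (v z).
  by apply: functional_extensionality_dep => z; rewrite /ct iotaN scalerN scaleNr.
have norm_ct z : rh (ct z) (ct z) = rh (t z) (t z).
  rewrite tE ctE rh_conj; last exact: h_iota.
  by rewrite scaleNr.
exists ct; split=> //.
  split=> //; exists N => z /HN tz; apply: rh_eq0.
  by rewrite norm_ct tz /rh h0l.
move=> z.
set ux := nabla xi (1, 0) u z; set uy := nabla xi (0, 1) u z.
set vx := nabla xi (1, 0) v z; set vy := nabla xi (0, 1) v z.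
have H1 : dz t z = (2^-1 : C) *: ((iota ux + iota vy) + ('i%C : C) *: (iota vx - iota uy)).
  rewrite /dz tE' !nablaD//; try exact: sm_scalec.
  rewrite !nablaZ// !(iota_nabla cx)//; congr (_ *: _).
  rewrite scalerDr scalerA -expr2 sqr_i scaleN1r opprD opprK scalerBr.
  by rewrite [- _ + _]addrC addrACA.
have H2 : dbar ct z = (2^-1 : C) *: ((iota ux + iota vy) - ('i%C : C) *: (iota vx - iota uy)).
  rewrite /dbar ctE !nablaD//; try exact: sm_scalec.
  rewrite !nablaZ// !(iota_nabla cx)//; congr (_ *: _).
  rewrite scalerDr scalerA mulrN -expr2 sqr_i opprK scale1r scalerBr opprB scaleNr.
  rewrite [RHS]addrA -[LHS]addrA.
  rewrite -!addrA; congr (_ + _).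
  by rewrite addrC [X in X + _ = _]addrC -addrA.
rewrite H1 H2 !rh_abs; congr (_ * _); rewrite rh_conj//.
by rewrite !(hDl, hDr, hNl, hNr) !(ImD, ImN) !h_iota oppr0 !addr0.
Qed.

End Conjugation.

(** * The spectral gap with growing weights *)

Section Weight.
Variable R : realType.
Implicit Types (z v : R * R) (a : R).

(** A smooth substitute for the modulus, from which it differs by at most 1. *)
Definition bracket z : R := Num.sqrt (1 + sqn z).
Definition grow a z : R := expR (a * bracket z).

Lemma modulusE z : modulus z = Num.sqrt (sqn z).
Proof. by []. Qed.

Lemma modulus_continuous : continuous (@modulus R).
Proof.
move=> z; apply: (@continuous_comp _ _ _ (@sqn R) Num.sqrt).
  by apply: (rs_continuous (rs_sqn _)); exact: openT.
exact: sqrt_continuous.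
Qed.

Lemma exp_weight_continuous a : continuous (exp_weight a).
Proof.
move=> z; apply: (@continuous_comp _ _ _ (fun z => - a * modulus z) expR).
  by apply: cvgM; [exact: cvg_cst|exact: modulus_continuous].
exact: continuous_expR.
Qed.

Lemma sqn1_gt0 z : 0 < 1 + sqn z.
Proof. by rewrite ltr_pwDl// sqn_ge0. Qed.

Lemma bracket_gt0 z : 0 < bracket z.
Proof. by rewrite sqrtr_gt0 sqn1_gt0. Qed.

Lemma bracket_sqr z : bracket z ^+ 2 = 1 + sqn z.
Proof. by rewrite sqr_sqrtr// ltW// sqn1_gt0. Qed.

Lemma modulus_ge0 z : 0 <= modulus z.
Proof. exact: sqrtr_ge0. Qed.

Lemma modulus_sqr z : modulus z ^+ 2 = sqn z.
Proof. by rewrite modulusE sqr_sqrtr// sqn_ge0. Qed.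

Lemma modulus_le_bracket z : modulus z <= bracket z.
Proof. by rewrite modulusE /bracket ler_wsqrtr// lerDr. Qed.

Lemma bracket_le z : bracket z <= 1 + modulus z.
Proof.
have m0 := modulus_ge0 z.
have b0 := ltW (bracket_gt0 z).
rewrite -(@ler_pXn2r _ 2)// ?nnegrE ?addr_ge0//.
by rewrite bracket_sqr -modulus_sqr; nra.
Qed.

Lemma rs_bracket : rsmooth_on setT bracket.
Proof.
apply: rs_sqrt; [exact: openT|by move=> z _; exact: sqn1_gt0|].
by apply: rs_add; [exact: openT|exact: rs_cst|apply: rs_sqn; exact: openT].
Qed.

Lemma rs_grow a : rsmooth_on setT (grow a).
Proof.
apply: rs_exp; first exact: openT.
by apply: rs_mul; [exact: openT|exact: rs_cst|exact: rs_bracket].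
Qed.

Lemma grow_gt0 a z : 0 < grow a z.
Proof. exact: expR_gt0. Qed.

Lemma grow_continuous a : continuous (grow a).
Proof. exact: rs_continuous (rs_grow a). Qed.

Lemma D_grow a v z :
  'D_v (grow a) z = a * ((z.1 * v.1 + z.2 * v.2) / bracket z) * grow a z.
Proof.
have ds : differentiable (@sqn R) z by apply: rs_diff (rs_sqn (@openT _)) _.
have dc : differentiable (fun=> 1 : R) z by exact: differentiable_cst.
have d1 : differentiable (fun z => 1 + sqn z) z by exact: (differentiableD dc ds).
have [d2 D2] := D_comp (is_derive1_sqrt (sqn1_gt0 z)) d1.
have da : differentiable (fun=> a : R) z by exact: differentiable_cst.
have d3 : differentiable (fun z => a * bracket z) z.
  by apply: rs_diff (rs_mul (@openT _) (rs_cst a) rs_bracket) _.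
have [_ D3] := D_comp (is_derive_expR (a * bracket z)) d3.
rewrite /grow D3 (D_mul _ da d2) D_cst mulr0 addr0 D2 (D_add _ dc ds) D_cst D_sqn.
have b0 : bracket z != 0 by rewrite gt_eqF// bracket_gt0.
rewrite -/(bracket z); field; exact: b0.
Qed.

(** The square of the growing weight times the decaying one is comparable with the
    growing weight. *)
Lemma grow_weight_lo a z : 0 <= a -> grow a z <= grow a z ^+ 2 * exp_weight a z.
Proof.
move=> a0; rewrite -expRM_natl -expRD ler_expR.
have := ler_wpM2l a0 (modulus_le_bracket z); lra.
Qed.

Lemma grow_weight_hi a z : 0 <= a ->
  grow a z ^+ 2 * exp_weight a z <= expR a * grow a z.
Proof.
move=> a0; rewrite -expRM_natl -!expRD ler_expR.
have := ler_wpM2l a0 (bracket_le z); lra.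
Qed.

End Weight.

Section Estimate.
Variables (R : realType) (n : nat) (E : hermitian_holomorphic_bundle R n).
Notation C := R[i].
Notation Re := (@complex.Re R).
Notation Im := (@complex.Im R).
Notation sec := (section E).
Notation sm s := (smooth_section (complex_coeffs R) (s : sec)).
Notation h := (metric E).
Implicit Types (s t g : sec) (z v : R * R).

Lemma L2normsqE (phi : R * R -> R) t : continuous phi -> testsec t ->
  L2normsq phi t = (nrm phi t)%:E.
Proof. by move=> cphi Tt; rewrite /nrm I2_E//; exact: nrm_Cc. Qed.

Lemma rh_add_le z (x y : E z) : rh (x + y) (x + y) <= 2 * rh x x + 2 * rh y y.
Proof.
have := rh_ge0 (x - y); rewrite !(rhDl, rhDr, rhNl, rhNr) => H.
lra.
Qed.

Lemma cderive_z_realE (F : R * R -> R) z :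
  Re (cderive_z (fun w => (F w)%:C) z) ^+ 2 + Im (cderive_z (fun w => (F w)%:C) z) ^+ 2 =
  ('D_(1, 0) F z ^+ 2 + 'D_(0, 1) F z ^+ 2) / 4.
Proof.
rewrite /cderive_z !cderive_real half_real !(ReM, ImM, ReD, ImD, ReN, ImN, ReR, ImR, Rei, Imi).
move: ('D_(1, 0) F z) ('D_(0, 1) F z) => p q.
by rewrite !(mul0r, mulr0, subr0, sub0r, add0r, mul1r, oppr0, addr0); field.
Qed.

Lemma cderive_z_grow (a : R) z :
  Re (cderive_z (fun w => (grow a w)%:C) z) ^+ 2 +
  Im (cderive_z (fun w => (grow a w)%:C) z) ^+ 2 <= a ^+ 2 / 4 * grow a z ^+ 2.
Proof.
rewrite cderive_z_realE (@D_grow _ a (1, 0)) (@D_grow _ a (0, 1)).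
set b := bracket z; set F := grow a z.
have b0 : 0 < b by exact: bracket_gt0.
have bE : b ^+ 2 = 1 + (z.1 ^+ 2 + z.2 ^+ 2) by exact: bracket_sqr.
have -> : ((a * ((z.1 * 1 + z.2 * 0) / b) * F) ^+ 2 +
  (a * ((z.1 * 0 + z.2 * 1) / b) * F) ^+ 2) / 4 =
  a ^+ 2 / 4 * F ^+ 2 * ((z.1 ^+ 2 + z.2 ^+ 2) / b ^+ 2).
  by field; rewrite gt_eqF.
rewrite -[leRHS]mulr1 ler_wpM2l//.
  by rewrite mulr_ge0 ?sqr_ge0// divr_ge0 ?sqr_ge0.
by rewrite ler_pdivrMr ?exprn_gt0// mul1r bE lerDr.
Qed.

Lemma rh_dz_grow (a : R) t z : sm t ->
  rh (dz (fun y => (grow a y)%:C *: t y) z) (dz (fun y => (grow a y)%:C *: t y) z) <=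
  2 * (grow a z ^+ 2 * rh (dz t z) (dz t z)) +
  a ^+ 2 / 2 * (grow a z ^+ 2 * rh (t z) (t z)).
Proof.
move=> St; rewrite dz_mul//; last by apply: cs_real; exact: rs_grow.
apply: le_trans (rh_add_le _ _) _.
rewrite !rh_abs ReR ImR expr0n addr0.
have := ler_wpM2r (rh_ge0 (t z)) (cderive_z_grow a z).
lra.
Qed.

(** The gap for nabla_z passes from exponentially decaying weights to
    exponentially growing ones: apply it to [grow a *: t]. The derivative of the
    logarithm of [grow a] is at most a / 2, and a^2 < kappa lets the left-hand
    side absorb half of the gap. *)
Lemma gap_grow (a kappa : R) : 0 < a -> 0 < kappa -> a ^+ 2 < kappa ->
  (forall t, testsec t -> kappa * nrm (exp_weight a) t <= nrm (exp_weight a) (dz t)) ->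
  forall t, testsec t -> nrm (grow a) t <= 4 / kappa * expR a * nrm (grow a) (dz t).
Proof.
move=> a0 k0 ak gap t Tt; have [St _] := Tt; have a0' := ltW a0.
pose phi z := grow a z ^+ 2 * exp_weight a z.
have cphi : continuous phi.
  move=> z; apply: cvgM; last exact: exp_weight_continuous.
  by apply: cvgM; exact: grow_continuous.
have Ts : testsec (fun z => (grow a z)%:C *: t z).
  by apply: testsec_scaler => //; exact: rs_grow.
have Tdt := testsec_dz Tt.
have C1 := nrm_Cc cphi Tt; have C2 := nrm_Cc cphi Tdt.
have H1 : nrm (exp_weight a) (fun z => (grow a z)%:C *: t z) = nrm phi t.
  by congr I2; apply/funext => z; rewrite rhZl rhZr /phi; ring.
have H2 : nrm (exp_weight a) (dz (fun z => (grow a z)%:C *: t z)) <=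
    2 * nrm phi (dz t) + a ^+ 2 / 2 * nrm phi t.
  rewrite -(I2_scale _ C1) -(I2_scale _ C2) -(I2_add (Cc_scale _ C2) (Cc_scale _ C1)).
  apply: I2_le.
  - by apply: nrm_Cc; [exact: exp_weight_continuous|exact: testsec_dz].
  - exact: Cc_add (Cc_scale _ C2) (Cc_scale _ C1).
  move=> z; have := ler_wpM2r (ltW (expR_gt0 (- a * modulus z))) (rh_dz_grow a z St).
  rewrite -/(exp_weight a z) /phi; lra.
have H3 : nrm (grow a) t <= nrm phi t.
  apply: I2_le => //; first by apply: nrm_Cc => //; exact: grow_continuous.
  by move=> z; rewrite ler_wpM2l ?rh_ge0//; exact: grow_weight_lo.
have C3 : Cc (fun z => rh (dz t z) (dz t z) * grow a z).
  by apply: nrm_Cc => //; exact: grow_continuous.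
have H4 : nrm phi (dz t) <= expR a * nrm (grow a) (dz t).
  rewrite -(I2_scale _ C3); apply: (I2_le C2 (Cc_scale _ C3)) => z.
  have := ler_wpM2l (rh_ge0 (dz t z)) (grow_weight_hi z a0').
  by rewrite [leRHS]mulrCA.
have := gap _ Ts; rewrite H1 => H5.
have N0 : 0 <= nrm phi t.
  by apply: nrm_ge0 => z; rewrite mulr_ge0 ?sqr_ge0// expR_ge0.
have H6 : kappa * nrm phi t <= 4 * (expR a * nrm (grow a) (dz t)).
  have := ler_wpM2r N0 (ltW ak); move: (le_trans H5 H2) H4.
  move: (nrm phi t) (nrm phi (dz t)) (expR a * _) (a ^+ 2) => p q r b.
  by clear; lra.
rewrite -(ler_pM2l k0); apply: le_trans (ler_wpM2l (ltW k0) H3) _.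
apply: le_trans H6 _; rewrite le_eqVlt; apply/orP; left; apply/eqP.
by field; rewrite gt_eqF.
Qed.

End Estimate.

(** * Minimizing sequences *)

Section Riesz.
Variable R : realType.

(** A nonnegative quadratic polynomial has a nonpositive discriminant; [q = 0]
    is allowed. *)
Lemma quad_disc (p b q : R) : 0 <= q ->
  (forall a : R, 0 <= p + 2 * a * b + a ^+ 2 * q) -> b ^+ 2 <= p * q.
Proof.
have [->|qn] := eqVneq q 0 => q0 H.
  have [->|bn] := eqVneq b 0; first by rewrite expr0n mulr0.
  (* the zero of the affine function p + 1 + 2 a b *)
  have := H (- (p + 1) / (2 * b)).
  have -> : p + 2 * (- (p + 1) / (2 * b)) * b + (- (p + 1) / (2 * b)) ^+ 2 * 0 = -1.
    by field.
  by rewrite oppr_ge0 ler10.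
have q1 : 0 < q by rewrite lt_neqAle eq_sym qn.
have := H (- b / q).
have -> : p + 2 * (- b / q) * b + (- b / q) ^+ 2 * q = p - b ^+ 2 / q by field.
by rewrite subr_ge0 ler_pdivrMr.
Qed.

Variables (T : Type) (P : T -> Prop) (comb : R -> T -> T -> T) (x0 : T).
Variables (B : T -> T -> R) (l : T -> R).
Hypothesis P0 : P x0.
Hypothesis Pcomb : forall a x y, P x -> P y -> P (comb a x y).
Hypothesis Bsym : forall x y, B x y = B y x.
Hypothesis Bge0 : forall x, 0 <= B x x.
Hypothesis Bcomb : forall a x y z, P x -> P y -> P z ->
  B (comb a x y) z = a * B x z + B y z.
Hypothesis lcomb : forall a x y, P x -> P y -> l (comb a x y) = a * l x + l y.

Lemma Bquad a x y : P x -> P y ->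
  B (comb a x y) (comb a x y) = B y y + 2 * a * B x y + a ^+ 2 * B x x.
Proof.
move=> Px Py; have Pc := Pcomb a Px Py.
rewrite Bcomb// [B x _]Bsym [B y _]Bsym !Bcomb// [B y x]Bsym; ring.
Qed.

Lemma B_CS x y : P x -> P y -> B x y ^+ 2 <= B x x * B y y.
Proof.
move=> Px Py; rewrite mulrC; apply: quad_disc => // a.
by rewrite -Bquad.
Qed.

(** Without completeness, the Riesz representative of a bounded functional
    exists only as a minimizing sequence of the energy [B x x - 2 * l x]. *)
Lemma approx_riesz (A : R) : (forall x, P x -> l x ^+ 2 <= A * B x x) ->
  exists t_ : nat -> T, [/\ forall k, P (t_ k),
    forall k x, P x -> (B (t_ k) x - l x) ^+ 2 <= k.+1%:R^-1 * B x x &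
    forall j k, B (comb (-1) (t_ j) (t_ k)) (comb (-1) (t_ j) (t_ k)) <=
      2 / j.+1%:R + 2 / k.+1%:R].
Proof.
move=> HA; pose J x := B x x - 2 * l x.
pose S : set R := [set r | exists2 x, P x & r = J x].
have lbS : has_lbound S.
  exists (- `|A|) => _ [x Px ->]; rewrite /J lerBrDr addrC -lerBrDr opprK.
  have q0 := Bge0 x; have A0 := normr_ge0 A.
  have Hb : l x ^+ 2 <= `|A| * B x x.
    by apply: le_trans (HA x Px) _; rewrite ler_wpM2r// ler_norm.
  apply: le_trans (ler_norm _) _.
  rewrite -(@ler_pXn2r _ 2)// ?nnegrE ?addr_ge0// real_normK ?num_real//.
  have := sqr_ge0 (B x x - `|A|); move: Hb.
  by move: (B x x) (l x) `|A| => q b c; lra.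
have iS : has_inf S by split=> //; exists (J x0), x0.
have He k : exists2 x, P x & J x < inf S + k.+1%:R^-1.
  have := inf_adherent (_ : 0 < k.+1%:R^-1 :> R) iS.
  by rewrite invr_gt0 ltr0Sn => /(_ isT)[_ [x Px ->] Hx]; exists x.
pose t_ k := s2val (cid2 (He k)).
have Pt k : P (t_ k) by exact: (s2valP (cid2 (He k))).
have Jt k : J (t_ k) < inf S + k.+1%:R^-1 by exact: (s2valP' (cid2 (He k))).
have Ht k x : P x -> (B (t_ k) x - l x) ^+ 2 <= k.+1%:R^-1 * B x x.
  move=> Px; apply: quad_disc => // a.
  have : inf S <= J (comb a x (t_ k)).
    by apply: ge_inf => //; exists (comb a x (t_ k)) => //; exact: Pcomb.
  have := Jt k; rewrite /J Bquad// lcomb// [B x _]Bsym.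
  move: (B x x) (B (t_ k) x) (B (t_ k) (t_ k)) (l x) (l (t_ k)) (inf S) (k.+1%:R^-1).
  by move=> p q r b c d e; lra.
exists t_; split=> // j k.
set x := comb _ _ _; have Px : P x by exact: Pcomb.
have Bx : B x x = (B (t_ k) x - l x) - (B (t_ j) x - l x).
  by rewrite {1}/x Bcomb//; ring.
have := Ht k x Px; have := Ht j x Px; have := Bge0 x; move: Bx.
move: (B x x) (B (t_ k) x - l x) (B (t_ j) x - l x) => q b c -> q0 Hc Hb.
have [->|bc] := eqVneq (b - c) 0; first by rewrite addr_ge0// divr_ge0.
have bc0 : 0 < b - c by rewrite lt_neqAle eq_sym bc.
rewrite -(ler_pM2r bc0).
have := sqr_ge0 (b + c); move: Hb Hc.
move: (k.+1%:R^-1) (j.+1%:R^-1) => u v; lra.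
Qed.

End Riesz.

Section Limits.
Variable R : realType.

(** The Cauchy estimates produced by [approx_riesz], passed to the limit. *)
Lemma cauchy_sqr (u : nat -> R) (N : R) : 0 <= N ->
  (forall j k, (u k - u j) ^+ 2 <= (2 / j.+1%:R + 2 / k.+1%:R) * N) ->
  cvgn u /\ forall k, (u k - limn u) ^+ 2 <= 4 / k.+1%:R * N.
Proof.
move=> N0 H.
have Hjk k j : (k <= j)%N -> (u k - u j) ^+ 2 <= 4 / k.+1%:R * N.
  move=> kj; apply: le_trans (H j k) _; rewrite ler_wpM2r//.
  have : j.+1%:R^-1 <= k.+1%:R^-1 :> R by rewrite lef_pV2 ?posrE// ler_nat.
  by move: (j.+1%:R^-1) (k.+1%:R^-1) => p q; lra.
have cu : cvgn u.
  apply: cauchy_cvg; apply: cauchy_exP => e e0.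
  pose M := Num.truncn (4 * N / e ^+ 2).
  exists (u M); exists M => // j /= Mj.
  rewrite /= -ball_normE /= -(@ltr_pXn2r _ 2)// ?nnegrE// ?ltW// real_normK ?num_real//.
  apply: le_lt_trans (Hjk _ _ Mj) _.
  have M1 : 4 * N / e ^+ 2 < M.+1%:R by exact: truncnS_gt.
  by rewrite mulrAC ltr_pdivrMr// [ltRHS]mulrC -ltr_pdivrMr ?exprn_gt0//.
split=> // k.
have cd : (fun j => (u k - u j) ^+ 2) @ \oo --> (u k - limn u) ^+ 2.
  have c1 : (fun j => u k - u j) @ \oo --> u k - limn u.
    by apply: (@cvgB _ R^o); [exact: cvg_cst|exact: cu].
  by rewrite expr2; apply: cvgM.
rewrite -(cvg_lim _ cd)//; apply: limr_le; first by apply: cvgP cd.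
by near=> j; apply: Hjk; near: j; exact: nbhs_infty_ge.
Unshelve. all: by end_near. Qed.

End Limits.

(** * The limit functional *)

Section Existence.
Variables (R : realType) (n : nat) (E : hermitian_holomorphic_bundle R n).
Notation C := R[i].
Notation Re := (@complex.Re R).
Notation Im := (@complex.Im R).
Notation sec := (section E).
Notation sm s := (smooth_section (complex_coeffs R) (s : sec)).
Notation h := (metric E).
Implicit Types (s t g : sec) (z v : R * R).

(** A quadratic factor is absorbed by doubling the rate of growth. *)
Lemma sqn_grow (a : R) : 0 < a ->
  exists2 c : R, 0 < c & forall z : R * R, sqn z * grow a z <= c * grow (2 * a) z.
Proof.
move=> a0; have [c Hc] := @pow_le_exp R 2.
have c0 : 0 < c.
  have := Hc 1 ler01; rewrite expr1n => H1.
  by rewrite -(pmulr_lgt0 _ (expR_gt0 1)) (lt_le_trans ltr01 H1).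
exists (c / a ^+ 2) => [|z]; first by rewrite divr_gt0// exprn_gt0.
have -> : grow (2 * a) z = grow a z * grow a z by rewrite /grow -expRD; congr expR; ring.
rewrite mulrA ler_wpM2r ?(ltW (grow_gt0 a z))//.
rewrite mulrAC ler_pdivlMr ?exprn_gt0//.
have b0 := ltW (bracket_gt0 z).
have := Hc (a * bracket z) (mulr_ge0 (ltW a0) b0); rewrite -/(grow a z) => H1.
apply: le_trans H1; rewrite exprMn mulrC ler_wpM2l ?sqr_ge0//.
by rewrite bracket_sqr lerDr.
Qed.

Lemma testsec_comb (a : R) s t : testsec s -> testsec t ->
  testsec (fun z => a%:C *: s z + t z).
Proof. by move=> Ts Tt; apply: testsec_add => //; exact: testsec_scalec. Qed.

Lemma dz_comb (a : R) s t z : sm s -> sm t ->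
  dz (fun z => a%:C *: s z + t z) z = a%:C *: dz s z + dz t z.
Proof.
move=> Ss St; rewrite (dz_add _ (sm_scalec _ Ss) St); congr (_ + _).
exact: dz_scalec.
Qed.

Definition ip (W : R * R -> R) s t : R := I2 (fun z => rh (s z) (t z) * W z).

Section InnerProduct.
Variable W : R * R -> R.
Hypothesis cW : continuous W.
Hypothesis W0 : forall z, 0 <= W z.

Lemma ip_Cc s t : sm s -> testsec t -> Cc (fun z => rh (s z) (t z) * W z).
Proof. by move=> Ss Tt; apply: Cc_mulr => //; exact: rh_Cc. Qed.

Lemma ip_sym s t : ip W s t = ip W t s.
Proof. by congr I2; apply/funext => z; rewrite rhC. Qed.

Lemma ip_comb (a : R) s t g : testsec s -> testsec t -> testsec g ->
  ip W (fun z => a%:C *: s z + t z) g = a * ip W s g + ip W t g.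
Proof.
move=> [Ss _] [St _] Tg.
have C1 := ip_Cc Ss Tg; have C2 := ip_Cc St Tg.
rewrite /ip -(I2_scale _ C1) -(I2_add (Cc_scale _ C1) C2).
by congr I2; apply/funext => z; rewrite rhDl rhZl mulrDl mulrA.
Qed.

Lemma ip_CS s t : testsec s -> testsec t -> ip W s t ^+ 2 <= nrm W s * nrm W t.
Proof.
apply: (@B_CS R sec (@testsec _ _ E) (fun a s t z => a%:C *: s z + t z) (ip W)).
- exact: testsec_comb.
- exact: ip_sym.
- by move=> x; exact: nrm_ge0.
- exact: ip_comb.
Qed.

End InnerProduct.

Lemma rh_lin_I2 (a : R) s t g : testsec s -> testsec t -> sm g ->
  I2 (fun z => rh (g z) (a%:C *: s z + t z)) =
  a * I2 (fun z => rh (g z) (s z)) + I2 (fun z => rh (g z) (t z)).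
Proof.
move=> Ts Tt Sg; have C1 := rh_Cc Sg Ts; have C2 := rh_Cc Sg Tt.
rewrite -(I2_scale _ C1) -(I2_add (Cc_scale _ C1) C2).
by congr I2; apply/funext => z; rewrite rhDr rhZr.
Qed.

(** Cauchy-Schwarz for the pairing of the weighted space with its dual. *)
Lemma rh_CS_dual (W : R * R -> R) s t : rsmooth_on setT W -> (forall z, 0 < W z) ->
  testsec s -> testsec t ->
  I2 (fun z => rh (s z) (t z)) ^+ 2 <=
  nrm W (fun z => ((W z)^-1)%:C *: s z) * nrm W t.
Proof.
move=> SW W0 Ts Tt.
have SV : rsmooth_on setT (fun z => (W z)^-1).
  by apply: rs_inv => //; [exact: openT|move=> z _; rewrite gt_eqF].
have Tu : testsec (fun z => ((W z)^-1)%:C *: s z) by exact: testsec_scaler.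
have := ip_CS (rs_continuous SW) (fun z => ltW (W0 z)) Tu Tt.
congr (_ ^+ 2 <= _); congr I2; apply/funext => z.
by rewrite rhZl; field; rewrite gt_eqF.
Qed.

Lemma rh_adj z (c : C) (x y : E z) : rh (c *: x) y = rh x (conjc c *: y).
Proof. by rewrite /rh hZl hZr conjcK. Qed.

Lemma rh_zbar z (x : E z) :
  rh (conjc (zc z) *: x) (conjc (zc z) *: x) = sqn z * rh x x.
Proof. by rewrite rh_abs ReJ ImJ sqrrN. Qed.

Lemma cderive_z_zbar z : cderive_z (fun w => conjc (@zc R w)) z = 0.
Proof.
have dzc : cdiff (@zc R) z by apply: (cs_cdiff (cs_zc _)).
rewrite /cderive_z (cderive_conj (1, 0) dzc) (cderive_conj (0, 1) dzc) !cderive_zc.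
have -> : conjc (zc (1, 0)) = 1 :> C by apply: complex_eq => //=; rewrite oppr0.
have -> : conjc (zc (0, 1)) = - 'i%C :> C by exact: conj_i.
by rewrite mulrN -expr2 sqr_i opprK subrr mulr0.
Qed.

(** Multiplication by zbar commutes with nabla_z: the coordinate zbar is
    antiholomorphic. *)
Lemma dz_zbar t z : sm t ->
  dz (fun y => conjc (zc y) *: t y) z = conjc (zc z) *: dz t z.
Proof.
move=> St; rewrite dz_mul//; last by apply: cs_conj; [exact: openT|exact: cs_zc].
by rewrite cderive_z_zbar scale0r add0r.
Qed.

Lemma cs_zbar : csmooth_on setT (fun w => conjc (@zc R w)).
Proof. by apply: cs_conj; [exact: openT|exact: cs_zc]. Qed.

Variables (a K0 : R).
Hypothesis a0 : 0 < a.
Hypothesis estimate : forall t, testsec t -> nrm (grow a) t <= K0 * nrm (grow a) (dz t).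
Variables (e f : sec).
Hypothesis Te : testsec e.
Hypothesis Tf : testsec f.
Hypothesis fE : forall z, zc z *: f z = dbar e z.

(** Solve dbar (w nabla_z t) = - f by minimization, with w = [grow a]. The
    estimate bounds t |-> I2 (rh f t) by the energy, and [approx_riesz] gives a
    minimizing sequence t_k. Then v_k = - w nabla_z t_k satisfies dbar v_k = f in
    the limit, and s_k = e - z v_k becomes holomorphic, as z f = dbar e. It is
    square integrable after doubling the weight because of the factor z. The
    last clause evaluates [L] wherever only the source [f] matters. *)
Lemma weak_limit_exists : exists (c : R) (s_ : nat -> sec) (L : sec -> R),
  [/\ 0 < c, weak_limit (fun z => c * grow (2 * a) z) s_ L &
   forall g th, testsec g -> testsec th ->
    (forall z, conjc (zc z) *: g z = dz th z) ->
    L g = I2 (fun z => rh (e z) (g z)) + I2 (fun z => rh (f z) (th z))].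
Proof.
have [Se _] := Te; have [Sf _] := Tf.
have cw : continuous (@grow R a) by exact: grow_continuous.
have w0 (z : R * R) : 0 <= grow a z by exact: ltW (grow_gt0 _ _).
have [c c0 Hc] := sqn_grow a0.
pose W z : R := c * grow (2 * a) z.
have W0 z : 0 < W z by rewrite mulr_gt0// grow_gt0.
have SW : rsmooth_on setT W.
  by apply: rs_mul; [exact: openT|exact: rs_cst|exact: rs_grow].
have cW := rs_continuous SW.
pose l t : R := I2 (fun z => rh (f z) (t z)).
pose B s t : R := ip (grow a) (dz s) (dz t).
pose A : R := nrm (grow a) (fun z => ((grow a z)^-1)%:C *: f z) * K0.
have lA t : testsec t -> l t ^+ 2 <= A * B t t.
  move=> Tt; apply: le_trans (rh_CS_dual (rs_grow a) (@grow_gt0 R a) Tf Tt) _.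
  rewrite /A -mulrA ler_wpM2l ?nrm_ge0//; exact: estimate.
have Bcomb k s t g : testsec s -> testsec t -> testsec g ->
    B (fun z => k%:C *: s z + t z) g = k * B s g + B t g.
  move=> Ts Tt Tg; rewrite /B -(ip_comb cw _ (testsec_dz Ts) (testsec_dz Tt) (testsec_dz Tg)).
  congr ip; apply: functional_extensionality_dep => z.
  by case: Ts Tt => Ss _ [St _]; exact: dz_comb.
have [t_ [Tt_ Hl Hq]] := @approx_riesz R sec (@testsec _ _ E)
  (fun k s t z => k%:C *: s z + t z) (fun=> 0) B l (testsec0 E) testsec_comb
  (fun s t => ip_sym (grow a) (dz s) (dz t)) (fun s => nrm_ge0 (dz s) w0) Bcomb
  (fun k s t Ts Tt => rh_lin_I2 k Ts Tt Sf) A lA.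
pose s_ k : sec := fun z => e z + (zc z * (grow a z)%:C) *: dz (t_ k) z.
have Ts_ k : testsec (s_ k).
  apply: testsec_add => //; apply: testsec_scale; last exact: testsec_dz.
  apply: cs_mul; [exact: openT|exact: cs_zc|apply: cs_real; exact: rs_grow].
pose al k g : R := I2 (fun z => rh (s_ k z) (g z)).
pose zb g : sec := fun z => conjc (zc z) *: g z.
have Tzb g : testsec g -> testsec (zb g) by move=> Tg; exact: testsec_scale cs_zbar Tg.
have alE k g : testsec g ->
    al k g = I2 (fun z => rh (e z) (g z)) + ip (grow a) (dz (t_ k)) (zb g).
  move=> Tg; have Sd := dz_smooth (proj1 (Tt_ k)).
  rewrite -(I2_add (rh_Cc Se Tg) (ip_Cc cw Sd (Tzb g Tg))).
  congr I2; apply/funext => z; rewrite /s_ rhDl; congr (_ + _).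
  by rewrite mulrC -scalerA rhZl rh_adj mulrC.
have nrm_zb g : testsec g -> nrm (grow a) (zb g) <= nrm W g.
  move=> Tg; apply: (I2_le (nrm_Cc cw (Tzb g Tg)) (nrm_Cc cW Tg)) => z.
  by rewrite rh_zbar mulrAC mulrC ler_wpM2l// rh_ge0.
have al_cauchy g : testsec g -> forall j k,
    (al k g - al j g) ^+ 2 <= (2 / j.+1%:R + 2 / k.+1%:R) * nrm W g.
  move=> Tg j k; rewrite !alE//.
  have Td : testsec (dz (fun z => (-1)%:C *: t_ j z + t_ k z)).
    by apply: testsec_dz; exact: testsec_comb.
  have -> : forall p q r : R, p + q - (p + r) = -1 * r + q by move=> p q r; ring.
  have Tj := testsec_dz (Tt_ j); have Tk := testsec_dz (Tt_ k).
  rewrite -(ip_comb cw _ Tj Tk (Tzb g Tg)).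
  have -> : (fun z => (-1)%:C *: dz (t_ j) z + dz (t_ k) z) =
      dz (fun z => (-1)%:C *: t_ j z + t_ k z).
    apply: functional_extensionality_dep => z.
    by rewrite (dz_comb _ _ (proj1 (Tt_ j)) (proj1 (Tt_ k))).
  apply: le_trans (ip_CS cw w0 Td (Tzb g Tg)) _.
  apply: ler_pM (nrm_zb g Tg); [exact: nrm_ge0|exact: nrm_ge0|exact: Hq].
have WN g : 0 <= nrm W g by apply: nrm_ge0 => z; exact: ltW.
pose L g : R := limn (fun k => al k g).
have HL g : testsec g -> cvgn (fun k => al k g) /\
    forall k, (al k g - L g) ^+ 2 <= 4 / k.+1%:R * nrm W g.
  by move=> Tg; apply: (cauchy_sqr (WN g)); exact: al_cauchy.
(* [l] is the limit of [B (t_ k)], so [L] is known on sections whose product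
   with the conjugate coordinate is a derivative. *)
have Ldz g th : testsec g -> testsec th -> (forall z, zb g z = dz th z) ->
    L g = I2 (fun z => rh (e z) (g z)) + l th.
  move=> Tg Tth gth.
  have zbE : zb g = dz th by exact: functional_extensionality_dep.
  apply: cvg_lim => //.
  apply: (@cvg_trans _ ((fun k => I2 (fun z => rh (e z) (g z)) + B (t_ k) th) @ \oo)).
    by apply: near_eq_cvg; near=> k; rewrite (alE k g Tg) zbE.
  apply: (@cvgD _ R^o); first exact: cvg_cst.
  apply/cvgrPdist_lt => r r0.
  have q0 : 0 <= B th th by exact: nrm_ge0.
  exists (Num.truncn (B th th / r ^+ 2)) => // k /= Hk.
  rewrite distrC -(@ltr_pXn2r _ 2)// ?nnegrE// ?(ltW r0)// real_normK ?num_real//.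
  apply: le_lt_trans (Hl k th Tth) _.
  have k0 : 0 < k.+1%:R :> R by rewrite ltr0Sn.
  rewrite mulrC ltr_pdivrMr// [ltRHS]mulrC -ltr_pdivrMr ?exprn_gt0//.
  apply: lt_le_trans (truncnS_gt _) _.
  by rewrite ler_nat.
exists c, s_, L; split=> //; split=> //.
- move=> k g1 g2 T1 T2; apply: cvg_lim => //.
  have [C1 _] := HL g1 T1; have [C2 _] := HL g2 T2.
  apply: (@cvg_trans _ ((fun j => k * al j g1 + al j g2) @ \oo)).
    by apply: near_eq_cvg; near=> j; rewrite /al (rh_lin_I2 k T1 T2 (proj1 (Ts_ j))).
  by apply: (@cvgD _ R^o) => //; apply: cvgMr; exact: C1.
(* The first term of the sequence bounds [L], which it approximates up to
   4 * nrm W g. *)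
- set N := nrm W (fun z => ((W z)^-1)%:C *: s_ 0%N z).
  exists (2 * N + 8); first by rewrite addr_ge0// mulr_ge0// WN.
  move=> g Tg; have [_ /(_ 0%N) H1] := HL g Tg.
  have H2 := rh_CS_dual SW W0 (Ts_ 0%N) Tg; rewrite -/(al 0%N g) -/N in H2.
  have H3 := sqr_ge0 (2 * al 0%N g - L g).
  rewrite mulrDl -mulrA; move: H1 H2 H3; rewrite divr1.
  rewrite -/W; move: N (al 0%N g) (L g) (nrm W g) => p b d q.
  by move: (p * q) => r; lra.
- move=> r r0; exists (Num.truncn (4 / r)) => g Tg.
  have [_ /(_ (Num.truncn (4 / r)))] := HL g Tg; move=> /le_trans; apply.
  rewrite ler_wpM2r// ler_pdivrMr ?ltr0Sn// mulrC -ler_pdivrMr//.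
  exact: ltW (truncnS_gt _).
move=> t Tt; have [St _] := Tt.
rewrite (Ldz _ (zb t) (testsec_dz Tt) (Tzb t Tt)); last first.
  by move=> z; rewrite /zb dz_zbar.
have -> : l (zb t) = I2 (fun z => rh (dbar e z) (t z)).
  by congr I2; apply/funext => z; rewrite -fE rh_adj.
by rewrite (dbar_dz_adjoint Se Tt) subrr.
Unshelve. all: by end_near. Qed.

End Existence.

(** * Non-triviality and square integrability *)

Section Source.
Variables (R : realType) (n : nat) (E : hermitian_holomorphic_bundle R n).
Notation C := R[i].
Notation Re := (@complex.Re R).
Notation Im := (@complex.Im R).
Notation sec := (section E).
Notation sm s := (smooth_section (complex_coeffs R) (s : sec)).
Notation h := (metric E).
Implicit Types (s t g : sec) (z v : R * R).

Lemma ball0E (r : R) z : ball (0 : R * R) r z <-> `|z| < r.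
Proof. by rewrite -ball_normE /= sub0r normrN. Qed.

Lemma zc_eq0 z : (zc z == 0) = (z == 0).
Proof. by case: z => x y; apply/eqP/eqP => -[-> ->]. Qed.

(** Division by the coordinate is smooth on sections that vanish near its zero. *)
Lemma zc_divide (r : R) g : 0 < r -> testsec g ->
  (forall z, ball 0 r z -> g z = 0) ->
  exists f : sec, [/\ testsec f, forall z, zc z *: f z = g z &
    forall z, ball 0 r z -> f z = 0].
Proof.
move=> r0 [Sg [N HN]] g0; exists (fun z => (zc z)^-1 *: g z); split.
- split; last by exists N => z /HN ->; rewrite scaler0.
  apply/sec_onT; apply: sec_on_local => z _.
  have [->|zn] := eqVneq z 0.
    exists (ball 0 r), (fun=> 0); split; [exact: ball_open|exact: ballxx|exact: sec_on0|].
    by move=> y /g0 ->; rewrite scaler0.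
  have oV : open (~` [set (0 : R * R)]) by apply: closed_openC; by apply: accessible_closed_set1; apply: hausdorff_accessible; exact: norm_hausdorff.
  exists (~` [set 0]), (fun z => (zc z)^-1 *: g z); split=> //; first exact/eqP.
  apply: sec_on_scale => //; last exact: sm_sec_on.
  by apply: cs_inv => //; [move=> y /eqP; rewrite zc_eq0|exact: cs_zc].
- move=> z; have [->|zn] := eqVneq z 0.
    by rewrite g0 ?scaler0//; exact: ballxx.
  by rewrite scalerA divff ?scale1r// zc_eq0.
by move=> z /g0 ->; rewrite scaler0.
Qed.

(** d chi / dz = - zbar rho / 2: this writes zbar * rho as a derivative. *)
Lemma cderive_z_chi (d : R) z :
  (-2)%:C * cderive_z (fun y => (chi d y)%:C) z = conjc (zc z) * (rho d z)%:C.
Proof.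
rewrite cderive_z_real (D_chi d (1, 0)) (D_chi d (0, 1)).
move: (rho d z) => q; apply: complex_eq;
  rewrite !(ReM, ImM, ReD, ImD, ReN, ImN, ReJ, ImJ, ReR, ImR, Rei, Imi) /=;
  by rewrite !(mul0r, mulr0, subr0, sub0r, add0r, mul1r, mulr1, oppr0, addr0); field.
Qed.

(** Take g = rho eps_j with a small radius. As zbar * g = nabla_z (-2 chi eps_j)
    and the source vanishes where chi does not, the limit functional takes at g
    the value of the integral of rho. The correction z v_k, which vanishes at
    the origin to first order, cannot cancel e_j there. *)
Lemma source_test (r : R) (e eps : 'I_n -> sec) (j : 'I_n) :
  local_frame 0 r e eps -> exists g th : sec,
  [/\ testsec g, testsec th, forall z, conjc (zc z) *: g z = dz th z,
      forall z, ~ ball 0 r z -> th z = 0 &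
      0 < I2 (fun z => rh (e j z) (g z))].
Proof.
move=> fr; have r0 := frame_r fr; pose d : R := r / 2.
have d0 : 0 < d by rewrite divr_gt0.
have dr : d < r by rewrite /d; lra.
have out z : ~ ball 0 r z -> d <= `|z|.
  by move=> /ball0E/negP; rewrite -leNgt; exact/le_trans/ltW.
have Teps := frame_eps fr j; have [Seps _] := Teps.
have Schi := rs_chi d; have Srho := rs_rho d.
pose u : sec := fun z => (chi d z)%:C *: eps j z.
have Tu : testsec u by exact: testsec_scaler.
exists (fun z => (rho d z)%:C *: eps j z), (fun z => (-2)%:C *: u z); split.
- exact: testsec_scaler.
- exact: testsec_scalec.
- move=> z; rewrite (dz_scalec _ _ (proj1 Tu)) dz_mul//; last exact: cs_real.
  rewrite scalerDr [X in _ = X + _]scalerA cderive_z_chi -scalerA.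
  rewrite [X in _ = _ + X](_ : _ = 0) ?addr0//.
  have [zr|/out zd] := pselect (ball (0 : R * R) r z).
    by rewrite (frame_dz fr zr) !scaler0.
  by rewrite chi_norm0// scale0r scaler0.
- by move=> z /out zd; rewrite /u chi_norm0// scale0r scaler0.
rewrite [X in 0 < X](_ : _ = I2 (rho d)); first exact: I2_rho_gt0.
congr I2; apply/funext => z; rewrite rhZr.
have [zr|/out zd] := pselect (ball (0 : R * R) r z).
  by rewrite /rh (frame_dual fr zr) eqxx mulr1.
by rewrite rho_norm0// mul0r.
Qed.

Notation mR := (measurableTypeR R).
Notation mP := (mR * mR)%type.

Lemma smooth_measurable s : sm s -> measurable_section s.
Proof.
move=> Ss i k; have [S1 S2] := Ss i k.
have oD : open (dom E i) by exact: dom_open.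
split; apply: continuous_measurable_plane => // z di;
  apply: differentiable_continuous; [exact: rs_diff S1 di|exact: rs_diff S2 di].
Qed.

(** Monotone convergence over the squares on which the cutoffs equal one. *)
Lemma L2_of_cutoffs (W phi : R * R -> R) s (M K : R) : sm s ->
  continuous W -> (forall z, 0 < W z) -> continuous phi -> (forall z, 0 <= phi z) ->
  0 <= M -> (forall z, phi z <= M * (W z)^-1) ->
  (forall N : R, 0 < N -> I2 (fun z => chi N z * (rh (s z) (s z) / W z)) <= K) ->
  (L2normsq phi s < +oo)%E.
Proof.
move=> Ss cW W0 cphi phi0 M0 Hphi HK.
have crh : continuous (fun z => rh (s z) (s z)).
  by apply: rs_continuous; exact: rh_smooth.
pose f (z : mP) : \bar R := (normsq s z * phi z)%:E.
have f0 z : (0 <= f z)%E by rewrite lee_fin mulr_ge0// rh_ge0.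
have mf : measurable_fun setT f.
  apply/measurable_EFinP; apply: continuous_measurable_fun_plane => z.
  by apply: cvgM; [exact: crh|exact: cphi].
pose F (i : nat) : set mP := sq i%:R.
have mF i : measurable (F i) by exact: sq_measurable.
have ndF : nondecreasing_seq F.
  move=> i j ij; apply/subsetPset => z /le_trans; apply.
  by rewrite ler_nat.
have UF : \bigcup_i F i = setT.
  apply/seteqP; split=> // z _; exists (Num.truncn `|z|).+1 => //=.
  by rewrite /F /sq /= ltW// truncnS_gt.
have bound i : (\int[plane_measure R]_(z in F i) f z <= (M * K)%:E)%E.
  pose d : R := 4 * (i%:R + 1).
  have d0 : 0 < d by rewrite mulr_gt0// ltr_wpDl.
  pose g z : R := chi d z * (rh (s z) (s z) / W z).
  have Cg : Cc g.
    split; last by exists d => z zd; rewrite /g chi_norm0// mul0r.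
    move=> z; apply: cvgM; first by apply: (rs_continuous (rs_chi d)).
    apply: cvgM; first exact: crh.
    by apply: cvgV; [rewrite gt_eqF|exact: cW].
  have g0 z : 0 <= g z.
    by rewrite mulr_ge0 ?chi_ge0// divr_ge0 ?rh_ge0// ltW.
  have CMg := Cc_scale M Cg.
  have mg : measurable_fun setT (fun z : mP => (M * g z)%:E).
    by apply/measurable_EFinP; apply: continuous_measurable_fun_plane; case: CMg.
  have Mg0 (z : mP) : (0 <= (M * g z)%:E)%E by rewrite lee_fin mulr_ge0.
  apply: (@le_trans _ _ (\int[plane_measure R]_(z in F i) (M * g z)%:E)%E).
    apply: ge0_le_integral => //; try (by apply: measurable_funTS).
    move=> z Fz; rewrite lee_fin /g chi_norm1// ?mul1r.
      have := ler_wpM2l (rh_ge0 (s z)) (Hphi z).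
      by rewrite /normsq -/(rh (s z) (s z)) [leRHS]mulrCA.
    by apply: le_trans Fz _; rewrite /d mulrC mulKf// lerDl.
  apply: (@le_trans _ _ (\int[plane_measure R]_z (M * g z)%:E)%E).
    by apply: ge0_subset_integral.
  by rewrite -(I2_E CMg) (I2_scale _ Cg) lee_fin ler_wpM2l// HK.
have cv := @ge0_nondecreasing_set_cvg_integral _ _ _ F f (plane_measure R) ndF mF
  (fun i => measurable_funTS mf) (fun i x _ => f0 x).
rewrite UF in cv.
apply: (@le_lt_trans _ _ (M * K)%:E); last exact: ltry.
rewrite /L2normsq -/f -(cvg_lim _ cv)//; apply: lime_le; first by apply: cvgP cv.
exact: nearW.
Qed.

End Source.

(** * The holomorphic section *)

Section Gap.
Variables (R : realType) (n : nat) (E : hermitian_holomorphic_bundle R n).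
Variables (xi : euclidean_bundle R n) (iota : forall z : R * R, xi z -> E z).
Hypothesis cx : is_complexification iota.

(** Apply the gap to the conjugate of [t]. *)
Lemma gap_conj (a kappa : R) :
  (forall s : section E, smooth_section (complex_coeffs R) s -> compactly_supported s ->
     (kappa%:E * L2normsq (exp_weight a) s <= L2normsq (exp_weight a) (dbar s))%E) ->
  forall t : section E, testsec t ->
    kappa * nrm (exp_weight a) t <= nrm (exp_weight a) (dz t).
Proof.
move=> gap t Tt; have [ct [Tct N1 N2]] := conj_section cx Tt.
have cw : continuous (exp_weight a) by exact: exp_weight_continuous.
have := gap ct (proj1 Tct) (testsec_compact Tct).
rewrite (L2normsqE cw Tct) (L2normsqE cw (testsec_dbar Tct)) -EFinM lee_fin.
congr (_ * _ <= _); congr I2; apply/funext => z.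
  by rewrite N1.
by rewrite N2.
Qed.

End Gap.

Lemma exp_weight_le (R : realType) (a : R) (z : R * R) : 0 <= a ->
  exp_weight a z <= expR a / grow a z.
Proof.
move=> a0; rewrite ler_pdivlMr ?grow_gt0//.
rewrite -(ler_pM2l (grow_gt0 a z)).
have := grow_weight_hi z a0; rewrite expr2 -mulrA [exp_weight a z * _]mulrC.
by rewrite [grow a z * expR a]mulrC.
Qed.

Theorem corollary4p2 (R : realType) (n : nat) (n_gt0 : (0 < n)%N)
    (E : hermitian_holomorphic_bundle R n) (kappa0 eps0 : R)
    (kappa0_gt0 : 0 < kappa0) (eps0_gt0 : 0 < eps0)
    (spectral_gap : forall eps : R, 0 < eps -> eps < eps0 ->
       forall s : section E,
         smooth_section (complex_coeffs R) s -> compactly_supported s ->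
         (kappa0%:E * L2normsq (exp_weight eps) s <=
          L2normsq (exp_weight eps) (dbar s))%E)
    (E_complexification : exists (xi : euclidean_bundle R n)
       (iota : forall z : R * R, xi z -> E z), is_complexification iota) :
  forall eps : R, 0 < eps ->
    eps < Num.min (eps0 / 2) (Num.sqrt kappa0 / 2) ->
    exists s : section E,
      [/\ holomorphic_section s,
          (exists z, s z != 0) &
          in_L2 (exp_weight (4 * eps)) s].
Proof.
move=> eps eps_gt0; rewrite lt_min => /andP[eps1 eps2].
have [xi [iota cx]] := E_complexification.
pose a := 2 * eps.
have a0 : 0 < a by rewrite mulr_gt0.
have a1 : a < eps0 by rewrite /a mulrC -ltr_pdivlMr.
have a2 : a ^+ 2 < kappa0.
  have h : a < Num.sqrt kappa0 by rewrite /a mulrC -ltr_pdivlMr.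
  rewrite -(sqr_sqrtr (ltW kappa0_gt0)).
  by rewrite ltr_pXn2r// ?nnegrE ?sqrtr_ge0// ltW.
have est := gap_grow a0 kappa0_gt0 a2 (gap_conj cx (spectral_gap a a0 a1)).
have [r [e [d fr]]] := frame_exists E 0; pose j := Ordinal n_gt0.
have r0 := frame_r fr.
have Te := frame_e fr j; have Tde := testsec_dbar Te.
have de0 z : ball (0 : R * R) r z -> dbar (e j) z = 0.
  by move=> zr; exact: (frame_dbar fr zr).
have [f [Tf fE f0]] := zc_divide r0 Tde de0.
have [c [s_ [L [c0 wl Lsrc]]]] := weak_limit_exists a0 est Te Tf fE.
have [S [hS LS]] := global_representation wl.
have [Sm _] := hS.
exists S; split=> //.
- have [g [th [Tg Tth gth th0 pos]]] := source_test j fr.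
  apply: contrapT => /forallNP S0.
  move: pos; have := Lsrc g th Tg Tth gth; rewrite (LS g Tg).
  have -> : (fun z => rh (S z) (g z)) = fun=> 0.
    apply/funext => z; have /negP := S0 z; rewrite negbK => /eqP ->.
    by rewrite /rh h0l.
  have -> : (fun z => rh (f z) (th z)) = fun=> 0.
    apply/funext => z; have [zr|zr] := pselect (ball (0 : R * R) r z).
      by rewrite f0// /rh h0l.
    by rewrite th0// /rh h0r.
  by rewrite I2_0 addr0 => <-; rewrite ltxx.
- split; first exact: smooth_measurable.
  have SW : rsmooth_on setT (fun z : R * R => c * grow (2 * a) z).
    by apply: rs_mul; [exact: openT|exact: rs_cst|exact: rs_grow].
  have [K HK] := representation_L2 wl SW Sm LS.
  have a4 : 4 * eps = 2 * a by rewrite /a mulrA -natrM.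
  have b0 : 0 <= 2 * a by rewrite mulr_ge0// ltW.
  rewrite a4.
  apply: (@L2_of_cutoffs _ _ _ (fun z => c * grow (2 * a) z) _ _
    (c * expR (2 * a)) K Sm) => //.
  + exact: rs_continuous SW.
  + by move=> z; rewrite mulr_gt0// grow_gt0.
  + exact: exp_weight_continuous.
  + by move=> z; exact: expR_ge0.
  + by rewrite mulr_ge0 ?expR_ge0// ltW.
  move=> z; apply: le_trans (exp_weight_le z b0) _.
  by rewrite invfM mulrACA divff ?mul1r// gt_eqF.
Qed.
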